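(* Let $n\in\{2,3\}$. Consider a solitary wave with localized vorticity in Case I (that is, Case I-A or Case I-B) or Case II, and suppose that for some $\varepsilon\in(0,1/4)$ the velocity $u$ (respectively $u_\pm$ in Case II) and the free surface profile $\eta$ satisfy $$\eta\in C^2_{\mathrm{bdd}}(\mathbb{R}^{n-1}),\qquad \partial^\beta\eta=O\left(\frac1{|x'|^{n-1+|\beta|+4\varepsilon}}\right)\ \text{ as }|x'|\to\infty,\ 0\le|\beta|\le1,$$ $$u=O\left(\frac1{|x|^{n-1+\varepsilon}}\right)\ \text{ as }|x|\to\infty.$$ If $\eta \geq 0$ or $\eta \leq 0$, then $\eta \equiv 0$. Moreover, there is no excess mass: $$\int_{\mathbb{R}^{n-1}} \eta \, dx' = 0.$$
   Context: Write $x=(x',x_n)\in\mathbb{R}^{n-1}\times\mathbb{R}$. Fix $g>0$, $\sigma\ge0$ and a horizontal wave velocity $c=(c',0)\in\mathbb{R}^n$. $C^2_{\mathrm{bdd}}$ is the space of $C^2$ functions bounded together with their derivatives up to order two. A solitary wave is a traveling wave (written in the moving frame) whose profile $\eta:\mathbb{R}^{n-1}\to\mathbb{R}$ vanishes at infinity. Case I (one fluid). $\Omega=\{x_n<\eta(x')\}$, $S=\partial\Omega$, $N=(-\nabla\eta,1)/\sqrt{1+|\nabla\eta|^2}$ the outward unit normal. The velocity $u$ and pressure $P$ satisfy, in the weak sense, $$(u-c)\cdot\nabla u+\nabla P+ge_n=0,\quad\nabla\cdot u=0\ \text{ in }\Omega,\qquad (u-c)\cdot N=0,\quad P=\sigma\nabla\cdot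 N\ \text{ on }S.$$ The vorticity is $\omega=\partial_{x_1}u_2-\partial_{x_2}u_1$ if $n=2$, and $\omega=\nabla\times u$ if $n=3$. Case I-A: $\omega\in L^1(\Omega)\cap L^\infty(\Omega)$ and $|x|^k\omega\in L^1(\Omega)$ for some $k>n^2$; if $n=3$, also $\omega\cdot N=0$ on $S$ (normal trace in $H^{-1/2}(S)$, as $\omega$ is divergence free). Case I-B ($n=2$ only): $\omega=\sum_{i=1}^M\varpi^i\delta_{\xi^i}+\omega_{\mathrm{ac}}$ with $\Xi=\{\xi^1,\dots,\xi^M\}\subset\Omega$, $\varpi^i\in\mathbb{R}$, and $\omega_{\mathrm{ac}}$ satisfying the integrability conditions of Case I-A. The Euler equations hold in the distributional sense on $\Omega\setminus\Xi$, and $c=\big(u-\frac1{2\pi}\varpi^i\nabla^\perp\log|\cdot-\xi^i|\big)\big|_{\xi^i}$ for $i=1,\dots,M$, where $\nabla^\perp=(-\partial_{x_2},\partial_{x_1})$. Case II (vortex sheet). $\Omega_-=\{x_n<\eta\}$, $\Omega_+=\{x_n>\eta\}$, $\Omega=\Omega_+\cup\Omega_-$, $S=\partial\Omega_\pm$, with (possibly different) constant densities $\rho_\pm>0$; $u_\pm,P_\pm$ are the restrictions of $u,P$ to $\Omega_\pm$ and $N_\pm$ is the outward unit normal to $\Omega_\pm$. One requires $$(u_\pm-c)\cdot\nabla u_\pm+\tfrac1{\rho_\pm}\nabla P_\pm+ge_n=0,\quad\nabla\cdot u_\pm=0,\quad\nabla\times u_\pm=0\ \text{ in }\Omega_\pm,$$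 $$N_\pm\cdot(u_\pm-c)=0,\qquad P_+-P_-=\sigma\nabla\cdot N_+=-\sigma\nabla\cdot N_-\ \text{ on }S.$$
   Formalization: In Case II the two densities are assumed different; with equal densities the claim fails: c = 0, σ = 0, u = 0, P = −ρ g x_n solves all the equations for every profile η, for instance a nonzero compactly supported η ≥ 0. *)

(* Defs.v *)
From HB Require Import structures.
From mathcomp Require Import all_boot all_order all_algebra.
From mathcomp Require Import all_classical all_reals all_analysis.

Set Implicit Arguments.
Unset Strict Implicit.
Unset Printing Implicit Defensive.
Import Order.TTheory GRing.Theory Num.Theory.
Import numFieldNormedType.Exports.
Local Open Scope classical_set_scope.
Local Open Scope ring_scope.

(** The space R^n is ['rV[R]_n].  A point of R^(m+1) = R^m x R is written
    x = (x', x_(m+1)), the last coordinate being the vertical one; with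
    n = m + 1 the surface profile is a function on R^(n-1) = R^m. *)

Section coordinates.
Context {R : realType}.

Definition join m (x' : 'rV[R]_m) (t : R) : 'rV[R]_m.+1 :=
  \row_j (if unlift ord_max j is Some i then x' 0 i else t).

Definition horiz m (x : 'rV[R]_m.+1) : 'rV[R]_m := col' ord_max x.

Definition vert m (x : 'rV[R]_m.+1) : R := x 0 ord_max.

Definition dot n (x y : 'rV[R]_n) : R := \sum_i x 0 i * y 0 i.

(* The library norm on ['rV[R]_n] is the sup norm. *)
Definition enorm n (x : 'rV[R]_n) : R := Num.sqrt (dot x x).

Lemma horiz_join m (x' : 'rV[R]_m) t : horiz (join x' t) = x'.
Proof. by apply/rowP => i; rewrite !mxE liftK. Qed.

Lemma vert_join m (x' : 'rV[R]_m) t : vert (join x' t) = t.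
Proof. by rewrite /vert mxE unlift_none. Qed.

End coordinates.

(** Lebesgue measure on R^n.  The sigma-algebra is the product one, i.e. the
    Borel sigma-algebra of ['rV[R]_n]; the measure is the iterated product of
    [lebesgue_measure], transported along [join]. *)

Definition matrix_display : measure_display -> measure_display.
Proof. exact. Qed.

Section matrix_measurable.
Context d (T : measurableType d) (m n : nat).

Definition coord_cylinder : set (set 'M[T]_(m, n)) :=
  [set A | exists i j, exists2 B : set T,
    measurable B & A = (fun M : 'M[T]_(m, n) => M i j) @^-1` B].

HB.instance Definition _ := @isMeasurable.Build (matrix_display d)
  'M[T]_(m, n) <<s coord_cylinder >> (@sigma_algebra0 _ setT coord_cylinder)
  (@sigma_algebraC _ coord_cylinder)
  (@sigma_algebra_bigcup _ setT coord_cylinder).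

Lemma measurable_coord i j :
  measurable_fun [set: 'M[T]_(m, n)] (fun M : 'M[T]_(m, n) => M i j).
Proof.
move=> _ B mB; rewrite setTI; apply: sub_sigma_algebra.
by exists i, j, B.
Qed.

Lemma measurable_fun_matrix d' (X : measurableType d') (f : X -> 'M[T]_(m, n)) :
  (forall i j, measurable_fun setT (fun x => f x i j)) -> measurable_fun setT f.
Proof.
move=> mf; apply: (@measurability _ _ X 'M[T]_(m, n) _ _ coord_cylinder) => //.
move=> _ [_ [i [j [B mB ->]]] <-].
by rewrite setTI; have := mf i j measurableT B mB; rewrite setTI.
Qed.

End matrix_measurable.

Section lebesgue_rV.
Context {R : realType}.

Let joinp m (p : 'rV[R]_m * R) : 'rV[R]_m.+1 := join p.1 p.2.

Let measurable_joinp m : measurable_fun setT (@joinp m).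
Proof.
apply: measurable_fun_matrix => i j.
under eq_fun do rewrite mxE.
case: (unlift _ _) => [k|]; last exact: measurable_snd.
exact: (measurableT_comp (measurable_coord 0 k) measurable_fst).
Qed.

Let measurable_split m :
  measurable_fun setT (fun x : 'rV[R]_m.+1 => (horiz x, vert x)).
Proof.
apply: measurable_fun_pair; last exact: measurable_coord.
apply: measurable_fun_matrix => i j.
under eq_fun do rewrite mxE.
exact: measurable_coord.
Qed.

Section step.
Variables (m : nat) (mu : {sigma_finite_measure set 'rV[R]_m -> \bar R}).

Definition lebesgue_step : set 'rV[R]_m.+1 -> \bar R :=
  pushforward (mu \x @lebesgue_measure R)%E (fun p => join p.1 p.2).

Let ls0 : lebesgue_step set0 = 0%E.
Proof. by rewrite /lebesgue_step /pushforward preimage_set0 measure0. Qed.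

Let ls_ge0 A : (0 <= lebesgue_step A)%E.
Proof. by rewrite /lebesgue_step /pushforward measure_ge0. Qed.

Let ls_sigma : semi_sigma_additive lebesgue_step.
Proof.
move=> F mF tF mUF; rewrite /lebesgue_step /pushforward preimage_bigcup.
have mj A : measurable A -> measurable (@joinp m @^-1` A).
  by move=> mA; rewrite -[X in measurable X]setTI; exact: measurable_joinp.
apply: measure_semi_sigma_additive.
- by move=> n; exact: mj.
- apply/trivIsetP => /= i j _ _ ij; rewrite -preimage_setI.
  by move/trivIsetP : tF => /(_ _ _ _ _ ij) ->//; rewrite preimage_set0.
- by rewrite -preimage_bigcup; exact: mj.
Qed.

HB.instance Definition _ := isMeasure.Build _ _ _ lebesgue_step
  ls0 ls_ge0 ls_sigma.

Let ls_sigma_finite : sigma_finite setT lebesgue_step.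
Proof.
have /sigma_finiteP[F [FT ndF Foo]] := sigma_finiteT mu.
have /sigma_finiteP[G [GT ndG Goo]] := sigma_finiteT (@lebesgue_measure R).
exists (fun k => (fun x : 'rV[R]_m.+1 => (horiz x, vert x)) @^-1`
                   (F k `*` G k)).
  apply/seteqP; split=> // x _.
  have [n _ Fn] : (\bigcup_n F n) (horiz x) by rewrite -FT.
  have [k _ Gk] : (\bigcup_n G n) (vert x) by rewrite -GT.
  exists (maxn n k) => //; split.
  - by move: Fn; exact/subsetPset/ndF/leq_maxl.
  - by move: Gk; exact/subsetPset/ndG/leq_maxr.
move=> k; have [mFk Fkoo] := Foo k; have [mGk Gkoo] := Goo k; split.
  rewrite -[X in measurable X]setTI; apply: measurable_split => //.
  exact: measurableX.
rewrite /lebesgue_step /pushforward -comp_preimage.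
rewrite (_ : _ \o _ = id); last first.
  by apply/funext => -[x' t] /=; rewrite horiz_join vert_join.
by rewrite preimage_id product_measure1E// lte_mul_pinfty// ge0_fin_numE.
Qed.

HB.instance Definition _ := Measure_isSigmaFinite.Build _ _ _ lebesgue_step
  ls_sigma_finite.

End step.

Let dirac0_sigma_finite : sigma_finite setT (@dirac _ 'rV[R]_0 0 R).
Proof.
exists (fun=> setT); first by rewrite bigcup_const.
by move=> k; split=> //; rewrite diracE ltry.
Qed.

Fixpoint lebesgue_rV_rec n : {sigma_finite_measure set 'rV[R]_n -> \bar R} :=
  match n with
  | 0 => [the {sigma_finite_measure set _ -> \bar R} of
           (@dirac _ 'rV[R]_0 0 R : set _ -> \bar R)]
  | m.+1 => [the {sigma_finite_measure set _ -> \bar R} of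
           lebesgue_step (lebesgue_rV_rec m)]
  end.

Definition lebesgue_rV n : set 'rV[R]_n -> \bar R := lebesgue_rV_rec n.

HB.instance Definition _ n := SigmaFiniteMeasure.copy (@lebesgue_rV n)
  (lebesgue_rV_rec n : set _ -> \bar R).

End lebesgue_rV.

(** Differential calculus and test functions. *)

Section calculus.
Context {R : realType}.

Definition pderiv n (i : 'I_n) (f : 'rV[R]_n -> R) : 'rV[R]_n -> R :=
  fun x => 'D_(delta_mx 0 i) f x.

(* The multi-index of [pderivs s f] is encoded by the sequence s of the
   directions of differentiation, so that its order is [size s]. *)
Definition pderivs n (s : seq 'I_n) (f : 'rV[R]_n -> R) : 'rV[R]_n -> R :=
  foldr (@pderiv n) f s.

Definition class_C n (k : nat) (f : 'rV[R]_n -> R) : Prop :=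
  forall s : seq 'I_n, (size s <= k)%N ->
    continuous (pderivs s f) /\
    ((size s < k)%N ->
       forall i x, derivable (pderivs s f) x (delta_mx 0 i)).

Definition C2_bdd n (f : 'rV[R]_n -> R) : Prop :=
  class_C 2 f /\
  forall s : seq 'I_n, (size s <= 2)%N ->
    exists M, forall x, `|pderivs s f x| <= M.

(* [test_fun V phi] is phi in C_c^oo(V), for V open. *)
Definition test_fun n (V : set 'rV[R]_n) (phi : 'rV[R]_n -> R) : Prop :=
  [/\ forall k, class_C k phi,
      compact (closure [set x | phi x != 0]) &
      closure [set x | phi x != 0] `<=` V].

Definition test_field n (V : set 'rV[R]_n) (psi : 'rV[R]_n -> 'rV[R]_n) : Prop :=
  forall i, test_fun V (fun x => psi x 0 i).

(* f = O(|x|^-a) as |x| -> oo with x in D. *)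
Definition decays n (D : set 'rV[R]_n) (a : R) (f : 'rV[R]_n -> R) : Prop :=
  exists C r : R, forall x, D x -> r < enorm x ->
    `|f x| <= C * enorm x `^ (- a).

Definition vanishes_at_infinity n (f : 'rV[R]_n -> R) : Prop :=
  forall e, 0 < e -> exists r, forall x, r < enorm x -> `|f x| < e.

(* Integrability on the D-part of compact sets avoiding Xi: the compact sets
   may meet the boundary of D. *)
Definition loc_integrable n (D Xi : set 'rV[R]_n) (f : 'rV[R]_n -> R) : Prop :=
  forall K, compact K -> K `<=` ~` Xi ->
    (@lebesgue_rV R n).-integrable (D `&` K) (EFin \o f).

End calculus.

(** The free surface S = {x_n = eta(x')}. *)

Section surface.
Context {R : realType} (m : nat) (eta : 'rV[R]_m -> R).

Definition below : set 'rV[R]_m.+1 := [set x | vert x < eta (horiz x)].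
Definition above : set 'rV[R]_m.+1 := [set x | eta (horiz x) < vert x].

Definition grad (x' : 'rV[R]_m) : 'rV[R]_m := \row_i pderiv i eta x'.

Definition area (x' : 'rV[R]_m) : R := Num.sqrt (1 + dot (grad x') (grad x')).

(* The unit normal pointing out of [below eta], as a function of x' alone. *)
Definition normal (x' : 'rV[R]_m) : 'rV[R]_m.+1 :=
  (area x')^-1 *: join (- grad x') 1.

(* Only horizontal derivatives occur, N being independent of x_n. *)
Definition div_normal (x' : 'rV[R]_m) : R :=
  \sum_(i < m) pderiv i (fun y => normal y 0 (lift ord_max i)) x'.

Definition surface_integral (f : 'rV[R]_m -> R) : R :=
  (\int[@lebesgue_rV R m]_x' (f x' * area x'))%R.

End surface.

(** Weak form of the equations.

    The equations are tested against functions that need not vanish on S, so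
    that the boundary conditions on S are part of the weak equations (U is the
    region occupied by a fluid of density rho, N its outward unit normal):
    - div u = 0 in U and (u - c).N = 0 on S become
        int_U (u - c).grad phi = 0;
    - since div (u - c) = 0, the stress tensor
        T = rho (u - c) (x) u + P I   has   div T = - rho g e_n   in U,
      and T N = P N on S, so that for every vector field psi
        int_U (T : grad psi - rho g psi_n) = int_S P N.psi dS,
      in which the dynamic condition gives the value of P on S.
    The set Xi collects the point vortices, which the supports of the test
    functions avoid. *)

Section weak_equations.
Context {R : realType} (m : nat).
Local Notation space := 'rV[R]_m.+1.
Local Notation leb := (@lebesgue_rV R m.+1).
Variables (g : R) (c : space) (Xi U : set space) (u : space -> space)
  (P : space -> R).

(* The regularity which gives a meaning to the weak equations. *)
Definition admissible : Prop :=
  [/\ forall i, loc_integrable U set0 (fun x => u x 0 i),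
      forall i, loc_integrable U Xi (fun x => u x 0 i ^+ 2) &
      loc_integrable U Xi P].

Definition incompressible_tangential : Prop :=
  forall phi, test_fun (~` Xi) phi ->
    (\int[leb]_(x in U)
       (\sum_j (u x 0 j - c 0 j) * pderiv j phi x))%R = 0.

Definition momentum (rho : R) (psi : space -> space) : R :=
  (\int[leb]_(x in U)
     (rho * (\sum_i \sum_j (u x 0 j - c 0 j) * u x 0 i *
               pderiv j (fun y => psi y 0 i) x)
      + P x * (\sum_i pderiv i (fun y => psi y 0 i) x)
      - rho * g * vert (psi x)))%R.

(* The distribution d_i u_j - d_j u_i in U. *)
Definition curl (i j : 'I_m.+1) (phi : space -> R) : R :=
  (\int[leb]_(x in U) (u x 0 i * pderiv j phi x - u x 0 j * pderiv i phi x))%R.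

Definition irrotational : Prop :=
  forall i j phi, test_fun U phi -> curl i j phi = 0.

(* int_S sigma (div N) N.psi dS, N pointing out of [below eta]. *)
Definition tension (sigma : R) (eta : 'rV[R]_m -> R) (psi : space -> space) : R :=
  surface_integral eta (fun x' =>
    sigma * div_normal eta x' * dot (normal eta x') (psi (join x' (eta x')))).

End weak_equations.

(** Case I: one fluid, of density 1. *)

Section one_fluid.
Context {R : realType}.

Definition one_fluid m (g sigma : R) (c : 'rV[R]_m.+1) (Xi : set 'rV[R]_m.+1)
    (eta : 'rV[R]_m -> R) (u : 'rV[R]_m.+1 -> 'rV[R]_m.+1)
    (P : 'rV[R]_m.+1 -> R) : Prop :=
  [/\ vanishes_at_infinity eta,
      admissible Xi (below eta) u P,
      incompressible_tangential c Xi (below eta) u &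
      forall psi, test_field (~` Xi) psi ->
        momentum g c (below eta) u P 1 psi = tension sigma eta psi].

(* w in L^1(D) and L^oo(D), and |x|^k w in L^1(D). *)
Definition localized n (D : set 'rV[R]_n) (k : R) (w : 'rV[R]_n -> R) : Prop :=
  [/\ w \_ D \in Lfun (@lebesgue_rV R n) 1%E,
      w \_ D \in Lfun (@lebesgue_rV R n) +oo%E &
      (fun x => enorm x `^ k * w x) \_ D \in Lfun (@lebesgue_rV R n) 1%E].

Section plane.
Variables (g sigma : R) (c : 'rV[R]_2) (eta : 'rV[R]_1 -> R)
  (u : 'rV[R]_2 -> 'rV[R]_2) (P : 'rV[R]_2 -> R).
Let Om := below eta.
Let leb := @lebesgue_rV R 2.

Definition caseIA_plane : Prop :=
  one_fluid g sigma c set0 eta u P /\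
  exists w : 'rV[R]_2 -> R,
    (forall phi, test_fun Om phi ->
       curl Om u ord0 ord_max phi = (\int[leb]_(x in Om) (w x * phi x))%R) /\
    (exists2 k, (2 ^ 2)%:R < k & localized Om k w).

Definition perp_grad (f : 'rV[R]_2 -> R) (x : 'rV[R]_2) : 'rV[R]_2 :=
  \row_j (if j == ord0 then - pderiv ord_max f x else pderiv ord0 f x).

Definition caseIB : Prop :=
  exists (M : nat) (xi : 'I_M -> 'rV[R]_2) (vpi : 'I_M -> R)
         (w : 'rV[R]_2 -> R),
    [/\ injective xi /\ range xi `<=` Om,
        one_fluid g sigma c (range xi) eta u P,
        forall phi, test_fun Om phi ->
          curl Om u ord0 ord_max phi =
          \sum_i vpi i * phi (xi i) + (\int[leb]_(x in Om) (w x * phi x))%R,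
        exists2 k, (2 ^ 2)%:R < k & localized Om k w &
        forall i,
          u x - (vpi i / (2 * pi)) *: perp_grad (fun y => ln (enorm (y - xi i))) x
            @[x --> (xi i)^'] --> c].

End plane.

Section space.
Variables (g sigma : R) (c : 'rV[R]_3) (eta : 'rV[R]_2 -> R)
  (u : 'rV[R]_3 -> 'rV[R]_3) (P : 'rV[R]_3 -> R).
Let Om := below eta.
Let leb := @lebesgue_rV R 3.

(* Indices are added modulo 3: the i-th component of the vector curl of u is
   d_(i+1) u_(i+2) - d_(i+2) u_(i+1).  The last clause is div w = 0 in Om
   together with the vanishing of the normal trace of w in H^(-1/2)(S), which
   is defined by <w.N, phi> = int_Om (w.grad phi + phi div w). *)
Definition caseIA_space : Prop :=
  one_fluid g sigma c set0 eta u P /\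
  exists w : 'rV[R]_3 -> 'rV[R]_3,
    [/\ forall i phi, test_fun Om phi ->
          curl Om u (i + 1) (i + 2%:R) phi =
          (\int[leb]_(x in Om) (w x 0 i * phi x))%R,
        exists2 k, (3 ^ 2)%:R < k & forall i, localized Om k (fun x => w x 0 i) &
        forall phi, test_fun setT phi ->
          (\int[leb]_(x in Om) (\sum_i w x 0 i * pderiv i phi x))%R = 0].

End space.

Definition caseI m : R -> R -> 'rV[R]_m.+1 -> ('rV[R]_m -> R) ->
    ('rV[R]_m.+1 -> 'rV[R]_m.+1) -> ('rV[R]_m.+1 -> R) -> Prop :=
  match m with
  | 1 => fun g sigma c eta u P =>
      caseIA_plane g sigma c eta u P \/ caseIB g sigma c eta u P
  | 2 => fun g sigma c eta u P => caseIA_space g sigma c eta u P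
  | _ => fun _ _ _ _ _ _ => False
  end.

End one_fluid.

(** Case II: two irrotational fluids separated by a vortex sheet.  As N_+ = -N_-
    and P_+ - P_- = - sigma div N_- on S, the sum of the boundary terms of the
    two weak momentum equations is int_S sigma (div N_-) N_-.psi dS.

    The densities have to be different: for c = 0, sigma = 0 and rho_+ = rho_-,
    u = 0 and P = - rho g x_n give a solution whatever the profile eta is. *)

Definition caseII {R : realType} m (g sigma : R) (c : 'rV[R]_m.+1)
    (eta : 'rV[R]_m -> R) (u : 'rV[R]_m.+1 -> 'rV[R]_m.+1)
    (P : 'rV[R]_m.+1 -> R) : Prop :=
  exists rho_m rho_p : R,
    [/\ [/\ 0 < rho_m, 0 < rho_p & rho_m != rho_p],
        vanishes_at_infinity eta,
        forall U, U = below eta \/ U = above eta ->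
          [/\ admissible set0 U u P, incompressible_tangential c set0 U u &
              irrotational U u] &
        forall psi, test_field setT psi ->
          momentum g c (below eta) u P rho_m psi +
          momentum g c (above eta) u P rho_p psi = tension sigma eta psi].

(* Main.v *)
From HB Require Import structures.
Require Import Defs.
From mathcomp Require Import all_boot all_order all_algebra.
From mathcomp Require Import all_classical all_reals all_analysis.
From mathcomp Require Import measurable_realfun ring lra.
Set Implicit Arguments.
Unset Strict Implicit.
Unset Printing Implicit Defensive.
Import Order.TTheory GRing.Theory Num.Theory.
Import numFieldNormedType.Exports.
Local Open Scope classical_set_scope.
Local Open Scope ring_scope.

(** Testing the momentum equation with a divergence free vector field makes the
    pressure disappear.  Take for test field a compactly supported stream-function
    field equal to e_n on the cube of radius N and supported in the cube of radius
    2N, with gradient O(1/N).  Since u = O(|x|^(-n+1-eps)), the momentum flux is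
    O(N^-eps), and the surface tension, once integrated by parts on S, tends to 0
    with grad eta.  The vertical component of the field has integral 0 over the half
    space x_n < 0, so that the gravity term is g times the integral of eta against a
    horizontal cutoff (with the factor rho_- - rho_+ for two fluids): hence the
    integral of eta vanishes.

    For point vortices, small copies of the same field around each vortex are
    subtracted, so that the test field vanishes near the vortices.  The force which
    they contribute tends to 0 with their size d: the desingularized velocity is
    c + o(1) by hypothesis, the vortex velocity is O(1/d), and the quadratic
    self-interaction of the vortex cancels by reflection. *)

(** * Lebesgue measure on R^n *)

(** No decay of P is given, so the test field has to be exactly solenoidal; hence a constant field
    truncated through its stream function. Its vertical component is then an x_1-derivative, of mean
    zero on each horizontal slice. This is what makes the gravity term converge: the fluid column
    over x' contributes a volume independent of x' plus or minus eta(x'), and the first part drops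
    out. The decay of u is just enough: because of c, the flux (u - c) (x) u is in general only
    linear in u at infinity, so O(N^(-(n-1)-eps)), to be set against a gradient O(1/N) on a volume
    O(N^n). At a vortex no size estimate can suffice: velocity squared d^-2, gradient d^-1 and area
    d^2 give d^-1. The cutoffs are therefore even, which makes the quadratic term odd under
    reflection in the horizontal line through the vortex; the cross terms with the o(1) remainder
    are o(1). All cutoffs are products of functions of one coordinate. They fit the cubes of the sup
    norm, and every integral over R^n reduces to integrals along coordinate lines. *)

Section norm_rV.
Context {R : realType}.

Lemma ler_coord_norm n (x : 'rV[R]_n) i : `|x 0 i| <= `|x|.
Proof.
rewrite [leRHS]/Num.norm /= mx_normrE; apply/bigmax_geP; right => /=.
by exists (0, i).
Qed.

Lemma norm_le_coord n (x : 'rV[R]_n) r :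
  0 <= r -> (forall i, `|x 0 i| <= r) -> `|x| <= r.
Proof.
move=> r0 h; rewrite [leLHS]/Num.norm /= mx_normrE; apply/bigmax_leP; split=> //.
by move=> [i j] _ /=; rewrite ord1.
Qed.

Lemma ltr_norm_coord n (x : 'rV[R]_n) r :
  0 < r -> (`|x| < r) <-> (forall i, `|x 0 i| < r).
Proof.
move=> r0; split=> [xr i|h]; first exact: le_lt_trans (ler_coord_norm x i) xr.
rewrite [ltLHS]/Num.norm /= mx_normrE; apply/bigmax_ltP; split=> //.
by move=> [i j] _ /=; rewrite ord1.
Qed.

Lemma dot_ge0 n (x : 'rV[R]_n) : 0 <= dot x x.
Proof. by apply: sumr_ge0 => i _; rewrite -expr2 sqr_ge0. Qed.

Lemma coord_le_enorm n (x : 'rV[R]_n) i : `|x 0 i| <= enorm x.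
Proof.
rewrite /enorm -sqrtr_sqr ler_sqrt ?dot_ge0// /dot (bigD1 i)//= expr2 lerDl.
by apply: sumr_ge0 => j _; rewrite -expr2 sqr_ge0.
Qed.

Lemma norm_le_enorm n (x : 'rV[R]_n) : `|x| <= enorm x.
Proof. by apply: norm_le_coord => [|i]; [exact: sqrtr_ge0|exact: coord_le_enorm]. Qed.

End norm_rV.

Section measurability.
Context {R : realType}.

Lemma measurable_ball_rV n (x : 'rV[R]_n) e : measurable (ball x e).
Proof.
have [e0|e0] := ltP 0 e; last first.
  rewrite (_ : ball _ _ = set0)//; apply/seteqP; split=> // y.
  by rewrite -ball_normE /ball_ /= => /(le_lt_trans (normr_ge0 _)); rewrite ltNge e0.
rewrite (_ : ball x e = \big[setI/setT]_(i < n)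
    ((fun y : 'rV[R]_n => y 0 i) @^-1` (ball (x 0 i) e))); last first.
  rewrite -bigcap_seq; apply/seteqP; split=> y.
    by move=> [_ h] i _; apply: h.
  move=> h; split=> // i j; rewrite ord1.
  by apply: h => /=; exact: mem_index_enum.
apply: bigsetI_measurable => i _.
rewrite -[X in measurable X]setTI.
exact: (@measurable_coord _ (measurableTypeR R) 1 n 0 i measurableT _ (measurable_ball _ _)).
Qed.

(** Balls with rational centres and radii 1/(k+1) form a countable base, and each is a finite
    intersection of coordinate cylinders, so the product sigma-algebra contains the topology. *)
Lemma open_measurable_rV n (A : set 'rV[R]_n) : open A -> measurable A.
Proof.
move=> oA.
pose I := ('rV[rat]_n * nat)%type.
pose c (p : I) : 'rV[R]_n := map_mx ratr p.1.
pose e (p : I) : R := p.2.+1%:R^-1.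
rewrite (_ : A = \bigcup_(p in [set p : I | ball (c p) (e p) `<=` A])
  ball (c p) (e p)); last first.
  apply/seteqP; split => [x Ax|x [p /= pA]]; last exact: pA.
  have /nbhs_ballP[d /= d0 dA] : nbhs x A by exact: open_nbhs_nbhs.
  have [k kd] : exists k : nat, (k.+1%:R^-1 : R) < d / 2.
    have [k /= _ /(_ k (leqnn k))] := near_infty_natSinv_lt (PosNum (divr_gt0 d0 (ltr0n _ 2))).
    by exists k.
  have k0 : 0 < k.+1%:R^-1 :> R by rewrite invr_gt0.
  have /choice[q qx] : forall i, exists q : rat, ball (x 0 i) (k.+1%:R^-1 : R) (ratr q).
    move=> i; have : x 0 i < x 0 i + k.+1%:R^-1 by rewrite ltrDl.
    move=> /rat_in_itvoo[q]; rewrite in_itv/= => /andP[q1 q2]; exists q.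
    move: k0 q2; set w := _^-1 => k0 q2.
    by rewrite -ball_normE /ball_ /= ltr_norml; apply/andP; split; lra.
  have xb : ball (c (\row_i q i, k)) (e (\row_i q i, k)) x.
    apply: ball_sym; split=> // i j; rewrite ord1 !mxE; exact: qx.
  exists (\row_i q i, k) => //= y cy; apply: dA.
  have := ball_triangle (ball_sym xb) cy.
  by apply: le_ball; rewrite /e /=; move: kd; set w := _^-1 => kd; lra.
rewrite bigcup_mkcond; apply: countable_bigcupT_measurable => [|p]; first exact: countableP.
by case: ifP => // _; exact: measurable_ball_rV.
Qed.

Lemma closed_measurable_rV n (A : set 'rV[R]_n) : closed A -> measurable A.
Proof.
move=> cA; rewrite -[A]setCK; apply: measurableC; apply: open_measurable_rV.
by rewrite openC.
Qed.

Lemma continuous_measurable_rV n (f : 'rV[R]_n -> R) :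
  continuous f -> measurable_fun setT f.
Proof.
move=> /continuousP cf; apply: (measurability _ (RGenOpens.measurableE R)).
move=> _ [_ [a [b ->] <-]]; rewrite setTI; apply: open_measurable_rV.
exact/cf/interval_open.
Qed.

Lemma measurable_join m :
  measurable_fun setT (fun p : 'rV[R]_m * measurableTypeR R => join p.1 p.2).
Proof.
apply: measurable_fun_matrix => i j.
under eq_fun do rewrite mxE.
case: (unlift _ _) => [k|]; last exact: measurable_snd.
exact: (measurableT_comp (measurable_coord 0 k) measurable_fst).
Qed.

End measurability.

(** * Fubini along the last coordinate *)

Section fubini_rV.
Context {R : realType}.
Local Notation leb n := (@lebesgue_rV R n).
Local Notation mu := (@lebesgue_measure R).
Local Open Scope ereal_scope.

Lemma integrable_join m (f : 'rV[R]_m.+1 -> \bar R) :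
  (leb m.+1).-integrable setT f ->
  (leb m \x mu).-integrable setT (fun p => f (join p.1 p.2)).
Proof.
move=> /integrableP[mf foo]; apply/integrableP; split.
  exact: (measurableT_comp mf (@measurable_join R m)).
move: foo; rewrite /lebesgue_rV /= ge0_integral_pushforward//.
- exact: measurable_join.
- exact: measurableT_comp.
Qed.

Lemma integral_joinE m (f : 'rV[R]_m.+1 -> \bar R) :
  (leb m.+1).-integrable setT f ->
  \int[leb m.+1]_x f x = \int[leb m \x mu]_p f (join p.1 p.2).
Proof.
move=> fi; rewrite /lebesgue_rV /= integral_pushforward//.
- exact: measurable_join.
- by case/integrableP: fi.
- exact: integrable_join.
Qed.

Lemma integral_join_vert m (f : 'rV[R]_m.+1 -> \bar R) :
  (leb m.+1).-integrable setT f ->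
  \int[leb m.+1]_x f x = \int[leb m]_x' \int[mu]_t f (join x' t).
Proof.
by move=> fi; rewrite integral_joinE// -integral12_prod_meas1//; exact: integrable_join.
Qed.

Lemma integral_join_horiz m (f : 'rV[R]_m.+1 -> \bar R) :
  (leb m.+1).-integrable setT f ->
  \int[leb m.+1]_x f x = \int[mu]_t \int[leb m]_x' f (join x' t).
Proof.
by move=> fi; rewrite integral_joinE// -integral21_prod_meas1//; exact: integrable_join.
Qed.

(** Induction on the dimension, peeling off the last coordinate: the measure in dimension m+1 is by
    construction the image of a product under [join]. *)
Lemma lebesgue_box n (B : 'I_n -> set R) : (forall i, measurable (B i)) ->
  leb n [set x | forall i, B i (x ord0 i)] = \prod_(i < n) mu (B i).
Proof.
elim: n B => [|m ih] B mB.
  by rewrite big_ord0 /lebesgue_rV /= /dirac indicE mem_set// => -[].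
pose A := [set x : 'rV[R]_m | forall i, B (lift ord_max i) (x ord0 i)].
have -> : leb m.+1 [set x | forall i, B i (x ord0 i)] =
    (leb m \x mu) (A `*` B ord_max).
  change ((leb m \x mu) ((fun p : 'rV[R]_m * measurableTypeR R => join p.1 p.2)
    @^-1` [set x | forall i, B i (x ord0 i)]) = (leb m \x mu) (A `*` B ord_max)).
  congr ((leb m \x mu) _); apply/seteqP; split=> [[x t] /= h|[x t] /= [h ht] j].
    split; last by have := h ord_max; rewrite mxE unlift_none.
    by move=> i; have := h (lift ord_max i); rewrite mxE liftK.
  by rewrite mxE; case: unliftP => [i ->|->].
have mA : measurable A.
  rewrite (_ : A = \big[setI/setT]_(i < m)
      ((fun x : 'rV[R]_m => x ord0 i) @^-1` B (lift ord_max i))).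
    apply: bigsetI_measurable => i _; rewrite -[X in measurable X]setTI.
    exact: (@measurable_coord _ (measurableTypeR R) 1 m ord0 i measurableT _ (mB _)).
  rewrite -bigcap_seq; apply/seteqP; split=> y /= h i; first by move=> _; exact: h.
  by apply: h => /=; exact: mem_index_enum.
rewrite product_measure1E//; last exact: mB.
rewrite [X in X * _](ih (fun i => B (lift ord_max i)) (fun i => mB _)).
by rewrite [RHS](bigD1_ord ord_max)//= muleC.
Qed.

End fubini_rV.

(** * Cubes and integrals of functions supported in a cube *)

Section cube.
Context {R : realType}.
Local Notation leb n := (@lebesgue_rV R n).
Local Notation mu := (@lebesgue_measure R).

Definition cube n (a : 'rV[R]_n) (r : R) : set 'rV[R]_n := [set x | `|x - a| <= r].

Lemma cubeE n (a : 'rV[R]_n) r : 0 <= r ->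
  cube a r = [set x | forall i, `[a 0 i - r, a 0 i + r]%classic (x 0 i)].
Proof.
move=> r0; apply/seteqP; split=> x /= h.
  move=> i; rewrite in_itv /=; move: (le_trans (ler_coord_norm (x - a) i) h).
  by rewrite !mxE ler_norml => /andP[? ?]; apply/andP; split; lra.
apply: norm_le_coord => // i; have := h i; rewrite in_itv/= => /andP[? ?].
by rewrite !mxE ler_norml; apply/andP; split; lra.
Qed.

Lemma cube_closed n (a : 'rV[R]_n) r : closed (cube a r).
Proof.
rewrite (_ : cube a r = (fun x : 'rV[R]_n => `|x - a|) @^-1` [set t | t <= r]).
  apply: closed_comp; last exact: closed_le.
  have ca : continuous (fun x : 'rV[R]_n => x - a).
    by move=> x; apply: (@cvgB _ _ _ (nbhs x) _ id (cst a) x a); [exact: cvg_id|exact: cvg_cst].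
  move=> x _; exact: (continuous_comp (ca x) (@norm_continuous _ _ _)).
by [].
Qed.

Lemma cube_compact n (a : 'rV[R]_n) r : compact (cube a r).
Proof.
apply: bounded_closed_compact; last exact: cube_closed.
exists (`|a| + r); split; first exact: num_real.
move=> M /ltW aM x /= xr; apply: le_trans aM.
by rewrite -[x](subrK a) addrC (le_trans (ler_normD _ _))// lerD2l.
Qed.

Lemma measurable_cube n (a : 'rV[R]_n) r : measurable (cube a r).
Proof. by apply: closed_measurable_rV; exact: cube_closed. Qed.

Lemma lebesgue_cube n (a : 'rV[R]_n) r : 0 <= r ->
  leb n (cube a r) = ((2 * r) ^+ n)%:E.
Proof.
move=> r0; rewrite cubeE//.
rewrite (lebesgue_box (B := fun i => `[a 0 i - r, a 0 i + r]%classic))//.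
transitivity (\prod_(i < n) (2 * r)%:E)%E.
  apply: eq_bigr => i _; rewrite lebesgue_measure_itv/= lte_fin.
  case: ltP => rr; first by rewrite -EFinB; congr (_%:E); ring.
  by congr (_%:E); lra.
by rewrite -(big_morph EFin (@EFinM R) erefl) prodr_const card_ord.
Qed.

Section estimate.
Variables (n : nat) (D : set 'rV[R]_n) (f : 'rV[R]_n -> R) (a : 'rV[R]_n) (r M : R).
Hypotheses (mD : measurable D) (mf : measurable_fun D f) (r0 : 0 <= r) (M0 : 0 <= M).
Hypothesis fM : forall x, D x -> `|x - a| <= r -> `|f x| <= M.
Hypothesis f0 : forall x, D x -> r < `|x - a| -> f x = 0.

Let g : 'rV[R]_n -> R := fun x => M * \1_(cube a r) x.

Let fg x : D x -> `|f x| <= g x.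
Proof.
move=> Dx; rewrite /g indicE; have [ar|ar] := leP `|x - a| r.
  by rewrite mem_set// mulr1 fM.
by rewrite f0// normr0 mulr_ge0.
Qed.

Let ig : (leb n).-integrable setT (EFin \o g).
Proof.
rewrite /g; apply/integrableP; split.
  apply/measurable_EFinP; apply: measurable_funM => //.
  by apply: measurable_indic; exact: measurable_cube.
under eq_integral => x _ do
  rewrite /= ger0_norm ?mulr_ge0// EFinM.
rewrite ge0_integralZl//; last first.
  by apply/measurable_EFinP; apply: measurable_indic; exact: measurable_cube.
rewrite integral_indic ?setIT//; last exact: measurable_cube.
by rewrite [X in (_ * X)%E]lebesgue_cube// -EFinM ltry.
Qed.

Lemma integrable_bounded_support : (leb n).-integrable D (EFin \o f).
Proof.
apply: (@le_integrable _ _ _ _ _ mD _ (EFin \o g)).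
- exact/measurable_EFinP.
- by move=> x Dx /=; rewrite lee_fin (le_trans (fg Dx))// ler_norm.
- by apply: integrableS ig.
Qed.

(** Supremum times volume. The limits of the momentum flux and of the tension come down to this
    bound with explicit powers of the radius. *)
Lemma Rintegral_bounded_support :
  `|\int[leb n]_(x in D) f x|%R <= M * (2 * r) ^+ n.
Proof.
apply: (le_trans (le_normr_Rintegral mD integrable_bounded_support)).
have : (\int[leb n]_(x in D) `|f x| <= \int[leb n]_(x in D) g x)%R.
  apply: le_Rintegral => //; first exact/integrable_norm/integrable_bounded_support.
  by apply: integrableS ig.
move/le_trans; apply.
rewrite RintegralZl//; last first.
  apply: (@integrableS _ _ _ _ setT) => //.
  rewrite [X in _.-integrable _ X](_ : _ = EFin \o \1_(cube a r))//.
  apply/integrableP; split.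
    by apply/measurable_EFinP; apply: measurable_indic; exact: measurable_cube.
  under eq_integral => x _ do rewrite /= ger0_norm//.
  rewrite integral_indic ?setIT//; last exact: measurable_cube.
  by rewrite [X in (X < _)%E]lebesgue_cube// ltry.
rewrite ler_wpM2l//.
rewrite /Rintegral integral_indic//; last exact: measurable_cube.
rewrite -[leRHS]/(fine ((2 * r) ^+ n)%:E) -(lebesgue_cube a r0).
apply: fine_le.
- rewrite ge0_fin_numE//; apply: (@le_lt_trans _ _ (leb n (cube a r))).
    apply: le_measure; rewrite ?inE//; [|exact: measurable_cube].
    by apply: measurableI => //; exact: measurable_cube.
  by rewrite lebesgue_cube// ltry.
- by rewrite lebesgue_cube.
- apply: le_measure; rewrite ?inE//; [|exact: measurable_cube].
  by apply: measurableI => //; exact: measurable_cube.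
Qed.

End estimate.

Lemma continuous_bounded_support n (f : 'rV[R]_n -> R) (a : 'rV[R]_n) r :
  continuous f -> (forall x, r < `|x - a| -> f x = 0) ->
  exists2 M, 0 <= M & forall x, `|f x| <= M.
Proof.
move=> cf f0; have [K K0 fK] : exists2 K, 0 <= K & forall x, cube a r x -> `|f x| <= K.
  have cK : compact (f @` cube a r).
    by apply: continuous_compact; [exact: continuous_subspaceT|exact: cube_compact].
  have [K [_ hK]] := compact_bounded cK.
  exists (`|K| + 1); first by rewrite addr_ge0.
  move=> x ax; apply: (hK (`|K| + 1)); last by exists x.
  by rewrite (le_lt_trans (ler_norm K))// ltrDl.
exists K => // x; have [ar|ar] := leP `|x - a| r; first exact: fK.
by rewrite f0// normr0.
Qed.

Lemma continuous_support_integrable n (f : 'rV[R]_n -> R) (a : 'rV[R]_n) r :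
  continuous f -> (forall x, r < `|x - a| -> f x = 0) ->
  (leb n).-integrable setT (EFin \o f).
Proof.
move=> cf f0; have [M M0 fM] := continuous_bounded_support cf f0.
apply: (@integrable_bounded_support n setT f a `|r| M) => //.
- exact: continuous_measurable_rV.
- by move=> x _ ar; apply: f0; exact: le_lt_trans (ler_norm r) ar.
Qed.

End cube.

(** * Integrals on the line: reflection and the fundamental theorem of calculus *)

Section lebesgue_line.
Context {R : realType}.
Local Notation mu := (@lebesgue_measure R).

Section reflection.
Variable c : R.

Let refl (t : measurableTypeR R) : measurableTypeR R := c - t.

Let mrefl : measurable_fun setT refl.
Proof. by apply: measurable_funB; [exact: measurable_cst|exact: measurable_id]. Qed.

Let refl' : {mfun measurableTypeR R >-> measurableTypeR R} :=
  HB.pack refl (isMeasurableFun.Build _ _ _ _ refl mrefl).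

(** Half-open intervals determine Lebesgue measure, and reflection preserves their length; it only
    moves the closed end to the other side. *)
Lemma lebesgue_measure_reflection (A : set (measurableTypeR R)) :
  measurable A -> mu A = pushforward mu refl A.
Proof.
apply: (@lebesgue_measure_unique R (pushforward mu refl')) => X [[a b] _ <-] /=.
rewrite /pushforward (_ : _ @^-1` _ = `[c - b, c - a[%classic); last first.
  apply/seteqP; split=> t /=; rewrite !in_itv/= /refl => /andP[? ?];
    by apply/andP; split; lra.
rewrite !lebesgue_measure_itv/= !lte_fin ltrD2l ltrN2; case: ifP => // _.
by rewrite -!EFinB; congr (_%:E); ring.
Qed.

(** The substitution t -> c - t shows that the integral equals its opposite, and integrability makes
    it finite. *)
Lemma integral_antisymmetric (f : R -> R) : mu.-integrable setT (EFin \o f) ->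
  (forall t, f (c - t) = - f t) -> (\int[mu]_t (f t)%:E = 0)%E.
Proof.
move=> fi fc; have : (\int[mu]_t (f t)%:E = - \int[mu]_t (f t)%:E)%E.
  rewrite -integralN; last by apply: integrable_add_def.
  rewrite (eq_measure_integral (pushforward mu refl')); last first.
    by move=> A mA _; exact: lebesgue_measure_reflection.
  rewrite integral_pushforward//=.
  - by rewrite preimage_setT; apply: eq_integral => t _ /=; rewrite /refl fc opprK.
  - by have := measurable_int _ (integrableN fi).
  - rewrite preimage_setT [X in _.-integrable _ X](_ : _ = EFin \o f)//.
    by apply/funext => t /=; rewrite /refl fc opprK.
have := integrable_fin_num measurableT fi.
rewrite [X in X \is a fin_num -> _](_ : _ = \int[mu]_t (f t)%:E)%E//.

case: (\int[mu]_t _)%E => //= r _ [] rr; congr (_%:E); lra.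
Qed.

End reflection.

Lemma integral_derive_bounded_support (f f' : R -> R) (r : R) :
  (forall t, is_derive t (1 : R) f (f' t)) -> continuous f' ->
  (forall t, r < `|t| -> f t = 0) ->
  (\int[mu]_t (f' t)%:E = 0)%E.
Proof.
(* As b exceeds r strictly, f vanishes at both ends of [-b, b], and its derivative vanishes
   beyond. *)
move=> df cf' f0; pose b : R := `|r| + 1.
have b0 : 0 < b by rewrite ltr_wpDl.
have rb : r < b by rewrite (le_lt_trans (ler_norm r))// ltrDl.
have f'0 t : b < `|t| -> f' t = 0.
  move=> bt; have [_ <-] := df t.
  rewrite (@near_eq_derive _ _ _ f (cst 0)) ?derive_cst//.
  near=> s; rewrite /= f0// (lt_trans rb)//; near: s.
  by apply: (@cvgr_gt _ _ _ _ (fun s : R => `|s|) `|t|) => //; exact: norm_continuous.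
rewrite (_ : (fun t => (f' t)%:E) = (fun t => (f' t)%:E) \_ (`[- b, b]%classic)); last first.
  apply/funext => t; rewrite patchE; case: ifPn => //.
  rewrite notin_setE /= in_itv/= => /negP; rewrite -ler_norml -ltNge => bt.
  by rewrite f'0.
rewrite -integral_mkcond (@continuous_FTC2 _ f' f)//.
- rewrite !f0 ?subee//; first by rewrite normrN gtr0_norm.
  by rewrite gtr0_norm.
- by rewrite gtrN.
- exact: continuous_subspaceT.
- split.
  + by move=> t _; have [] := df t.
  + apply: cvg_at_right_filter; apply: differentiable_continuous.
    by apply/derivable1_diffP; have [] := df (- b).
  + apply: cvg_at_left_filter; apply: differentiable_continuous.
    by apply/derivable1_diffP; have [] := df b.
- by move=> t _; rewrite derive1E; have [_ ->] := df t.
Unshelve. all: by end_near. Qed.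

End lebesgue_line.
Section slices.
Context {R : realType}.
Local Notation leb n := (@lebesgue_rV R n).
Local Notation mu := (@lebesgue_measure R).

Lemma continuous_rV (T : topologicalType) n (g : T -> 'rV[R]_n) :
  (forall i, continuous (fun x => g x 0 i)) -> continuous g.
Proof.
move=> cg x; apply/cvgrPdist_lt => e e0.
have : \forall y \near x, forall i, `|g x 0 i - g y 0 i| < e.
  by apply: filter_forall => i; move/cvgrPdist_lt : (cg i x); exact.
apply: filterS => y h; apply/ltr_norm_coord => // i; rewrite !mxE; exact: h.
Qed.

Lemma continuous_joinl m t : continuous (fun x' : 'rV[R]_m => join x' t).
Proof.
apply: continuous_rV => i x'; under eq_fun do rewrite mxE.
by case: (unlift _ _) => [k|]; [exact: coord_continuous|exact: cst_continuous].
Qed.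

Lemma continuous_joinr m (x' : 'rV[R]_m) : continuous (fun t => join x' t).
Proof.
apply: continuous_rV => i t; under eq_fun do rewrite mxE.
by case: (unlift _ _) => [k|]; [exact: cst_continuous|exact: cvg_id].
Qed.

Lemma norm_joinl m (x' : 'rV[R]_m) t : `|x'| <= `|join x' t|.
Proof.
apply: norm_le_coord => // i; apply: le_trans (ler_coord_norm _ (lift ord_max i)).
by rewrite mxE liftK.
Qed.

Lemma norm_joinr m (x' : 'rV[R]_m) t : `|t| <= `|join x' t|.
Proof.
by apply: le_trans (ler_coord_norm _ ord_max); rewrite mxE unlift_none.
Qed.

(** * Derivatives and smooth cutoffs *)

Section affine.
Variables (U V W : normedModType R) (f : V -> W) (g : U -> V) (a v : U) (w : V).
Hypothesis gaff : forall h : R, g (h *: v + a) = h *: w + g a.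

Let quotientE : (fun h : R => h^-1 *: ((f \o g \o shift a) (h *: v) - (f \o g) a)) =
  (fun h : R => h^-1 *: ((f \o shift (g a)) (h *: w) - f (g a))).
Proof. by apply/funext => h /=; rewrite gaff. Qed.

(** Along an affine line the two difference quotients are the same function of h. Only directional
    derivatives are involved, in keeping with [pderiv]. *)
Lemma derive_comp_affine : 'D_v (f \o g) a = 'D_w f (g a).
Proof. by rewrite /derive quotientE. Qed.

Lemma derivable_comp_affine : derivable (f \o g) a v <-> derivable f (g a) w.
Proof. by rewrite /derivable quotientE. Qed.

End affine.

Lemma join_shift_horiz m (x' : 'rV[R]_m) t j (h : R) :
  join (h *: delta_mx 0 j + x') t = h *: delta_mx 0 (lift ord_max j) + join x' t.
Proof.
apply/rowP => i; rewrite !mxE; case: unliftP => [k ->|->].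
  by rewrite !mxE /= (inj_eq lift_inj).
by rewrite eqxx /= (negbTE (neq_lift _ _)) mulr0 add0r.
Qed.

Lemma join_shift_vert m (x' : 'rV[R]_m) t (h : R) :
  join x' (h *: 1 + t) = h *: delta_mx 0 ord_max + join x' t.
Proof.
apply/rowP => i; rewrite !mxE; case: unliftP => [k ->|->].
  by rewrite eq_sym eqxx (negbTE (neq_lift _ _)) mulr0 add0r.
by rewrite !eqxx.
Qed.

Lemma pderiv_outside n (i : 'I_n) (f : 'rV[R]_n -> R) a r :
  (forall x, r < `|x - a| -> f x = 0) ->
  forall x, r < `|x - a| -> pderiv i f x = 0.
Proof.
move=> f0 x rx; rewrite /pderiv (@near_eq_derive _ _ _ f (cst 0)) ?derive_cst//.
near=> y; rewrite /= f0//; near: y.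
have ca : continuous (fun y : 'rV[R]_n => y - a).
  by move=> y; apply: (@cvgB _ _ _ (nbhs y) _ id (cst a) y a); [exact: cvg_id|exact: cvg_cst].
apply: (@cvgr_gt _ _ _ _ (fun y : 'rV[R]_n => `|y - a|) `|x - a|) => //.
exact: (continuous_comp (ca x) (@norm_continuous _ _ _)).
Unshelve. all: by end_near. Qed.

(** Induction on the dimension. If i is the last coordinate, it is integrated first and each line
    gives 0 by the fundamental theorem of calculus; otherwise it is integrated last, and the
    horizontal slices fall under the induction hypothesis. *)
Lemma integral_pderiv n (i : 'I_n) (f : 'rV[R]_n -> R) r :
  (forall x, derivable f x (delta_mx 0 i)) -> continuous (pderiv i f) ->
  (forall x, r < `|x| -> f x = 0) ->
  (\int[leb n]_x (pderiv i f x)%:E = 0)%E.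
Proof.
elim: n i f => [[]//|m ih] i f df cf f0.
have f'0 x : r < `|x - 0| -> pderiv i f x = 0.
  by apply: pderiv_outside => y; rewrite subr0; exact: f0.
have fi := continuous_support_integrable cf f'0.
have [j ij|imax] := unliftP ord_max i.
  rewrite integral_join_horiz//= integral0_eq// => t _.
  have aff (x' : 'rV[R]_m) := join_shift_horiz x' t j.
  have E : (fun x' => pderiv i f (join x' t)) = pderiv j (fun x' => f (join x' t)).
    apply/funext => x'; rewrite /pderiv ij.
    by rewrite -(derive_comp_affine f (g := fun y => join y t) (aff x')).
  under eq_integral do rewrite (congr1 (fun h => h _) E).
  apply: ih.
  - move=> x'; apply/(derivable_comp_affine f (g := fun y => join y t) (aff x')).
    by rewrite -ij.
  - by rewrite -E => x'; apply: continuous_comp; [exact: continuous_joinl|exact: cf].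
  - by move=> x' rx'; rewrite f0// (lt_le_trans rx')// norm_joinl.
rewrite integral_join_vert//= integral0_eq// => x' _.
have aff t := join_shift_vert x' t.
apply: (integral_derive_bounded_support (f := fun t => f (join x' t)) (r := r)).
- move=> t; apply: DeriveDef.
    apply/(derivable_comp_affine f (g := fun s => join x' s) (aff t)).
    by rewrite -imax.
  by rewrite (derive_comp_affine f (g := fun s => join x' s) (aff t)) -imax.
- by move=> t; apply: continuous_comp; [exact: continuous_joinr|exact: cf].
- by move=> t rt; rewrite f0// (lt_le_trans rt)// norm_joinr.
Qed.

End slices.
Section real_continuity.
Context {R : realType} (T : topologicalType).
Implicit Types f g : T -> R.

Lemma continuous_add_fun f g : continuous f -> continuous g ->
  continuous (fun x => f x + g x).
Proof. by move=> cf cg x; exact: cvgD (cf x) (cg x). Qed.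

Lemma continuous_mul_fun f g : continuous f -> continuous g ->
  continuous (fun x => f x * g x).
Proof. by move=> cf cg x; exact: cvgM (cf x) (cg x). Qed.

Lemma continuous_scale_fun c f : continuous f -> continuous (fun x => c * f x).
Proof. by move=> cf x; exact: cvgM (cvg_cst c) (cf x). Qed.

Lemma continuous_inv_fun f : (forall x, f x != 0) -> continuous f ->
  continuous (fun x => (f x)^-1).
Proof. by move=> f0 cf x; exact: cvgV (f0 x) (cf x). Qed.

Lemma continuous_sum_fun (I : finType) (F : I -> T -> R) :
  (forall i, continuous (F i)) -> continuous (fun x => \sum_i F i x).
Proof.
move=> cF; elim: (index_enum I) => [|i s ih].
  by under eq_fun do rewrite big_nil; exact: cst_continuous.
by under eq_fun do rewrite big_cons; exact: continuous_add_fun.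
Qed.

Lemma continuous_prod_fun (I : finType) (F : I -> T -> R) :
  (forall i, continuous (F i)) -> continuous (fun x => \prod_i F i x).
Proof.
move=> cF; elim: (index_enum I) => [|i s ih].
  by under eq_fun do rewrite big_nil; exact: cst_continuous.
by under eq_fun do rewrite big_cons; exact: continuous_mul_fun.
Qed.

End real_continuity.

(** * Smooth functions of one variable and the basic cutoff *)

Section smooth_line.
Context {R : realType}.
Implicit Types f g : R -> R.

Fixpoint Dn (n : nat) f : Prop :=
  match n with
  | 0 => continuous f
  | k.+1 => (forall x, derivable f x 1) /\ Dn k (derive1 f)
  end.

Definition smooth f := forall n, Dn n f.

Lemma DnS n f f' : (forall x, is_derive x (1 : R) f (f' x)) -> Dn n f' -> Dn n.+1 f.
Proof.
move=> df Df'; split; first by move=> x; exact: ex_derive.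
suff -> : (derive1 f) = f' by [].
by apply/funext => x; rewrite derive1E derive_val.
Qed.

Lemma Dn_is_derive n f x : Dn n.+1 f -> is_derive x (1 : R) f ((derive1 f) x).
Proof. by move=> [df _]; rewrite derive1E; exact: derivableP. Qed.

Lemma derive_continuous f f' : (forall x, is_derive x (1 : R) f (f' x)) -> continuous f.
Proof.
by move=> df x; apply: differentiable_continuous; apply/derivable1_diffP; exact: ex_derive.
Qed.

Lemma Dn_continuous n f : Dn n f -> continuous f.
Proof.
case: n => // n Df; apply: (derive_continuous (f' := (derive1 f))) => x.
exact: Dn_is_derive Df.
Qed.

Lemma Dn_pred n f : Dn n.+1 f -> Dn n f.
Proof.
elim: n f => [f|n ih f [df Df]]; first exact: Dn_continuous.
by split=> //; exact: ih.
Qed.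

Lemma Dn_cst n (c : R) : Dn n (cst c).
Proof.
elim: n c => [c|n ih c]; first exact: cst_continuous.
exact: (DnS (f' := cst 0)).
Qed.

Lemma Dn_add n f g : Dn n f -> Dn n g -> Dn n (fun x => f x + g x).
Proof.
elim: n f g => [f g cf cg x|n ih f g Df Dg]; first by apply: cvgD; [exact: cf|exact: cg].
apply: (DnS (f' := fun x => (derive1 f) x + (derive1 g) x)) => [x|].
  by apply: is_deriveD; [exact: Dn_is_derive Df|exact: Dn_is_derive Dg].
by apply: ih; [case: Df|case: Dg].
Qed.

Lemma Dn_mul n f g : Dn n f -> Dn n g -> Dn n (fun x => f x * g x).
Proof.
elim: n f g => [f g cf cg x|n ih f g Df Dg]; first by apply: cvgM; [exact: cf|exact: cg].
apply: (DnS (f' := fun x => f x * (derive1 g) x + g x * (derive1 f) x)) => [x|].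
  by apply: is_deriveM; [exact: Dn_is_derive Df|exact: Dn_is_derive Dg].
by apply: Dn_add; apply: ih; [exact: Dn_pred Df|case: Dg|exact: Dn_pred Dg|case: Df].
Qed.

(** The derivative - f' (1/f)^2 is a product in which 1/f occurs with one order of regularity less,
    so the induction closes. *)
Lemma Dn_inv n f : (forall x, f x != 0) -> Dn n f -> Dn n (fun x => (f x)^-1).
Proof.
move=> f0; elim: n => [cf x|n ih Df]; first exact: cvgV (f0 x) (cf x).
have dV x : is_derive x (1 : R) (fun y => (f y)^-1)
    ((-1) * (derive1 f x * ((f x)^-1 * (f x)^-1))).
  have [df Df'] := Df.
  apply: DeriveDef; first exact: derivableV.
  rewrite deriveV// -derive1E /GRing.scale/= -exprVn expr2; ring.
apply: (DnS dV).
apply: Dn_mul; first exact: Dn_cst.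
by apply: Dn_mul; [case: Df|apply: Dn_mul; apply: ih; exact: Dn_pred].
Qed.

Lemma is_derive_comp_affine f (a b x d : R) : is_derive (a * x + b) (1 : R) f d ->
  is_derive x (1 : R) (fun t => f (a * t + b)) (a * d).
Proof.
move=> fd; have := @is_derive1_comp _ f (fun t => a * t + b) x d a fd.
rewrite mulrC; apply; rewrite -[X in is_derive _ _ _ X]addr0.
apply: is_deriveD; rewrite -[X in is_derive _ _ _ X](mulr1 a).
exact: (is_deriveZ (f := id)).
Qed.

Lemma Dn_comp_affine n f (a b : R) : Dn n f -> Dn n (fun x => f (a * x + b)).
Proof.
elim: n f => [f cf|n ih f Df].
  move=> x; apply: continuous_comp; last exact: cf.
  by apply: cvgD; [apply: cvgM; [exact: cvg_cst|exact: cvg_id]|exact: cvg_cst].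
apply: (DnS (f' := fun x => a * (derive1 f) (a * x + b))) => [x|].
  by apply: is_derive_comp_affine; exact: Dn_is_derive Df.
by apply: Dn_mul; [exact: Dn_cst|apply: ih; case: Df].
Qed.

(* The derivative of [flat k] is [flat k.+2 - k * flat k.+1], whence the index. *)
Definition flat (k : nat) (x : R) : R :=
  if x <= 0 then 0 else x^-1 ^+ k * expR (- x^-1).

Lemma flat_le0 k x : x <= 0 -> flat k x = 0.
Proof. by rewrite /flat => ->. Qed.

Lemma flat_gt0 k x : 0 < x -> flat k x = x^-1 ^+ k * expR (- x^-1).
Proof. by move=> x0; rewrite /flat leNgt x0. Qed.

Lemma flat_pos k x : 0 < x -> 0 < flat k x.
Proof. by move=> x0; rewrite flat_gt0// mulr_gt0 ?expR_gt0// exprn_gt0// invr_gt0. Qed.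

Lemma flat_ge0 k x : 0 <= flat k x.
Proof. by have [x0|/flat_pos/ltW//] := leP x 0; rewrite flat_le0. Qed.

(** From exp(y) >= y^(k+2) / (k+2)! at y = 1/x. The square of x is one power more than continuity at
    0 requires: it makes the difference quotient at 0 tend to 0. *)
Lemma flat_bound k x : `|flat k x| <= k.+2`!%:R * x ^+ 2.
Proof.
have [x0|x0] := leP x 0; first by rewrite flat_le0// normr0 mulr_ge0// sqr_ge0.
rewrite ger0_norm ?flat_ge0// flat_gt0// expRN.
have y0 : 0 < x^-1 by rewrite invr_gt0.
have := expR_ge1Dxn k.+1 (ltW y0) => h.
have F0 : 0 < k.+2`!%:R :> R by rewrite ltr0n fact_gt0.
have E0 := expR_gt0 x^-1.
rewrite ler_pdivrMr// -(@ler_pM2l _ k.+2`!%:R^-1) ?invr_gt0//.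
rewrite !mulrA mulVf ?gt_eqF// mul1r.
have {h} h : x^-1 ^+ k.+2 / k.+2`!%:R <= expR x^-1 by apply: le_trans h; rewrite lerDr.
have -> : k.+2`!%:R^-1 * x^-1 ^+ k = x ^+ 2 * (x^-1 ^+ k.+2 / k.+2`!%:R).
  rewrite !exprS; field; rewrite ?gt_eqF//.
by rewrite ler_wpM2l// sqr_ge0.
Qed.

Lemma is_derive_flat k x :
  is_derive x (1 : R) (flat k) (- k%:R * flat k.+1 x + flat k.+2 x).
Proof.
have [x0|x0|->] := ltgtP x 0.
- rewrite !flat_le0 ?(ltW x0)// mulr0 addr0.
  apply: (@near_eq_is_derive _ _ _ (cst (0 : R))).

  near=> y; rewrite flat_le0//; apply: ltW; near: y; exact: lt_nbhsl.
- have xn0 : x != 0 by rewrite gt_eqF.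
  have dV : is_derive x (1 : R) (fun y : R => y^-1) (- x^-1 ^+ 2).
    apply: DeriveDef; first by apply: (@derivableV _ _ id).
    by rewrite (@deriveV _ _ id)// derive_id /GRing.scale/= mulr1 exprVn.
  have dE : is_derive x (1 : R) (fun y : R => expR (- y^-1)) (expR (- x^-1) * x^-1 ^+ 2).
    apply: (@is_derive1_comp _ expR (fun y => - y^-1)).
    by rewrite -[x^-1 ^+ 2]opprK; exact: is_deriveN.
  have dP : is_derive x (1 : R) (fun y : R => y^-1 ^+ k) (k%:R * x^-1 ^+ k.-1 * - x^-1 ^+ 2).
    by have := @is_deriveX _ _ (fun y : R => y^-1) k x 1 _ dV; rewrite exprfctE.
  have dF := is_deriveM dP dE.
  have near_flat : \near x, ((fun y : R => y^-1 ^+ k) * (fun y : R => expR (- y^-1))) x = flat k x.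
    by near=> y; rewrite flat_gt0//; near: y; exact: lt_nbhsr.
  apply: is_derive_eq (near_eq_is_derive near_flat dF) _.
  rewrite !flat_gt0// /GRing.scale/=.
  by case: k {dP dF near_flat} => [|k] /=; rewrite ?exprS; ring.
rewrite !flat_le0// mulr0 addr0.
(* At 0 the quadratic bound makes the difference quotient O(|h|). *)
suff h : (fun h : R => h^-1 *: ((flat k \o shift 0) (h *: 1) - flat k 0)) @ 0^' --> (0 : R).
  by apply: DeriveDef; [apply/cvg_ex; exists 0|exact: cvg_lim h].
apply/cvgrPdist_le => e e0; near=> h.
have h0 : h != 0 by near: h; exact: nbhs_dnbhs_neq.
rewrite sub0r normrN /= addr0 [flat k 0]flat_le0// subr0 /GRing.scale/= mulr1 normrM normfV.
rewrite ler_pdivrMl ?normr_gt0//; apply: le_trans (flat_bound _ _) _.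
rewrite -[h ^+ 2]ger0_norm ?sqr_ge0// normrX expr2 mulrCA ler_wpM2l//.
have F0 : 0 < k.+2`!%:R :> R by rewrite ltr0n fact_gt0.
rewrite mulrC -ler_pdivlMr//; near: h.
apply: (@cvgr_le _ _ _ _ (fun h : R => `|h|) 0); last by rewrite divr_gt0.
rewrite -[X in _ --> X](@normr0 _ R^o); apply: cvg_norm; apply: cvg_within.
Unshelve. all: by end_near. Qed.

Lemma smooth_flat k : smooth (flat k).
Proof.
move=> n; elim: n k => [k|n ih k]; first exact: derive_continuous (is_derive_flat k).
apply: DnS (is_derive_flat k) _.
by apply: Dn_add => //; apply: Dn_mul => //; exact: Dn_cst.
Qed.

(** The standard transition from 0 on x <= 0 to 1 on x >= 1, where the second term of the
    denominator vanishes. *)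
Definition smooth_step (x : R) : R := flat 0 x / (flat 0 x + flat 0 (1 - x)).

(** x and 1 - x cannot both be nonpositive. *)
Lemma smooth_step_denominator x : 0 < flat 0 x + flat 0 (1 - x).
Proof.
have [x0|x0] := ltP 0 x; first by rewrite ltr_wpDr ?flat_ge0 ?flat_pos.
by rewrite ltr_wpDl ?flat_ge0 ?flat_pos//; lra.
Qed.

Lemma smooth_smooth_step : smooth smooth_step.
Proof.
move=> n; apply: Dn_mul; first exact: smooth_flat.
apply: (@Dn_inv _ (fun x => flat 0 x + flat 0 (1 - x))).
  by move=> x; rewrite gt_eqF// smooth_step_denominator.
apply: Dn_add; first exact: smooth_flat.
have -> : (fun x => flat 0 (1 - x)) = (fun x => flat 0 (-1 * x + 1)).
  by apply/funext => x; congr flat; ring.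
by apply: Dn_comp_affine; exact: smooth_flat.
Qed.

(** The product of a step and its mirror image is an even function; the cancellation of the
    self-interaction of a vortex depends on this. *)
Definition cutoff (s : R) : R := smooth_step (s + 2) * smooth_step (2 - s).

Lemma smooth_cutoff : smooth cutoff.
Proof.
move=> n; rewrite /cutoff.
have -> : (fun s => smooth_step (s + 2) * smooth_step (2 - s)) =
    (fun s => smooth_step (1 * s + 2) * smooth_step (-1 * s + 2)).
  by apply/funext => s; congr (_ * _); congr smooth_step; ring.
by apply: Dn_mul; apply: Dn_comp_affine; exact: smooth_smooth_step.
Qed.

Lemma cutoff1 s : `|s| <= 1 -> cutoff s = 1.
Proof.
rewrite ler_norml => /andP[s1 s2].
have st x : 1 <= x -> smooth_step x = 1.
  move=> x1; rewrite /smooth_step [flat 0 (1 - x)]flat_le0 ?subr_le0// addr0 divff//.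
  by rewrite gt_eqF// flat_pos// (lt_le_trans _ x1).
by rewrite /cutoff !st ?mulr1//; lra.
Qed.

Lemma cutoff0 s : 2 <= `|s| -> cutoff s = 0.
Proof.
have st x : x <= 0 -> smooth_step x = 0 by move=> x0; rewrite /smooth_step flat_le0// mul0r.
rewrite /cutoff ler_normr => /orP[h|h]; [rewrite [X in _ * X]st ?mulr0//|rewrite st ?mul0r//]; lra.
Qed.

Lemma cutoff_even s : cutoff (- s) = cutoff s.
Proof. by rewrite /cutoff mulrC opprK addrC; congr (_ * smooth_step _); ring. Qed.

End smooth_line.
Section class_C.
Context {R : realType}.

Lemma is_derive_coord n (f : 'rV[R]_n -> R) (x : 'rV[R]_n) (j : 'I_n) (d : R) :
  is_derive 0 (1 : R) (fun h : R => f (h *: delta_mx 0 j + x)) d ->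
  is_derive x (delta_mx 0 j) f d.
Proof.
pose l (h : R) := h *: delta_mx 0 j + x : 'rV[R]_n.
have aff (h : R) : l (h *: 1 + 0) = h *: delta_mx 0 j + l 0.
  by rewrite /l scale0r add0r addr0 [_ *: 1]mulr1.
have l0 : l 0 = x by rewrite /l scale0r add0r.
move=> [dl <-]; apply: DeriveDef.
  by have := (derivable_comp_affine f aff).1 dl; rewrite l0.
by have := derive_comp_affine f aff; rewrite l0.
Qed.

Lemma pderivs_add n k (f g : 'rV[R]_n -> R) : class_C k f -> class_C k g ->
  forall s, (size s <= k)%N ->
  pderivs s (fun x => f x + g x) = (fun x => pderivs s f x + pderivs s g x).
Proof.
move=> Cf Cg; elim=> [//|j s ih] sk /=; rewrite ih; last exact: ltnW.
apply/funext => x; rewrite /pderiv.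
rewrite (@deriveD _ _ _ (pderivs s f) (pderivs s g))//.
  by have [_ h] := Cf s (ltnW sk); exact: h.
by have [_ h] := Cg s (ltnW sk); exact: h.
Qed.

Lemma class_C_add n k (f g : 'rV[R]_n -> R) : class_C k f -> class_C k g ->
  class_C k (fun x => f x + g x).
Proof.
move=> Cf Cg s sk; rewrite (pderivs_add Cf Cg)//.
have [cf df] := Cf s sk; have [cg dg] := Cg s sk; split.
  exact: continuous_add_fun.
by move=> sk' i x; apply: derivableD; [exact: df|exact: dg].
Qed.

Lemma class_C_scale n k (c : R) (f : 'rV[R]_n -> R) : class_C k f ->
  class_C k (fun x => c * f x).
Proof.
move=> Cf s sk.
have E : forall s, (size s <= k)%N ->
    pderivs s (fun x => c * f x) = (fun x => c * pderivs s f x).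
  elim=> [//|j t ih] tk /=; rewrite ih; last exact: ltnW.
  apply/funext => x; rewrite /pderiv.
  by rewrite (@deriveZ _ _ _ (pderivs t f))//; have [_ h] := Cf t (ltnW tk); exact: h.
rewrite E//; have [cf df] := Cf s sk; split.
  exact: continuous_scale_fun.
by move=> sk' i x; apply: (@derivableZ _ _ _ (pderivs s f)); exact: df.
Qed.

Lemma class_C_cst n k (c : R) : class_C k (fun _ : 'rV[R]_n => c).
Proof.
move=> s _.
have [d ->] : exists d, pderivs s (fun _ : 'rV[R]_n => c) = cst d.
  elim: s => [|j s [d ih]]; first by exists c.
  by exists 0; rewrite /= ih; apply/funext => x; rewrite /pderiv derive_cst.
by split=> [|_ i x]; [exact: cst_continuous|exact: derivable_cst].
Qed.

Lemma class_C_sum n k (I : finType) (f : I -> 'rV[R]_n -> R) :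
  (forall i, class_C k (f i)) -> class_C k (fun x => \sum_i f i x).
Proof.
move=> Cf; elim: (index_enum I) => [|i s ih].
  by under eq_fun do rewrite big_nil; exact: class_C_cst.
by under eq_fun do rewrite big_cons; exact: (class_C_add (Cf i) ih).
Qed.

Lemma test_fun_compact n (V K : set 'rV[R]_n) (phi : 'rV[R]_n -> R) :
  (forall k, class_C k phi) -> compact K -> closed K -> K `<=` V ->
  (forall x, phi x != 0 -> K x) -> test_fun V phi.
Proof.
move=> Cphi cK clK KV phiK.
have supp : closure [set x | phi x != 0] `<=` K.
  by rewrite [K](closure_id _).1//; apply: closure_subset.
split=> //; last exact: subset_trans KV.
by apply: subclosed_compact cK supp; exact: closed_closure.
Qed.

Lemma class_C_continuous n k (f : 'rV[R]_n -> R) : class_C k f -> continuous f.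
Proof. by move=> Cf; have [] := Cf [::] isT. Qed.

Lemma class_C_pderiv n k (f : 'rV[R]_n -> R) (i : 'I_n) : class_C k.+1 f ->
  class_C k (pderiv i f).
Proof.
move=> Cf s sk.
have E : pderivs s (pderiv i f) = pderivs (rcons s i) f by rewrite /pderivs foldr_rcons.
by rewrite E; have := Cf (rcons s i); rewrite size_rcons; apply.
Qed.

Lemma class_C_derivable n k (f : 'rV[R]_n -> R) (i : 'I_n) x : class_C k.+1 f ->
  derivable f x (delta_mx 0 i).
Proof. by move=> Cf; have [_] := Cf [::] isT; apply. Qed.

End class_C.

Section tame.
Context {R : realType}.
Implicit Types f g : R -> R.

(** This class is stable under [derive1], so the partial derivatives of a product of tame factors
    are again such products, up to a scalar. *)
Definition tame f := smooth f /\ (forall s, 2 < `|s| -> f s = 0).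

Lemma tame_derive f : tame f -> tame (derive1 f).
Proof.
move=> [sf f0]; split; first by move=> n; have [] := sf n.+1.
move=> s s2; rewrite derive1E (@near_eq_derive _ _ _ f (cst (0 : R))) ?derive_cst//.
near=> t; rewrite /= f0//; near: t.
by apply: (@cvgr_gt _ _ _ _ (fun t : R => `|t|) `|s|) => //; exact: norm_continuous.
Unshelve. all: by end_near. Qed.

Lemma tame_cutoff : tame (@cutoff R).
Proof. by split; [exact: smooth_cutoff|move=> s /ltW; exact: cutoff0]. Qed.

(** A compactly supported substitute for the coordinate s, with derivative 1 on ]-1, 1[: the factor
    of the stream function along x_1. *)
Definition lump (s : R) : R := s * cutoff s.

Lemma tame_lump : tame lump.
Proof.
split=> [n|s /ltW s2]; last by rewrite /lump cutoff0// mulr0.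
apply: Dn_mul; last exact: smooth_cutoff.
rewrite (_ : id = (fun x : R => 1 * x + 0)); last by apply/funext => x; rewrite mul1r addr0.
apply: (@Dn_comp_affine _ n id); case: n => [|n]; first by move=> x; exact: cvg_id.
by apply: (DnS (f' := cst 1)) => //; exact: Dn_cst.
Qed.

Lemma tame_bounded f : tame f -> exists2 M, 0 <= M & forall s, `|f s| <= M.
Proof.
move=> [sf f0].
have cf : compact (f @` `[-2, 2]%classic).
  apply: continuous_compact; last exact: segment_compact.
  by apply: continuous_subspaceT; exact: Dn_continuous (sf 0%N).
have [K [_ hK]] := compact_bounded cf.
have K0 : 0 <= `|K| + 1 by rewrite addr_ge0.
exists (`|K| + 1) => // s; have [s2|s2] := leP `|s| 2; last by rewrite f0// normr0.
apply: (hK (`|K| + 1)); first by rewrite (le_lt_trans (ler_norm K))// ltrDl.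
by exists s => //=; rewrite in_itv/= -ler_norml.
Qed.

Lemma tame_is_derive f s : tame f -> is_derive s (1 : R) f (derive1 f s).
Proof. by move=> [sf _]; exact: Dn_is_derive (sf 1%N). Qed.

Lemma derive_cutoff1 s : `|s| < 1 -> derive1 (@cutoff R) s = 0.
Proof.
move=> s1; rewrite derive1E (@near_eq_derive _ _ _ _ (cst (1 : R))) ?derive_cst//.
near=> t; rewrite /= cutoff1//; apply: ltW; near: t.
by apply: (@cvgr_lt _ _ _ _ (fun t : R => `|t|) `|s|) => //; exact: norm_continuous.
Unshelve. all: by end_near. Qed.

Lemma derive_lump1 s : `|s| < 1 -> derive1 lump s = 1.
Proof.
move=> s1; rewrite derive1E (@near_eq_derive _ _ _ _ id) ?derive_id//.
near=> t; rewrite /= /lump cutoff1 ?mulr1//; apply: ltW; near: t.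
by apply: (@cvgr_lt _ _ _ _ (fun t : R => `|t|) `|s|) => //; exact: norm_continuous.
Unshelve. all: by end_near. Qed.

End tame.

(** * Rescaled products of functions of one coordinate *)

Section tensor.
Context {R : realType} (n : nat).
Implicit Types (F : 'I_n -> R -> R) (a x : 'rV[R]_n) (r : R).

Definition tensor F a r x : R := \prod_i F i ((x 0 i - a 0 i) / r).

Definition derive_factor (j : 'I_n) F (i : 'I_n) : R -> R :=
  if i == j then derive1 (F i) else F i.

Definition tame_family F := forall i, tame (F i).

Lemma tame_derive_factor j F : tame_family F -> tame_family (derive_factor j F).
Proof.
by move=> tF i; rewrite /derive_factor; case: ifP => // _; exact: tame_derive.
Qed.

(** Only the factor j varies along this line; the rescaling produces the 1/r of all later gradient
    bounds. *)
Lemma is_derive_tensor F a r x j : tame_family F ->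
  is_derive x (delta_mx 0 j) (tensor F a r) (r^-1 * tensor (derive_factor j F) a r x).
Proof.
move=> tF; apply: is_derive_coord.
pose K := \prod_(i | i != j) F i ((x 0 i - a 0 i) / r).
have -> : (fun h : R => tensor F a r (h *: delta_mx 0 j + x)) =
    (fun h => K * F j (r^-1 * h + (x 0 j - a 0 j) / r)).
  apply/funext => h; rewrite /tensor (bigD1 j)//= mulrC; congr (_ * _).
    apply: eq_bigr => i ij; by rewrite !mxE (negbTE ij) andbF mulr0 add0r.
  by congr (F j _); rewrite !mxE !eqxx mulr1; ring.
have -> : r^-1 * tensor (derive_factor j F) a r x =
    K *: (r^-1 * derive1 (F j) ((x 0 j - a 0 j) / r)).
  rewrite /tensor (bigD1 j)//= /derive_factor eqxx.
  rewrite [X in _ * (_ * X)](_ : _ = K); first by rewrite /GRing.scale/=; ring.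
  by apply: eq_bigr => i /negbTE ->.
apply: (@is_deriveZ _ _ _ (fun h => F j (r^-1 * h + (x 0 j - a 0 j) / r))).
apply: is_derive_comp_affine; rewrite mulr0 add0r; exact: tame_is_derive.
Qed.

Lemma pderiv_tensor F a r j : tame_family F ->
  pderiv j (tensor F a r) = (fun x => r^-1 * tensor (derive_factor j F) a r x).
Proof. by move=> tF; apply/funext => x; have [_ <-] := is_derive_tensor a r x j tF. Qed.

Lemma continuous_tensor F a r : tame_family F -> continuous (tensor F a r).
Proof.
move=> tF; apply: continuous_prod_fun => i x.
have cg : continuous (fun x : 'rV[R]_n => (x 0 i - a 0 i) / r).
  apply: continuous_mul_fun; last exact: cst_continuous.
  by apply: continuous_add_fun; [exact: coord_continuous|exact: cst_continuous].
apply: (continuous_comp (cg x)).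
by apply: Dn_continuous; have [sf _] := tF i; exact: (sf 0%N).
Qed.

(** Every iterated derivative is a scalar times a [tensor] of tame factors, hence continuous and
    derivable; this settles all orders at once. *)
Lemma class_C_tensor F a r k : tame_family F -> class_C k (tensor F a r).
Proof.
move=> tF s _; have [c [G [tG ->]]] : exists c G, tame_family G /\
    pderivs s (tensor F a r) = (fun x => c * tensor G a r x).
  elim: s => [|j s [c [G [tG ih]]]] /=.
    by exists 1, F; split=> //; apply/funext => x; rewrite mul1r.
  exists (c * r^-1), (derive_factor j G); split; first exact: tame_derive_factor.
  rewrite ih; apply/funext => x; rewrite /pderiv (@deriveZ _ _ _ (tensor G a r)).
    by rewrite -/(pderiv j _ x) pderiv_tensor// [LHS]mulrA.
  by have [] := is_derive_tensor a r x j tG.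
split=> [|_ i x]; first by apply: continuous_scale_fun; exact: continuous_tensor.
by apply: (@derivableZ _ _ _ (tensor G a r)); have [] := is_derive_tensor a r x i tG.
Qed.

Lemma tensor_outside F a r x : tame_family F -> 0 < r -> 2 * r < `|x - a| ->
  tensor F a r x = 0.
Proof.
move=> tF r0 xr; have [i xi] : exists i, 2 * r < `|(x - a) 0 i|.
  apply: contrapT => /forallNP h; move: xr; rewrite ltNge => /negP; apply.
  by apply: norm_le_coord => [|i]; [rewrite mulr_ge0// ltW|rewrite leNgt; exact/negP].
rewrite /tensor (bigD1 i)//=; have [_ ->] := tF i; first by rewrite mul0r.
by rewrite normrM normfV (gtr0_norm r0) ltr_pdivlMr//; move: xi; rewrite !mxE.
Qed.

Lemma tensor_bounded F : tame_family F ->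
  exists2 M, 0 <= M & forall a r x, `|tensor F a r x| <= M.
Proof.
move=> tF; have /choice[M hM] : forall i, exists M, forall s, `|F i s| <= M.
  by move=> i; have [M _ hM] := tame_bounded (tF i); exists M.
have M0 i : 0 <= M i by apply: le_trans (hM i 0).
exists (\prod_i M i); first by apply: prodr_ge0.
by move=> a r x; rewrite /tensor normr_prod; apply: ler_prod => i _; rewrite normr_ge0 hM.
Qed.

(** The integrand is the j-th derivative of r times the [tensor] of F, which has bounded support. *)
Lemma integral_tensor_derive F a r j : tame_family F -> 0 < r ->
  (\int[@lebesgue_rV R n]_x (tensor (derive_factor j F) a r x)%:E = 0)%E.
Proof.
move=> tF r0.
have E x : tensor (derive_factor j F) a r x = pderiv j (fun y => r * tensor F a r y) x.
  rewrite /pderiv (@deriveZ _ _ _ (tensor F a r)).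
    by rewrite -/(pderiv j _ x) pderiv_tensor// /GRing.scale/= mulrA divff ?gt_eqF// mul1r.
  by have [] := is_derive_tensor a r x j tF.
under eq_integral do rewrite E.
have CF := class_C_scale r (@class_C_tensor F a r 1 tF).
apply: (integral_pderiv (r := `|a| + 2 * r)).
- by move=> x; exact: class_C_derivable CF.
- exact: class_C_continuous (class_C_pderiv j CF).
- move=> x ax; rewrite tensor_outside ?mulr0//.
  have := lerB_dist x a; lra.
Qed.

End tensor.
(** * Divergence free fields equal to e_n on a cube *)

Section field.
Context {R : realType}.

(* [field a r] is the rotated gradient, in the plane of the first and the last
   coordinates, of the stream function r * prod_i stream_factor i ((x_i - a_i) / r);
   on the cube of radius r, this stream function is x_1 - a_1. *)
Definition stream_factor n (i : 'I_n.+1) : R -> R := if i == ord0 then lump else cutoff.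

Lemma tame_stream_factor n : tame_family (@stream_factor n).
Proof.
by move=> i; rewrite /stream_factor; case: ifP => _; [exact: tame_lump|exact: tame_cutoff].
Qed.

(** Defined in every positive dimension, since the same function in dimension n-1 is the horizontal
    cutoff that multiplies eta in the gravity term. *)
Definition field_vert n (a : 'rV[R]_n.+1) (r : R) : 'rV[R]_n.+1 -> R :=
  tensor (derive_factor ord0 (@stream_factor n)) a r.

Definition field_horiz n (a : 'rV[R]_n.+1) (r : R) : 'rV[R]_n.+1 -> R :=
  tensor (derive_factor ord_max (@stream_factor n)) a r.

Lemma coord_inside n (a x : 'rV[R]_n) r i : 0 < r -> `|x - a| < r ->
  `|(x 0 i - a 0 i) / r| < 1.
Proof.
move=> r0 xr; rewrite normrM normfV (gtr0_norm r0) ltr_pdivrMr// mul1r.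
by have := le_lt_trans (ler_coord_norm (x - a) i) xr; rewrite !mxE.
Qed.

Lemma near_inside n (a x : 'rV[R]_n) r : `|x - a| < r -> \forall y \near x, `|y - a| < r.
Proof.
have ca : continuous (fun y : 'rV[R]_n => y - a).
  by move=> y; apply: (@cvgB _ _ _ (nbhs y) _ id (cst a) y a); [exact: cvg_id|exact: cvg_cst].
have cn := continuous_comp (ca x) (@norm_continuous _ _ _).
by move=> xr; move/cvgr_lt : cn; exact.
Qed.

Lemma field_vert_inside n (a x : 'rV[R]_n.+1) r : 0 < r -> `|x - a| < r ->
  field_vert a r x = 1.
Proof.
move=> r0 xr; rewrite /field_vert /tensor big1// => i _.
rewrite /derive_factor /stream_factor; have xi := coord_inside i r0 xr.
by have [] := eqVneq i ord0; [rewrite derive_lump1|rewrite cutoff1// ltW].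
Qed.

Lemma pderiv_field_vert_inside n (a x : 'rV[R]_n.+1) r i : 0 < r -> `|x - a| < r ->
  pderiv i (field_vert a r) x = 0.
Proof.
move=> r0 xr; rewrite /pderiv (@near_eq_derive _ _ _ _ (cst (1 : R))) ?derive_cst//.
near=> y; rewrite /= field_vert_inside//; near: y; exact: near_inside.
Unshelve. all: by end_near. Qed.

Definition field n (a : 'rV[R]_n.+2) (r : R) (x : 'rV[R]_n.+2) : 'rV[R]_n.+2 :=
  \row_j (if j == ord_max then field_vert a r x
          else if j == ord0 then - field_horiz a r x else 0).

Variable n : nat.
Implicit Types (a x : 'rV[R]_n.+2) (r : R).
Local Notation vmax := (@ord_max n.+1).

Let tS i : tame_family (derive_factor i (@stream_factor n.+1)).
Proof. by apply: tame_derive_factor; exact: tame_stream_factor. Qed.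

Lemma field_max a r : (fun x => field a r x 0 vmax) = field_vert a r.
Proof. by apply/funext => x; rewrite mxE eqxx. Qed.

Lemma field_ord0 a r : (fun x => field a r x 0 ord0) = (fun x => (-1) * field_horiz a r x).
Proof. by apply/funext => x; rewrite mxE /= mulN1r. Qed.

Lemma field_other a r j : j != vmax -> j != ord0 -> (fun x => field a r x 0 j) = cst 0.
Proof. by move=> j1 j0; apply/funext => x; rewrite mxE (negbTE j1) (negbTE j0). Qed.

Lemma field_ind (Q : 'I_n.+2 -> Prop) : Q vmax -> Q ord0 ->
  (forall j, j != vmax -> j != ord0 -> Q j) -> forall j, Q j.
Proof.
move=> Q1 Q0 Q2 j; have [->//|j1] := eqVneq j vmax.
by have [->//|j0] := eqVneq j ord0; exact: Q2.
Qed.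

Lemma class_C_field a r j k : class_C k (fun x => field a r x 0 j).
Proof.
move: j; apply: field_ind.
- by rewrite field_max; exact: class_C_tensor.
- by rewrite field_ord0; apply: class_C_scale; exact: class_C_tensor.
- by move=> j j1 j0; rewrite field_other//; exact: class_C_cst.
Qed.

Lemma field_outside a r x : 0 < r -> 2 * r < `|x - a| -> field a r x = 0.
Proof.
move=> r0 xr; apply/rowP => j; rewrite !mxE.
by rewrite /field_vert /field_horiz !tensor_outside// oppr0; case: ifP => // _; case: ifP.
Qed.

(** Only the height of x matters: the factor along x_n is the derivative of [cutoff], which vanishes
    on ]-1, 1[. Hence the field is vertical on the whole surface once r exceeds the bound of
    |eta|. *)
Lemma field_horiz0 a r x : 0 < r -> `|x 0 vmax - a 0 vmax| < r -> field_horiz a r x = 0.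
Proof.
move=> r0 xr; rewrite /field_horiz /tensor (bigD1 vmax)//= /derive_factor eqxx.
rewrite /stream_factor /= derive_cutoff1 ?mul0r//.
by rewrite normrM normfV (gtr0_norm r0) ltr_pdivrMr// mul1r.
Qed.

Lemma field_inside a r x : 0 < r -> `|x - a| < r -> field a r x = delta_mx 0 vmax.
Proof.
move=> r0 xr; apply/rowP => j; rewrite !mxE eqxx /=.
case: ifP => [_|_].
  by rewrite field_vert_inside.
case: ifP => // _; rewrite field_horiz0 ?oppr0//.
by have := le_lt_trans (ler_coord_norm (x - a) vmax) xr; rewrite !mxE.
Qed.

Lemma pderiv_field_outside a r x i j : 0 < r -> 2 * r < `|x - a| ->
  pderiv i (fun y => field a r y 0 j) x = 0.
Proof.
move=> r0; apply: (@pderiv_outside _ _ _ (fun y => field a r y 0 j)) => y yr.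
by rewrite field_outside// mxE.
Qed.

Lemma pderiv_field_inside a r x i j : 0 < r -> `|x - a| < r ->
  pderiv i (fun y => field a r y 0 j) x = 0.
Proof.
move=> r0 xr; rewrite /pderiv.
rewrite (@near_eq_derive _ _ _ _ (cst ((delta_mx 0 vmax : 'rV[R]_n.+2) 0 j))) ?derive_cst//.
near=> y; rewrite /= field_inside//; near: y.
exact: near_inside.
Unshelve. all: by end_near. Qed.

Lemma pderiv_field_max a r i : pderiv i (fun y => field a r y 0 vmax) =
  fun x => r^-1 * tensor (derive_factor i (derive_factor ord0 (@stream_factor n.+1))) a r x.
Proof. by rewrite field_max pderiv_tensor. Qed.

Lemma pderiv_field_ord0 a r i : pderiv i (fun y => field a r y 0 ord0) =
  fun x => - (r^-1 * tensor (derive_factor i (derive_factor vmax (@stream_factor n.+1))) a r x).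
Proof.
rewrite field_ord0; apply/funext => x; rewrite /pderiv (@deriveZ _ _ _ (field_horiz a r)).
  by rewrite -/(pderiv i _ x) pderiv_tensor// /GRing.scale/= mulN1r.
exact: class_C_derivable (@class_C_tensor _ _ _ a r 1 (tS vmax)).
Qed.

Lemma pderiv_field_other a r i j : j != vmax -> j != ord0 ->
  pderiv i (fun y => field a r y 0 j) = cst 0.
Proof.
move=> j1 j0; rewrite field_other//; apply/funext => x; rewrite /pderiv derive_cst//.
Qed.

(** The two mixed derivatives of the stream function agree: differentiating the first and the last
    factor in either order gives the same family. *)
Lemma field_divergence a r x : \sum_i pderiv i (fun y => field a r y 0 i) x = 0.
Proof.
rewrite (bigD1 vmax)//= (bigD1 ord0)//= big1 => [|i /andP[i1 i0]]; last first.
  by rewrite pderiv_field_other.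
rewrite pderiv_field_max pderiv_field_ord0 addr0.
apply/eqP; rewrite subr_eq0; apply/eqP; congr (_ * tensor _ a r x).
apply/funext => i; rewrite /derive_factor.
by case: ifP => [/eqP ->//|_]; case: ifP.
Qed.

(** Scaling: the factor r in the stream function makes the field bounded uniformly in a and r, and
    one more derivative costs 1/r. *)
Lemma field_bounded : exists2 B, 0 <= B & forall a r x, 0 < r ->
  (forall j, `|field a r x 0 j| <= B) /\
  (forall i j, `|pderiv i (fun y => field a r y 0 j) x| <= B / r).
Proof.
have [A A0 hA] := tensor_bounded (tS ord0).
have [B B0 hB] := tensor_bounded (tS vmax).
have /choice[C hC] i : exists C, forall a r x,
    `|tensor (derive_factor i (derive_factor ord0 (@stream_factor n.+1))) a r x| <= C.
  by have [C _ hC] := tensor_bounded (tame_derive_factor i (tS ord0)); exists C.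
have /choice[D hD] i : exists D, forall a r x,
    `|tensor (derive_factor i (derive_factor vmax (@stream_factor n.+1))) a r x| <= D.
  by have [D _ hD] := tensor_bounded (tame_derive_factor i (tS vmax)); exists D.
have C0 i : 0 <= C i by apply: le_trans (hC i 0 0 0).
have D0 i : 0 <= D i by apply: le_trans (hD i 0 0 0).
have sumle (F : 'I_n.+2 -> R) i : (forall i, 0 <= F i) -> F i <= \sum_i F i.
  by move=> F0; rewrite (bigD1 i)//= lerDl sumr_ge0.
exists (A + B + \sum_i C i + \sum_i D i).
  by rewrite !addr_ge0// sumr_ge0.
have SC : 0 <= \sum_i C i by apply: sumr_ge0 => i _.
have SD : 0 <= \sum_i D i by apply: sumr_ge0 => i _.
move=> a r x r0; split.
  move=> j; have := hA a r x; have := hB a r x; rewrite -/(field_vert a r x) -/(field_horiz a r x).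
  move=> h1 h2; rewrite mxE; case: ifP => _; first by lra.
  by case: ifP => _; rewrite ?normrN ?normr0; lra.
move=> i; apply: field_ind.
- rewrite pderiv_field_max normrM normfV (gtr0_norm r0) mulrC ler_pM2r ?invr_gt0//.
  by have := hC i a r x; have := sumle C i C0; lra.
- rewrite pderiv_field_ord0 normrN normrM normfV (gtr0_norm r0) mulrC ler_pM2r ?invr_gt0//.
  by have := hD i a r x; have := sumle D i D0; lra.
- move=> j j1 j0; rewrite pderiv_field_other// normr0 divr_ge0//; last exact: ltW.
  by rewrite !addr_ge0.
Qed.

(** Separating the height from x' reduces the volume integrals of the gravity term to an integral of
    [cutoff] on each vertical line. *)
Lemma field_vert_join (a : 'rV[R]_n.+2) r (x' : 'rV[R]_n.+1) t :
  field_vert a r (join x' t) = field_vert (horiz a) r x' * cutoff ((t - vert a) / r).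
Proof.
rewrite /field_vert /tensor (bigD1_ord vmax)//= mulrC; congr (_ * _).
  apply: eq_bigr => i _; rewrite !mxE liftK /derive_factor /stream_factor.
  suff -> : (lift vmax i == ord0) = (i == ord0) by [].
  by rewrite -val_eqE /= /bump leqNgt ltn_ord.
by rewrite mxE unlift_none /derive_factor /stream_factor.
Qed.

Lemma integral_field_vert (a : 'rV[R]_n.+1) r : 0 < r ->
  (\int[@lebesgue_rV R n.+1]_x (field_vert a r x)%:E = 0)%E.
Proof. by move=> r0; apply: integral_tensor_derive => //; exact: tame_stream_factor. Qed.

End field.
(** * Decay at infinity *)

Section decay.
Context {R : realType}.
Local Notation leb n := (@lebesgue_rV R n).

Lemma powR_natr_cvg0 (e : R) : 0 < e -> N%:R `^ (- e) @[N --> \oo] --> (0 : R).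
Proof.
move=> e0; apply/cvgrPdist_lt => d d0; near=> N.
have N0 : 0 < N%:R :> R by rewrite ltr0n; near: N; exact: nbhs_infty_gt.
rewrite sub0r normrN ger0_norm ?powR_ge0// powRN.
rewrite -[ltRHS]invrK ltf_pV2 ?posrE ?powR_gt0 ?invr_gt0//.
have dE : d^-1 = (d^-1 `^ e^-1) `^ e.
  by rewrite -powRrM mulVf ?gt_eqF// powRr1// invr_ge0 ltW.
rewrite dE gt0_ltr_powR// ?nnegrE ?powR_ge0 ?ltW//.
near: N; exact: nbhs_infty_gtr.
Unshelve. all: by end_near. Qed.

(** An integrand O(N^(-b)) on a cube of volume (4 N)^n, with b > n. The support condition is stated
    at N+1 so as to avoid the radius 0. *)
Lemma Rintegral_far n (D : set 'rV[R]_n) (b : R) (f : nat -> 'rV[R]_n -> R) (C : R) :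
  measurable D -> (forall N, measurable_fun D (f N)) -> n%:R < b ->
  (\forall N \near \oo, forall x, D x -> `|f N x| <= C * N%:R `^ (- b)) ->
  (forall N x, D x -> 2 * N.+1%:R < `|x| -> f N.+1 x = 0) ->
  (\int[leb n]_(x in D) f N x)%R @[N --> \oo] --> (0 : R).
Proof.
move=> mD mf nb fC f0.
(* The cube of radius 2 N has side 4 N. *)
pose K := `|C| * 4 ^+ n.
have hK : (fun N : nat => K * N%:R `^ (- (b - n%:R))) @ \oo --> (0 : R).
  rewrite -[X in _ --> X](mulr0 K); apply: cvgM; first exact: cvg_cst.
  by apply: powR_natr_cvg0; rewrite subr_gt0.
apply/cvgr0Pnorm_le => e e0; move/cvgr0Pnorm_le : hK => /(_ e e0) hKe; near=> N.
have : K * N%:R `^ (- (b - n%:R)) <= e.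
  by apply: le_trans (ler_norm _) _; near: N; exact: hKe.
apply: le_trans.
have N0 : (0 < N)%N by near: N; exact: nbhs_infty_gt.
have NR : 0 < N%:R :> R by rewrite ltr0n.
have fN : forall x, D x -> `|f N x| <= C * N%:R `^ (- b) by near: N.
have := @Rintegral_bounded_support _ _ D (f N) 0 (2 * N%:R) (`|C| * N%:R `^ (- b)) mD (mf N).
have -> : `|C| * N%:R `^ (- b) * (2 * (2 * N%:R)) ^+ n = K * N%:R `^ (- (b - n%:R)).
  rewrite /K (_ : - (b - n%:R) = - b + n%:R); last by ring.
  rewrite powRD ?(gt_eqF NR) ?implybT// powR_mulrn ?ltW//.
  by rewrite mulrA exprMn (_ : 2 * 2 = 4 :> R); ring.
apply.
- by rewrite mulr_ge0// ltW.
- by rewrite mulr_ge0// powR_ge0.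
- move=> x Dx _; apply: le_trans (fN _ Dx) _.
  by rewrite ler_wpM2r ?powR_ge0// ler_norm.
- move=> x Dx; rewrite subr0.
  by have := f0 N.-1 x Dx; rewrite prednK.
Unshelve. all: by end_near. Qed.

(** The sup norm is at most the Euclidean one and t^(-b) is nonincreasing, so decay in terms of
    [enorm] gives decay outside cubes. *)
Lemma decays_nat n (D : set 'rV[R]_n) (b : R) (f : 'rV[R]_n -> R) : 0 <= b ->
  decays D b f -> exists2 C, 0 <= C & \forall N \near \oo,
    forall x, D x -> N%:R <= `|x| -> `|f x| <= C * N%:R `^ (- b).
Proof.
move=> b0 [C [r Cr]]; exists `|C| => //; near=> N => x Dx Nx.
have N0 : 0 < N%:R :> R by rewrite ltr0n; near: N; exact: nbhs_infty_gt.
have Ne : N%:R <= enorm x by exact: le_trans Nx (norm_le_enorm x).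
apply: (le_trans (Cr _ Dx _)).
  by apply: lt_le_trans Ne; near: N; exact: nbhs_infty_gtr.
apply: (@le_trans _ _ (`|C| * enorm x `^ (- b))).
  by rewrite ler_wpM2r ?powR_ge0// ler_norm.
rewrite ler_wpM2l// !powRN lef_pV2 ?posrE ?powR_gt0//; last exact: lt_le_trans Ne.
by rewrite ge0_ler_powR// nnegrE ?ltW// (lt_le_trans N0 Ne).
Unshelve. all: by end_near. Qed.

(** Dyadic decomposition: the shells between the cubes of radii p 2^k and p 2^(k+1) contribute at
    most a geometric series of ratio q = 2^(n-b) < 1. *)
Lemma decays_integrable n (f : 'rV[R]_n -> R) (b : R) : continuous f ->
  (exists M, forall x, `|f x| <= M) -> n%:R < b -> decays setT b f ->
  (leb n).-integrable setT (EFin \o f).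
Proof.
move=> cf [M fM] nb [C [r Cr]].
(* p > r puts the outside of every cube in the region of decay; p >= 1 makes the cubes exhaust the
   space, as k <= 2^k. *)
pose p : R := `|r| + 1.
have p0 : 0 < p by rewrite ltr_wpDl.
pose c k : R := p * 2 ^+ k.
have c0 k : 0 < c k by rewrite mulr_gt0// exprn_gt0.
have M0 : 0 <= M by apply: le_trans (fM 0).
pose F k := cube (0 : 'rV[R]_n) (c k).
have mF k : measurable (F k) by exact: measurable_cube.
have FS k : F k `<=` F k.+1.
  by move=> x /le_trans; apply; rewrite /c exprS ler_pM2l// ler_peMl ?exprn_ge0// ler1n.
have ndF : nondecreasing_seq F.
  by apply/nondecreasing_seqP => k; apply/subsetPset; exact: FS.
have mf : measurable_fun setT f by exact: continuous_measurable_rV.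
pose q : R := 2 `^ (n%:R - b).
have q1 : q < 1.
  rewrite /q -opprB powRN invf_lt1 ?powR_gt0// -[ltLHS](powRr0 2).
  rewrite /powR gt_eqF// ltr_expR ltr_pM2r ?subr_gt0//.
  by rewrite ln_gt0// ltr1n.
have q0 : 0 <= q by exact: powR_ge0.
(* On the k-th shell, |f| <= |C| (p 2^k)^(-b), inside a cube of side 2 c_1 2^k; the powers of 2^k
   combine into q^k. *)
pose A : R := `|C| * p `^ (- b) * (2 * c 1) ^+ n.
have A0 : 0 <= A by rewrite !mulr_ge0 ?powR_ge0// exprn_ge0// mulr_ge0// ltW.
pose V : R := M * (2 * c 0) ^+ n.
have mfn : measurable_fun setT (fun x => `|f x|) by exact: measurableT_comp.
have iF (D : set 'rV[R]_n) k : measurable D -> D `<=` F k ->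
    (leb n).-integrable D (EFin \o (fun x => `|f x|)).
  move=> mD DF; apply: (@integrable_bounded_support _ _ _ _ 0 (c k) M) => //.
  - exact: measurable_funS mfn.
  - exact: ltW.
  - by move=> x _ _; rewrite normr_id.
  - by move=> x /DF xF; rewrite ltNge xF.
have step k : (\int[leb n]_(x in F k.+1) `|f x|)%R <=
    (\int[leb n]_(x in F k) `|f x|)%R + A * q ^+ k.
  have mD : measurable (F k.+1 `\` F k) by exact: measurableD.
  have FE : F k.+1 = F k `|` (F k.+1 `\` F k).
    by rewrite setDUK//; exact: FS.
  rewrite {1}FE Rintegral_setU//; last 2 first.
  - by rewrite -FE; apply: (iF _ k.+1).
  - by apply/disj_setPS => x [h [_ ]]; exact.
  rewrite lerD2l; apply: le_trans (ler_norm _) _.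
  apply: le_trans (@Rintegral_bounded_support _ _ _ (fun x => `|f x|) 0 (c k.+1)
    (`|C| * c k `^ (- b)) mD _ (ltW (c0 _)) _ _ _) _.
  - exact: measurable_funS mfn.
  - by rewrite mulr_ge0// powR_ge0.
  - move=> x [_ /negP xk] _; rewrite normr_id.
    have ck : c k < `|x| by move: xk; rewrite -ltNge subr0.
    have ce : c k < enorm x by exact: lt_le_trans ck (norm_le_enorm x).
    have rc : r < enorm x.
      apply: le_lt_trans (ler_norm r) _; apply: lt_trans ce.
      apply: (@lt_le_trans _ _ p); first by rewrite ltrDl.
      by rewrite /c ler_peMr ?(ltW p0)// exprn_ege1// ler1n.
    apply: le_trans (Cr x I rc) _.
    apply: (@le_trans _ _ (`|C| * enorm x `^ (- b))).
      by rewrite ler_wpM2r ?powR_ge0// ler_norm.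
    rewrite ler_wpM2l// !powRN lef_pV2 ?posrE ?powR_gt0//; last exact: lt_trans ce.
    rewrite ge0_ler_powR ?nnegrE ?ltW//; last exact: lt_trans ce.
    by rewrite (le_lt_trans _ nb).
  - by move=> x [xF _]; rewrite ltNge xF.
  have E2 : (2 : R) ^+ k = 2 `^ k%:R by rewrite powR_mulrn.
  have qE : q ^+ k = (2 ^+ k) `^ (- b) * (2 ^+ k) ^+ n.
    rewrite E2 -(@powR_mulrn _ q)// -(@powR_mulrn _ (2 `^ k%:R)) ?powR_ge0//.
    rewrite /q -!powRrM -powRD ?pnatr_eq0 ?implybT//; congr (_ `^ _); ring.
  have cE : 2 * c k.+1 = 2 * c 1 * 2 ^+ k by rewrite /c exprS expr1; ring.
  have bE : c k `^ (- b) = p `^ (- b) * (2 ^+ k) `^ (- b).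
    by rewrite /c powRM ?exprn_ge0 ?(ltW p0).
  rewrite qE cE exprMn bE /A le_eqVlt; apply/orP; left; apply/eqP.
  by move: (_ ^+ n) (_ `^ _) (_ `^ _) (_ ^+ n) => *; ring.
(* V bounds the integral over the first cube; the other term is the sum of the first k shell
   bounds. *)
have bnd k : (\int[leb n]_(x in F k) `|f x|)%R <= V + A / (1 - q) * (1 - q ^+ k).
  elim: k => [|k ih].
    rewrite expr0 subrr mulr0 addr0.
    apply: le_trans (ler_norm _) _.
    apply: (@Rintegral_bounded_support _ _ _ (fun x => `|f x|) 0 (c 0)) => //.
    - exact: measurable_funS mfn.
    - exact: ltW.
    - by move=> x _ _; rewrite normr_id.
    - by move=> x xF; rewrite ltNge xF.
  apply: le_trans (step k) _; apply: le_trans (lerD ih (lexx _)) _.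
  rewrite -addrA lerD2l exprS.
  have q1' : 1 - q != 0 by rewrite subr_eq0 eq_sym lt_eqF.
  by rewrite le_eqVlt; apply/orP; left; apply/eqP; field.
apply/integrableP; split; first exact/measurable_EFinP.
have cupF : \bigcup_k F k = setT.
  apply/seteqP; split=> // x _.
  have [k] : exists k : nat, `|x| <= k%:R.
    by exists (Num.bound `|x|); apply: ltW; exact: archi_boundP.
  move=> xk; exists k => //; rewrite /F /cube /= subr0 (le_trans xk)//.
  rewrite (@le_trans _ _ (2 ^+ k))//; first by rewrite -natrX ler_nat ltnW// ltn_expl.
  by rewrite /c ler_peMl ?exprn_ge0// lerDr.
have := @ge0_nondecreasing_set_cvg_integral _ _ _ F (fun x => `|f x|%:E) (leb n) ndF mF.
rewrite cupF => h.
have {h} cvgI : (\int[leb n]_(x in F i) `|f x|%:E @[i --> \oo] --> \int[leb n]_x `|f x|%:E)%E.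
  apply: h => [i|i x _]; last by rewrite lee_fin.
  by apply/measurable_EFinP; exact: measurable_funS mfn.
apply: (@le_lt_trans _ _ (V + A / (1 - q))%:E); last exact: ltry.
rewrite -(cvg_lim _ cvgI)//; apply: lime_le; first by apply/cvg_ex; eexists; exact: cvgI.
apply: nearW => k.
rewrite -[leLHS]fineK; last by apply: integrable_fin_num => //; exact: (iF _ k).
rewrite lee_fin; apply: le_trans (bnd k) _; rewrite lerD2l.
rewrite -[leRHS]mulr1 ler_wpM2l// ?divr_ge0// ?subr_ge0 ?(ltW q1)//.
by rewrite gerBl exprn_ge0.
Qed.

End decay.
(** * The surface *)

Section cutoff_line.
Context {R : realType}.
Local Notation mu := (@lebesgue_measure R).
Variable r : R.
Hypothesis r0 : 0 < r.

Lemma continuous_cutoff_scaled : continuous (fun t : R => cutoff (t / r)).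
Proof.
have cg : continuous (fun t : R => t / r).
  by apply: continuous_mul_fun; [move=> t; exact: cvg_id|exact: cst_continuous].
move=> t; apply: (continuous_comp (cg t)).
exact: (Dn_continuous (smooth_cutoff 0%N)).
Qed.

Lemma integrable_cutoff : mu.-integrable setT (EFin \o (fun t : R => cutoff (t / r))).
Proof.
rewrite (_ : _ \o _ = (EFin \o (fun t : R => cutoff (t / r))) \_ (`[- (2 * r), 2 * r]%classic)).
  have mI : measurable (`[- (2 * r), 2 * r]%classic : set (measurableTypeR R)) by [].
  have h := @integrable_mkcond _ _ _ mu _ (EFin \o (fun t : R => cutoff (t / r))) mI.
  apply: (iffLR h).
  apply: continuous_compact_integrable; first exact: segment_compact.
  by apply: continuous_subspaceT; exact: continuous_cutoff_scaled.
apply/funext => t; rewrite patchE; case: ifPn => //.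
rewrite notin_setE /= in_itv/= => /negP; rewrite -ler_norml -ltNge => rt.
by rewrite cutoff0// normrM normfV (gtr0_norm r0) ler_pdivlMr// ltW.
Qed.

Lemma cutoff_scaled1 t : `|t| <= r -> cutoff (t / r) = 1.
Proof.
by move=> tr; rewrite cutoff1// normrM normfV (gtr0_norm r0) ler_pdivrMr// mul1r.
Qed.

(** The cutoff is 1 on ]-r, e[, of length r + e, and the tail below -r does not see e: the
    dependence on e is exactly affine. *)
Lemma integral_cutoff_below e : `|e| < r ->
  (\int[mu]_(t in [set t | t < e]) cutoff (t / r) =
   \int[mu]_(t in `]-oo, - r]%classic) cutoff (t / r) + r + e)%R.
Proof.
rewrite ltr_norml => /andP[re er].
have -> : [set t | t < e] = `]-oo, - r]%classic `|` `]- r, e[%classic.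
  apply/seteqP; split=> t /=; rewrite !in_itv/=.
    by move=> te; have [tr|tr] := leP t (- r); [left|right; rewrite te].
  by case=> [tr|/andP[]//]; exact: le_lt_trans re.
rewrite Rintegral_setU//; last 2 first.
- by apply: integrableS integrable_cutoff => //; exact: measurableU.
- apply/disj_setPS => t [/=]; rewrite !in_itv/= => tr /andP[].
  by rewrite ltNge tr.
rewrite -addrA; congr (_ + _).
rewrite (@eq_Rintegral _ _ _ _ _ (cst 1)); last first.
  move=> t; rewrite inE/= in_itv/= => /andP[rt te]; rewrite cutoff_scaled1//.
  by rewrite ler_norml; apply/andP; split; apply: ltW => //; exact: lt_trans er.
by rewrite Rintegral_cst//= lebesgue_measure_itv/= lte_fin re -EFinB /=; ring.
Qed.

Lemma integral_cutoff_above e : `|e| < r ->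
  (\int[mu]_(t in [set t | e < t]) cutoff (t / r) =
   \int[mu]_(t in `[r, +oo[%classic) cutoff (t / r) + r - e)%R.
Proof.
rewrite ltr_norml => /andP[re er].
have -> : [set t | e < t] = `[r, +oo[%classic `|` `]e, r[%classic.
  apply/seteqP; split=> t /=; rewrite !in_itv/= andbT.
    by move=> te; have [tr|tr] := leP r t; [left|right; rewrite te].
  by case=> [tr|/andP[]//]; exact: lt_le_trans tr.
rewrite Rintegral_setU//; last 2 first.
- by apply: integrableS integrable_cutoff => //; exact: measurableU.
- apply/disj_setPS => t [/=]; rewrite !in_itv/= andbT => tr /andP[_].
  by rewrite ltNge tr.
rewrite -addrA; congr (_ + _).
rewrite (@eq_Rintegral _ _ _ _ _ (cst 1)); last first.
  move=> t; rewrite inE/= in_itv/= => /andP[rt te]; rewrite cutoff_scaled1//.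
  by rewrite ler_norml; apply/andP; split; apply: ltW => //; exact: lt_trans rt.
by rewrite Rintegral_cst//= lebesgue_measure_itv/= lte_fin er -EFinB /=; ring.
Qed.

End cutoff_line.

Section regions.
Context {R : realType} (m : nat) (eta : 'rV[R]_m -> R).
Hypothesis ceta : continuous eta.

Lemma continuous_horiz : continuous (@horiz R m).
Proof.
by apply: continuous_rV => i x; under eq_fun do rewrite mxE; exact: coord_continuous.
Qed.

Let gap (x : 'rV[R]_m.+1) := eta (horiz x) - vert x.

Let continuous_gap : continuous gap.
Proof.
apply: continuous_add_fun.
  by move=> x; apply: continuous_comp; [exact: continuous_horiz|exact: ceta].
have cv : continuous (@vert R m) by move=> x; exact: coord_continuous.
by move=> x; exact: (cvgN (cv x)).
Qed.

Lemma open_below : open (below eta).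
Proof.
rewrite (_ : below eta = gap @^-1` [set t | 0 < t]).
  by apply: open_comp; [move=> x _; exact: continuous_gap|exact: open_gt].
by apply/seteqP; split=> x; rewrite /below /gap /= subr_gt0.
Qed.

Lemma open_above : open (above eta).
Proof.
rewrite (_ : above eta = gap @^-1` [set t | t < 0]).
  by apply: open_comp; [move=> x _; exact: continuous_gap|exact: open_lt].
by apply/seteqP; split=> x; rewrite /above /gap /= subr_lt0.
Qed.

Lemma measurable_below : measurable (below eta).
Proof. by apply: open_measurable_rV; exact: open_below. Qed.

Lemma measurable_above : measurable (above eta).
Proof. by apply: open_measurable_rV; exact: open_above. Qed.

End regions.

(** * The gravity term *)

Section volumes.
Context {R : realType} (m : nat) (eta : 'rV[R]_m.+1 -> R) (M r : R).
Local Notation leb n := (@lebesgue_rV R n).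
Local Notation mu := (@lebesgue_measure R).
Hypotheses (ceta : continuous eta) (etaM : forall x, `|eta x| <= M) (Mr : M < r).

Let r0 : 0 < r.
Proof. by apply: le_lt_trans Mr; apply: le_trans (etaM 0). Qed.

Let Q := field_vert (0 : 'rV[R]_m.+1) r.

Let continuous_field_vert n (a : 'rV[R]_n.+1) : continuous (field_vert a r).
Proof. by apply: continuous_tensor; apply: tame_derive_factor; exact: tame_stream_factor. Qed.

Let field_vert0 n (a x : 'rV[R]_n.+1) : 2 * r < `|x - a| -> field_vert a r x = 0.
Proof.
by move=> xr; apply: tensor_outside => //; apply: tame_derive_factor; exact: tame_stream_factor.
Qed.

Lemma integrable_field_vert n (a : 'rV[R]_n.+1) :
  (leb n.+1).-integrable setT (EFin \o field_vert a r).
Proof. exact: (continuous_support_integrable (@continuous_field_vert _ a) (@field_vert0 _ a)). Qed.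

Lemma integrable_eta_field_vert :
  (leb m.+1).-integrable setT (EFin \o (fun x' => eta x' * Q x')).
Proof.
apply: (@continuous_support_integrable _ _ _ 0 (2 * r)).
  by apply: continuous_mul_fun => //; exact: continuous_field_vert.
by move=> x xr; rewrite /Q field_vert0// mulr0.
Qed.

(** The slice over x' contributes Q(x') (K + s eta(x')). The constant K disappears because Q is an
    x_1-derivative and has integral 0. The sign s is 1 below the surface and -1 above. *)
Lemma Rintegral_field_vert_slices (U : set 'rV[R]_m.+2) (E : 'rV[R]_m.+1 -> set (measurableTypeR R))
    (K s : R) : measurable U -> (forall x', measurable (E x')) ->
  (forall x' t, U (join x' t) <-> E x' t) ->
  (forall x', \int[mu]_(t in E x') cutoff (t / r) = K + s * eta x')%R ->
  (\int[leb m.+2]_(x in U) field_vert 0 r x)%R = s * (\int[leb m.+1]_x' (eta x' * Q x'))%R.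
Proof.
move=> mU mE UE intE.
have iU : (leb m.+2).-integrable setT (EFin \o ((field_vert 0 r) \_ U)).
  rewrite -restrict_EFin; apply/(integrable_mkcond (EFin \o field_vert 0 r)) => //.
  exact: integrableS (integrable_field_vert 0).
have slice x' : (\int[mu]_t (((field_vert 0 r) \_ U) (join x' t))%:E =
    (Q x' * (K + s * eta x'))%:E)%E.
  rewrite -intE.
  have icut : mu.-integrable (E x') (EFin \o (fun t => cutoff (t / r))).
    by apply: integrableS (integrable_cutoff r0) => //; exact: mE.
  rewrite -RintegralZl// /Rintegral fineK; last first.
    by have := integrable_fin_num (mE x') (integrableZl (mE x') (Q x') icut).
  rewrite [RHS]integral_mkcond; apply: eq_integral => t _.
  rewrite !patchE; have [Et|nEt] := pselect (E x' t).
    rewrite !mem_set//; last exact/UE.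
    rewrite field_vert_join /vert mxE subr0.
    by rewrite (_ : horiz 0 = 0)//; apply/rowP => i; rewrite !mxE.
  by rewrite !memNset// => /UE.
rewrite Rintegral_mkcond /Rintegral integral_join_vert//=.
rewrite (eq_integral (fun x' => (Q x' * (K + s * eta x'))%:E)); last first.
  by move=> x' _; exact: slice.
rewrite -/(Rintegral (leb m.+1) setT (fun x' => Q x' * (K + s * eta x'))).
have -> : (fun x' => Q x' * (K + s * eta x')) = (fun x' => K * Q x' + s * (eta x' * Q x')).
  by apply/funext => x'; ring.
have iQ := integrable_field_vert (0 : 'rV[R]_m.+1).
have iE := integrable_eta_field_vert.
rewrite RintegralD//; last 2 first.
- exact: integrableZl iQ.
- exact: integrableZl iE.
rewrite !RintegralZl// [X in K * X](_ : _ = 0) ?mulr0 ?add0r//.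
by rewrite /Rintegral integral_field_vert.
Qed.

Lemma Rintegral_field_vert_below :
  (\int[leb m.+2]_(x in below eta) field_vert 0 r x)%R =
  (\int[leb m.+1]_x' (eta x' * Q x'))%R.
Proof.
pose K := (\int[mu]_(t in `]-oo, - r]%classic) cutoff (t / r))%R + r.
rewrite (@Rintegral_field_vert_slices _ (fun x' => [set t | t < eta x']) K 1) ?mul1r//.
- exact: measurable_below.
- by move=> x'; rewrite -[X in measurable X]/(`]-oo, eta x'[%classic).
- by move=> x' t; rewrite /below /= horiz_join vert_join.
- move=> x'; rewrite mul1r integral_cutoff_below//; exact: le_lt_trans Mr.
Qed.

Lemma Rintegral_field_vert_above :
  (\int[leb m.+2]_(x in above eta) field_vert 0 r x)%R =
  - (\int[leb m.+1]_x' (eta x' * Q x'))%R.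
Proof.
pose K := (\int[mu]_(t in `[r, +oo[%classic) cutoff (t / r))%R + r.
rewrite (@Rintegral_field_vert_slices _ (fun x' => [set t | eta x' < t]) K (-1)) ?mulN1r//.
- exact: measurable_above.
- move=> x'; rewrite (_ : [set t | _] = `]eta x', +oo[%classic)//.
  by apply/seteqP; split=> t /=; rewrite in_itv/= andbT.
- by move=> x' t; rewrite /above /= horiz_join vert_join.
- move=> x'; rewrite mulN1r integral_cutoff_above//; exact: le_lt_trans Mr.
Qed.

End volumes.
Section chain_rule.
Context {R : realType} (V : normedModType R).

(** On the line through x with direction v, f becomes a function of one variable, and the chain rule
    of the real line applies. *)
Lemma is_derive_real_comp (phi : R -> R) (f : V -> R) (x v : V) (a b : R) :
  is_derive (f x) (1 : R) phi a -> is_derive x v f b ->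
  is_derive x v (fun y => phi (f y)) (a * b).
Proof.
move=> dphi [df dfE].
pose l (h : R) := h *: v + x : V.
have aff (h : R) : l (h *: 1 + 0) = h *: v + l 0.
  by rewrite /l scale0r add0r addr0 [_ *: 1]mulr1.
have l0 : l 0 = x by rewrite /l scale0r add0r.
have dfl : is_derive 0 (1 : R) (f \o l) b.
  apply: DeriveDef; first by apply: (derivable_comp_affine f aff).2; rewrite l0.
  by rewrite (derive_comp_affine f aff) l0.
have := @is_derive1_comp _ phi (f \o l) 0 a b; rewrite /= l0 => /(_ dphi dfl) [dc dcE].
apply: DeriveDef.
  have := (derivable_comp_affine (fun y => phi (f y)) aff).1 dc.
  by rewrite l0.
by have := derive_comp_affine (fun y => phi (f y)) aff; rewrite l0 => <-; rewrite -dcE.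
Qed.

End chain_rule.

Section normal.
Context {R : realType} (m : nat) (eta : 'rV[R]_m -> R).
Hypothesis Ceta : class_C 2 eta.

Let p (i : 'I_m) := pderiv i eta.

Let Cp i : class_C 1 (p i).
Proof. exact: class_C_pderiv. Qed.

Let cp i : continuous (p i).
Proof. exact: class_C_continuous (Cp i). Qed.

Let cpp i j : continuous (pderiv j (p i)).
Proof. exact: class_C_continuous (class_C_pderiv j (Cp i)). Qed.

Let dp i j x : is_derive x (delta_mx 0 j) (p i) (pderiv j (p i) x).
Proof. by apply: derivableP; exact: class_C_derivable (Cp i). Qed.

Let A (x : 'rV[R]_m) : R := 1 + \sum_k p k x * p k x.

Let A_ge1 x : 1 <= A x.
Proof. by rewrite lerDl; apply: sumr_ge0 => k _; rewrite -expr2 sqr_ge0. Qed.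

Let A_gt0 x : 0 < A x. Proof. exact: lt_le_trans (A_ge1 x). Qed.

Let areaE x : area eta x = Num.sqrt (A x).
Proof. by rewrite /area /dot; under eq_bigr do rewrite !mxE. Qed.

Lemma area_ge1 x : 1 <= area eta x.
Proof. by rewrite areaE -[leLHS]sqrtr1; exact: ler_wsqrtr. Qed.

Lemma area_gt0 x : 0 < area eta x.
Proof. exact: lt_le_trans (area_ge1 x). Qed.

Let N (i : 'I_m) (x : 'rV[R]_m) : R := normal eta x 0 (lift ord_max i).

Let NE i x : N i x = (Num.sqrt (A x))^-1 * (- p i x).
Proof. by rewrite /N !mxE liftK -areaE !mxE. Qed.

(** Dividing by the area factor, which is at least 1, passes the decay of grad eta on to the
    horizontal part of the normal. *)
Lemma normal_horiz_le i x : `|normal eta x 0 (lift ord_max i)| <= `|pderiv i eta x|.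
Proof.
rewrite -[normal _ _ _ _]/(N i x) NE normrM normrN ler_piMl// ger0_norm ?invr_ge0 ?sqrtr_ge0//.
by rewrite invf_le1 -?areaE ?area_gt0// area_ge1.
Qed.

Lemma normal_vert x : normal eta x 0 ord_max = (area eta x)^-1.
Proof. by rewrite !mxE unlift_none mulr1. Qed.

Let dA j x : is_derive x (delta_mx 0 j) A (\sum_k (2 * p k x * pderiv j (p k) x)).
Proof.
have -> : A = cst 1 + \sum_(k < m) (fun y => p k y * p k y).
  by apply/funext => y; rewrite /A !fctE fct_sumE.
rewrite -[X in is_derive _ _ _ X]add0r; apply: is_deriveD.
apply: is_derive_sum => k; apply: is_derive_eq; first exact: is_deriveM.
by rewrite /GRing.scale/=; ring.
Qed.

Let dN_fun i j x : R :=
  (Num.sqrt (A x))^-1 * - pderiv j (p i) x +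
  (- p i x) * (- ((Num.sqrt (A x))^-1 * (Num.sqrt (A x))^-1) *
    ((2 * Num.sqrt (A x))^-1 * (\sum_k (2 * p k x * pderiv j (p k) x)))).

Let dN i j x : is_derive x (delta_mx 0 j) (N i) (dN_fun i j x).
Proof.
have -> : N i = (fun y => (Num.sqrt (A y))^-1 * (- p i y)).
  by apply/funext => y; exact: NE.
have s0 : Num.sqrt (A x) != 0 by rewrite gt_eqF// sqrtr_gt0.
have dS : is_derive x (delta_mx 0 j) (fun y => Num.sqrt (A y))
    ((2 * Num.sqrt (A x))^-1 * (\sum_k (2 * p k x * pderiv j (p k) x))).
  by apply: (is_derive_real_comp (phi := Num.sqrt) (f := A)) => //; exact: is_derive1_sqrt.
have dV : is_derive x (delta_mx 0 j) (fun y => (Num.sqrt (A y))^-1)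
    (- ((Num.sqrt (A x))^-1 * (Num.sqrt (A x))^-1) *
    ((2 * Num.sqrt (A x))^-1 * (\sum_k (2 * p k x * pderiv j (p k) x)))).
  apply: (is_derive_real_comp (phi := GRing.inv)) => //; apply: DeriveDef.
    exact: (@derivableV _ _ id).
  rewrite (@deriveV _ _ id)// derive_id /GRing.scale/= mulr1 -exprVn expr2.
  by ring.
have dM : is_derive x (delta_mx 0 j) (fun y => - p i y) (- pderiv j (p i) x).
  exact: is_deriveN.
exact: is_deriveM dV dM.
Qed.

Lemma derivable_normal i j x :
  derivable (fun y => normal eta y 0 (lift ord_max i)) x (delta_mx 0 j).
Proof. by have [] := dN i j x. Qed.

Let continuous_A : continuous A.
Proof.
apply: continuous_add_fun; first exact: cst_continuous.
by apply: continuous_sum_fun => k; exact: continuous_mul_fun.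
Qed.

Let continuous_isqrt : continuous (fun x => (Num.sqrt (A x))^-1).
Proof.
apply: continuous_inv_fun => x; first by rewrite gt_eqF// sqrtr_gt0.
by apply: (@continuous_comp _ _ _ A Num.sqrt x); [exact: continuous_A|exact: sqrt_continuous].
Qed.

Lemma continuous_normal i : continuous (fun y => normal eta y 0 (lift ord_max i)).
Proof.
rewrite (_ : (fun y => _) = (fun y => (Num.sqrt (A y))^-1 * (- 1 * p i y))); last first.
  by apply/funext => y; rewrite mulN1r -NE.
apply: continuous_mul_fun; first exact: continuous_isqrt.
by apply: continuous_scale_fun; exact: cp.
Qed.

(** Second derivatives of eta enter here only; the continuity of div N justifies the integration by
    parts in [tension_field]. *)
Lemma continuous_pderiv_normal i j :
  continuous (pderiv j (fun y => normal eta y 0 (lift ord_max i))).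
Proof.
rewrite (_ : pderiv _ _ = (fun x => (Num.sqrt (A x))^-1 * (-1 * pderiv j (p i) x) +
  p i x * (((Num.sqrt (A x))^-1 * (Num.sqrt (A x))^-1) *
    (2^-1 * (Num.sqrt (A x))^-1 * (\sum_k (2 * p k x * pderiv j (p k) x)))))); last first.
  apply/funext => x; have [_ E] := dN i j x.
  by rewrite -[LHS]/('D_(delta_mx 0 j) (N i) x) E /dN_fun invfM; ring.
have ci := continuous_isqrt.
apply: continuous_add_fun; apply: continuous_mul_fun => //.
  by apply: continuous_scale_fun; exact: cpp.
apply: continuous_mul_fun; first exact: continuous_mul_fun.
apply: continuous_mul_fun; first exact: continuous_scale_fun.
apply: continuous_sum_fun => k; apply: continuous_mul_fun; last exact: cpp.
by apply: continuous_scale_fun; exact: cp.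
Qed.

End normal.

Lemma cvg_sum0 {R : realType} (I : finType) (F : I -> nat -> R) :
  (forall i, F i @ \oo --> (0 : R)) -> (fun k => \sum_i F i k) @ \oo --> (0 : R).
Proof.
move=> F0; elim: (index_enum I) => [|i s ih].
  by under eq_fun do rewrite big_nil; exact: cvg_cst.
have h := cvgD (F0 i) ih; rewrite addr0 in h.
rewrite (_ : (fun k => \sum_(j <- i :: s) F j k) = F i \+ (fun k => \sum_(j <- s) F j k)).
  exact: h.
by apply/funext => k; rewrite big_cons.
Qed.

(** * Surface tension, and convergence of the truncated mass *)

Section tension.
Context {R : realType} (m : nat) (eta : 'rV[R]_m.+1 -> R) (M : R).
Local Notation leb n := (@lebesgue_rV R n).
Hypotheses (Ceta : class_C 2 eta) (etaM : forall x, `|eta x| <= M).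

Let Q r := field_vert (0 : 'rV[R]_m.+1) r.

Let tQ : tame_family (derive_factor ord0 (@stream_factor R m)).
Proof. by apply: tame_derive_factor; exact: tame_stream_factor. Qed.

Let CQ r k : class_C k (Q r). Proof. exact: class_C_tensor. Qed.

Let Q0 r x : 0 < r -> 2 * r < `|x| -> Q r x = 0.
Proof. by move=> r0 xr; apply: tensor_outside => //; rewrite subr0. Qed.

(** All heights on the surface are less than r, so the vertical cutoff is 1 and the horizontal
    component vanishes, wherever x' is. *)
Lemma field_surface r x' : M < r -> field (0 : 'rV[R]_m.+2) r (join x' (eta x')) =
  \row_j (if j == ord_max then Q r x' else 0).
Proof.
move=> Mr; have r0 : 0 < r by apply: le_lt_trans Mr; apply: le_trans (etaM 0).
have er : `|eta x'| < r by exact: le_lt_trans Mr.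
apply/rowP => j; rewrite !mxE; case: ifP => _.
  rewrite field_vert_join /vert mxE subr0 cutoff_scaled1 ?(ltW er)// mulr1.
  by rewrite (_ : horiz 0 = 0)//; apply/rowP => i; rewrite !mxE.
by case: ifP => // _; rewrite field_horiz0 ?oppr0// mxE unlift_none mxE subr0.
Qed.

Let N i x := normal eta x 0 (lift ord_max i).

(** On S the field is Q e_n and N.e_n dS = dx', which leaves the integral of sigma (div N) Q.
    Integrating by parts trades the curvature, for which no decay is given, for the horizontal part
    of N. *)
Lemma tension_field sigma r : M < r -> tension sigma eta (field 0 r) =
  - (sigma * \sum_i (\int[leb m.+1]_x' (N i x' * pderiv i (Q r) x'))%R).
Proof.
move=> Mr; have r0 : 0 < r by apply: le_lt_trans Mr; apply: le_trans (etaM 0).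
have cN i : continuous (N i) by exact: continuous_normal.
have cdN i : continuous (pderiv i (N i)) by exact: continuous_pderiv_normal.
have cQ : continuous (Q r) by exact: class_C_continuous (@CQ r 0%N).
have cdQ i : continuous (pderiv i (Q r)).
  exact: class_C_continuous (class_C_pderiv i (@CQ r 1%N)).
have Q0' x : 2 * r < `|x - 0| -> Q r x = 0 by rewrite subr0; exact: Q0.
have i1 i : (leb m.+1).-integrable setT (EFin \o (fun x => pderiv i (N i) x * Q r x)).
  apply: (@continuous_support_integrable _ _ _ 0 (2 * r)).
    exact: continuous_mul_fun.
  by move=> x xr; rewrite Q0' ?mulr0.
have i2 i : (leb m.+1).-integrable setT (EFin \o (fun x => N i x * pderiv i (Q r) x)).
  apply: (@continuous_support_integrable _ _ _ 0 (2 * r)).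
    exact: continuous_mul_fun.
  by move=> x xr; rewrite (pderiv_outside i Q0')// mulr0.
have byparts i : (\int[leb m.+1]_x (pderiv i (N i) x * Q r x))%R =
    - (\int[leb m.+1]_x (N i x * pderiv i (Q r) x))%R.
  apply/eqP; rewrite -addr_eq0 -RintegralD//; apply/eqP.
  have E x : pderiv i (N i) x * Q r x + N i x * pderiv i (Q r) x =
      pderiv i (fun y => N i y * Q r y) x.
    have dN := @derivable_normal _ _ _ Ceta i i x.
    have dQ : derivable (Q r) x (delta_mx 0 i) by exact: class_C_derivable (@CQ r 1%N).
    by rewrite {3}/pderiv (deriveM dN dQ) /GRing.scale/= addrC mulrC [in X in _ + X]mulrC addrC.
  under eq_Rintegral do rewrite E.
  rewrite /Rintegral (integral_pderiv (r := 2 * r))//.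
  - move=> x; apply: derivableM; first exact: derivable_normal.
    exact: class_C_derivable (@CQ r 1%N).
  - rewrite (_ : pderiv _ _ = (fun x => pderiv i (N i) x * Q r x + N i x * pderiv i (Q r) x)).
      by apply: continuous_add_fun; exact: continuous_mul_fun.
    by apply/funext => x; rewrite E.
  - by move=> x xr; rewrite Q0 ?mulr0.
rewrite /tension /surface_integral.
transitivity (\int[leb m.+1]_x' (sigma * \sum_i (pderiv i (N i) x' * Q r x')))%R.
  apply: eq_Rintegral => x' _; rewrite field_surface// /div_normal.
  have -> : dot (normal eta x') (\row_j (if j == ord_max then Q r x' else 0)) =
      (area eta x')^-1 * Q r x'.
    rewrite /dot (bigD1 ord_max)//= big1 => [|j /negbTE jm]; last by rewrite !mxE jm mulr0.
    by rewrite addr0 normal_vert mxE eqxx.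
  (* The surface element cancels the 1/area of the vertical component of the normal. *)
  have a0 := area_gt0 eta x'.
  rewrite -mulr_suml -!mulrA; congr (_ * (_ * _)).
  by rewrite mulrC mulfK// gt_eqF.
rewrite RintegralZl//; last first.
  rewrite (_ : _ \o _ = (fun x => \sum_i (pderiv i (N i) x * Q r x)%:E)%E).
    by apply: integrable_sum => // i _; exact: i1.
  by apply/funext => x /=; rewrite sumEFin.
rewrite -mulrN; congr (_ * _); rewrite -sumrN.
under [RHS]eq_bigr do rewrite -byparts.
elim: (index_enum _) => [|i s ih].
  rewrite big_nil; under eq_Rintegral do rewrite big_nil.
  by rewrite Rintegral_cst// mul0r.
rewrite big_cons; under eq_Rintegral do rewrite big_cons.
rewrite RintegralD ?ih//.
rewrite (_ : _ \o _ = (fun x => \sum_(i <- s) (pderiv i (N i) x * Q r x)%:E)%E).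
  by apply: integrable_sum => // j _; exact: i1.
by apply/funext => x /=; rewrite sumEFin.
Qed.

(** grad Q is supported between the cubes of radii N and 2 N, where the horizontal part of the
    normal is O(N^(-b)) with b greater than the dimension. *)
Lemma tension_cvg0 sigma b : (m.+1)%:R < b ->
  (forall i, decays setT b (pderiv i eta)) ->
  tension sigma eta (field 0 N%:R) @[N --> \oo] --> (0 : R).
Proof.
move=> mb dec; have b0 : 0 <= b by apply: ltW; apply: le_lt_trans mb.
suff h i : (\int[leb m.+1]_x' (normal eta x' 0 (lift ord_max i) *
    pderiv i (Q k%:R) x'))%R @[k --> \oo] --> (0 : R).
  apply: (@cvg_trans _ ((fun k : nat => - (sigma * \sum_i
      (\int[leb m.+1]_x' (N i x' * pderiv i (Q k%:R) x'))%R)) @ \oo)).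
    apply: near_eq_cvg; near=> k; rewrite tension_field//.
    by near: k; exact: nbhs_infty_gtr.
  suff hs : (fun k : nat => \sum_i (\int[leb m.+1]_x' (N i x' * pderiv i (Q k%:R) x'))%R) @ \oo
      --> (0 : R).
    have := cvgN (cvgM (cvg_cst sigma) hs); rewrite mulr0 oppr0; exact.
  by apply: cvg_sum0 => i; exact: h.
have [B B0 hB] := tensor_bounded (tame_derive_factor i tQ).
have [C C0 hC] := decays_nat b0 (dec i).
apply: (@Rintegral_far _ _ setT b _ (C * B)) => //.
- move=> k; apply: continuous_measurable_rV; apply: continuous_mul_fun.
    exact: continuous_normal.
  exact: class_C_continuous (class_C_pderiv i (@CQ k%:R 1%N)).
- near=> k.
  have hCk (x : 'rV[R]_m.+1) : setT x -> k%:R <= `|x| ->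
    `|pderiv i eta x| <= C * k%:R `^ (- b) by move: x; near: k.
  move=> x _.
  have k1 : 1 <= k%:R :> R by rewrite ler1n; near: k; exact: nbhs_infty_gt.
  have k0 : 0 < k%:R :> R by exact: lt_le_trans k1.
  have [xk|kx] := ltP `|x| k%:R.
    by rewrite pderiv_field_vert_inside ?subr0// mulr0 normr0 !mulr_ge0// powR_ge0.
  rewrite normrM mulrAC; apply: ler_pM => //.
    apply: le_trans (normal_horiz_le eta i x) _.
    exact: hCk.
  rewrite /Q /field_vert pderiv_tensor// normrM normfV (gtr0_norm k0).
  by apply: le_trans (hB 0 k%:R x); rewrite ler_piMl// invf_le1.
- move=> k x _ kx; rewrite (@pderiv_outside _ _ i _ 0 (2 * k.+1%:R)) ?mulr0 ?subr0//.
  by move=> y; rewrite subr0; exact: Q0.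
Unshelve. all: by end_near. Qed.

(** Dominated convergence: although Q has integral 0 at each scale, it is uniformly bounded and
    equals 1 inside the cube of radius N. *)
Lemma Rintegral_eta_field_cvg : (leb m.+1).-integrable setT (EFin \o eta) ->
  (\int[leb m.+1]_x' (eta x' * Q N%:R x'))%R @[N --> \oo] -->
  (\int[leb m.+1]_x' eta x')%R.
Proof.
move=> ieta; have [B B0 hB] := tensor_bounded tQ.
have ceta : continuous eta by exact: class_C_continuous Ceta.
apply: fine_cvg; rewrite fineK; last exact: integrable_fin_num.
have [] := @dominated_convergence _ _ _ (leb m.+1) setT measurableT
  (fun N x => (eta x * Q N%:R x)%:E) (EFin \o eta) (fun x => (B * `|eta x|)%:E).
- move=> k; apply/measurable_EFinP; apply: continuous_measurable_rV.
  by apply: continuous_mul_fun => //; exact: class_C_continuous (@CQ k%:R 0%N).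
- by apply/measurable_EFinP; exact: continuous_measurable_rV.
- apply: aeW => x _; apply: cvg_near_cst; near=> k.
  have kx : `|x| < k%:R by near: k; exact: nbhs_infty_gtr.
  rewrite /Q field_vert_inside ?mulr1 ?subr0//.
  exact: le_lt_trans kx.
- exact: (integrableZl measurableT B (integrable_norm ieta)).
- by apply: aeW => x k _ /=; rewrite lee_fin normrM mulrC ler_wpM2r// hB.
- by move=> _ _.
Unshelve. all: by end_near. Qed.

End tension.
(** * The momentum flux *)

Section local_integrability.
Context {R : realType} (n : nat) (U Xi : set 'rV[R]_n).
Local Notation leb := (@lebesgue_rV R n).
Hypothesis mU : measurable U.

Lemma loc_integrableW (f : 'rV[R]_n -> R) : loc_integrable U set0 f -> loc_integrable U Xi f.
Proof. by move=> h K cK _; apply: h => //; rewrite setC0. Qed.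

Lemma loc_integrableD (f g : 'rV[R]_n -> R) : loc_integrable U Xi f ->
  loc_integrable U Xi g -> loc_integrable U Xi (fun x => f x + g x).
Proof.
move=> lf lg K cK KXi; have mK : measurable K.
  by apply: closed_measurable_rV; exact: compact_closed (@norm_hausdorff _ _) cK.
exact: (integrableD (measurableI _ _ mU mK) (lf K cK KXi) (lg K cK KXi)).
Qed.

Lemma loc_integrableZ (f : 'rV[R]_n -> R) (a : R) : loc_integrable U Xi f ->
  loc_integrable U Xi (fun x => a * f x).
Proof.
move=> lf K cK KXi; have mK : measurable K.
  by apply: closed_measurable_rV; exact: compact_closed (@norm_hausdorff _ _) cK.
exact: (integrableZl (measurableI _ _ mU mK) a (lf K cK KXi)).
Qed.

(** |f g| <= f^2 + g^2; the hypotheses on f and g themselves provide measurability. *)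
Lemma loc_integrable_prod (f g : 'rV[R]_n -> R) : loc_integrable U set0 f ->
  loc_integrable U set0 g -> loc_integrable U Xi (fun x => f x ^+ 2) ->
  loc_integrable U Xi (fun x => g x ^+ 2) -> loc_integrable U Xi (fun x => f x * g x).
Proof.
move=> lf lg lf2 lg2 K cK KXi; have mK : measurable K.
  by apply: closed_measurable_rV; exact: compact_closed (@norm_hausdorff _ _) cK.
have mUK := measurableI _ _ mU mK.
have K0 : K `<=` ~` set0 by rewrite setC0.
have h := integrableD mUK (lf2 K cK KXi) (lg2 K cK KXi).
apply: (le_integrable mUK _ _ h).
- apply/measurable_EFinP; apply: measurable_funM; apply/measurable_EFinP.
    exact: measurable_int (lf K cK K0).
  exact: measurable_int (lg K cK K0).
- move=> x _ /=; rewrite lee_fin [leRHS]ger0_norm ?addr_ge0 ?sqr_ge0//.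
  rewrite normrM -[f x ^+ 2]real_normK ?num_real// -[g x ^+ 2]real_normK ?num_real//.
  have := sqr_ge0 (`|f x| - `|g x|); rewrite sqrrB.
  have := sqr_ge0 `|f x|; have := sqr_ge0 `|g x|; lra.
Qed.

Lemma loc_integrable_measurable (f : 'rV[R]_n -> R) : loc_integrable U set0 f ->
  measurable_fun U f.
Proof.
move=> lf; have -> : U = \bigcup_k (U `&` cube 0 k%:R).
  apply/seteqP; split=> [x Ux|x [k _ []]//]; exists (Num.bound `|x|) => //; split=> //.
  by rewrite /cube /= subr0 ltW// archi_boundP.
apply/measurable_fun_bigcup => k.
  by apply: measurableI => //; exact: measurable_cube.
apply/measurable_EFinP; apply: measurable_int.
by apply: lf; [exact: cube_compact|rewrite setC0].
Qed.

Lemma loc_integrable_test (f phi : 'rV[R]_n -> R) (K : set 'rV[R]_n) :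
  loc_integrable U Xi f -> compact K -> K `<=` ~` Xi -> continuous phi ->
  (forall x, ~ K x -> phi x = 0) -> leb.-integrable U (EFin \o (fun x => f x * phi x)).
Proof.
move=> lf cK KXi cphi phi0; have mK : measurable K.
  by apply: closed_measurable_rV; exact: compact_closed (@norm_hausdorff _ _) cK.
have mUK := measurableI _ _ mU mK.
have iK : leb.-integrable (U `&` K) (EFin \o (fun x => f x * phi x)).
  have := integrableMl mUK (lf K cK KXi) (h := phi); apply.
    by apply: measurable_funTS; exact: continuous_measurable_rV.
  have cphiK : compact (phi @` K) by apply: continuous_compact => //; exact: continuous_subspaceT.
  have [M [Mr hM]] := compact_bounded cphiK.
  exists M; split=> // M' MM' x [_ Kx] /=; apply: hM => //; by exists x.
apply/(integrable_mkcond _ mU).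
have := (integrable_mkcond _ mUK).1 iK.
congr (_.-integrable _ _); apply/funext => x; rewrite !patchE in_setI.
case: (boolP (x \in U)) => //= xU; case: (boolP (x \in K)) => // xK.
by rewrite /= phi0 ?mulr0//; move: xK; rewrite notin_setE.
Qed.

End local_integrability.

Section contraction.
Context {R : realType} (n : nat).
Local Notation space := 'rV[R]_n.
Local Notation leb := (@lebesgue_rV R n).

(** The double contraction w : grad psi. With w left free, it serves for the stress, for [W] and for
    the products of vortex velocities. *)
Definition contract (w : 'I_n -> 'I_n -> space -> R) (psi : space -> space) (x : space) : R :=
  \sum_i \sum_j w i j x * pderiv j (fun y => psi y 0 i) x.

Lemma integrable_sumr (U : set space) (I : finType) (f : I -> space -> R) : measurable U ->
  (forall i, leb.-integrable U (EFin \o f i)) ->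
  leb.-integrable U (EFin \o (fun x => \sum_i f i x)).
Proof.
move=> mU fi; rewrite (_ : _ \o _ = (fun x => \sum_i (f i x)%:E)%E).
  by apply: integrable_sum => // i _; exact: fi.
by apply/funext => x /=; rewrite sumEFin.
Qed.

Lemma integrable_contract (U Xi K : set space) w (psi : space -> space) : measurable U ->
  (forall i j, loc_integrable U Xi (w i j)) -> compact K -> K `<=` ~` Xi ->
  (forall i j, continuous (pderiv j (fun y => psi y 0 i))) ->
  (forall i j x, ~ K x -> pderiv j (fun y => psi y 0 i) x = 0) ->
  leb.-integrable U (EFin \o contract w psi).
Proof.
move=> mU lw cK KXi cpsi psi0.
rewrite /contract; apply: integrable_sumr => // i; apply: integrable_sumr => // j.
apply: (loc_integrable_test mU (lw i j) cK KXi (cpsi i j)) => x Kx; exact: psi0.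
Qed.

End contraction.

Section momentum.
Context {R : realType} (m : nat).
Local Notation space := 'rV[R]_m.+1.
Local Notation leb := (@lebesgue_rV R m.+1).
Variables (g : R) (c : space) (Xi U : set space) (u : space -> space) (P : space -> R).
Hypothesis mU : measurable U.

(** The momentum flux (u - c) (x) u: i is the component transported, j the direction of
    transport. *)
Definition stress (i j : 'I_m.+1) (x : space) : R := (u x 0 j - c 0 j) * u x 0 i.

Lemma momentum_solenoidal rho (psi : space -> space) :
  leb.-integrable U (EFin \o contract stress psi) ->
  leb.-integrable U (EFin \o (fun x => vert (psi x))) ->
  (forall x, \sum_i pderiv i (fun y => psi y 0 i) x = 0) ->
  momentum g c U u P rho psi =
  rho * (\int[leb]_(x in U) contract stress psi x)%R -
  rho * g * (\int[leb]_(x in U) vert (psi x))%R.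
Proof.
move=> iA iV div0; rewrite /momentum -RintegralZl// -RintegralZl// -RintegralB//.
- by apply: eq_Rintegral => x _; rewrite div0 mulr0 addr0.
- exact: (integrableZl mU rho iA).
- exact: (integrableZl mU (rho * g) iV).
Qed.

Hypothesis adm : admissible Xi U u P.

Lemma loc_integrable_velocity i : loc_integrable U Xi (fun x => u x 0 i).
Proof. by case: adm => lu _ _; exact: loc_integrableW. Qed.

Lemma loc_integrable_stress i j : loc_integrable U Xi (stress i j).
Proof.
have [lu lu2 _] := adm.
rewrite (_ : stress i j = fun x => u x 0 j * u x 0 i + (- c 0 j) * u x 0 i); last first.
  by apply/funext => x; rewrite /stress mulrBl mulNr.
apply: loc_integrableD => //; first exact: loc_integrable_prod.
by apply: loc_integrableZ => //; exact: loc_integrable_velocity.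
Qed.

Lemma measurable_velocity i : measurable_fun U (fun x => u x 0 i).
Proof. by case: adm => lu _ _; exact: loc_integrable_measurable. Qed.

End momentum.

(** * Integrability and limit of the flux through the large field *)

Section far_field.
Context {R : realType} (m : nat).
Local Notation space := 'rV[R]_m.+2.
Local Notation leb := (@lebesgue_rV R m.+2).
Variables (c : space) (U : set space) (u : space -> space).
Hypothesis mU : measurable U.

Lemma continuous_pderiv_field (a : space) r i j :
  continuous (pderiv j (fun y => field a r y 0 i)).
Proof. exact: class_C_continuous (class_C_pderiv j (@class_C_field _ _ a r i 1)). Qed.

Lemma integrable_vert_field (a : space) r : 0 < r ->
  leb.-integrable U (EFin \o (fun x => vert (field a r x))).
Proof.
move=> r0; apply: (@integrableS _ _ _ _ setT) => //.
apply: (@continuous_support_integrable _ _ _ a (2 * r)).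
  exact: class_C_continuous (@class_C_field _ _ a r ord_max 0).
by move=> x xr; rewrite /vert field_outside// mxE.
Qed.

Lemma test_fun_field (V : set space) (a : space) r : 0 < r -> cube a (2 * r) `<=` V ->
  test_field V (field a r).
Proof.
move=> r0 KV i; apply: (@test_fun_compact _ _ _ (cube a (2 * r))) => //.
- by move=> k; exact: class_C_field.
- exact: cube_compact.
- exact: cube_closed.
- move=> x; apply: contraNP => /negP; rewrite -ltNge => xr.
  by rewrite field_outside// mxE.
Qed.

(** The gradient of the field lives in the shell between radii r and 2 r. It suffices that no vortex
    lies there: the stress may fail to be integrable near a vortex at the centre. *)
Lemma integrable_contract_field Xi (w : 'I_m.+2 -> 'I_m.+2 -> space -> R) (a : space) r :
  (forall i j, loc_integrable U Xi (w i j)) -> 0 < r ->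
  (forall x, Xi x -> `|x - a| < r \/ 2 * r < `|x - a|) ->
  leb.-integrable U (EFin \o contract w (field a r)).
Proof.
move=> lw r0 Xir.
pose K := cube a (2 * r) `&` [set x | r <= `|x - a|].
have KXi : K `<=` ~` Xi.
  by move=> x [/= xr rx] /Xir[]; rewrite ltNge ?xr ?rx.
have cK : compact K.
  apply: subclosed_compact (@cube_compact _ _ a (2 * r)) _; last by move=> x [].
  apply: closedI; first exact: cube_closed.
  rewrite (_ : [set x | _] = ~` [set x | `|x - a| < r]); last first.
    by apply/seteqP; split=> x /=; rewrite leNgt => /negP.
  apply: open_closedC; rewrite openE => x /= xr; exact: near_inside.
apply: (integrable_contract mU lw cK KXi).
  by move=> i j; exact: continuous_pderiv_field.
move=> i j x Kx; have [xr|rx] := ltP `|x - a| r; first exact: pderiv_field_inside.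
have [xr|xr] := leP `|x - a| (2 * r); last exact: pderiv_field_outside.
by exfalso; apply: Kx.
Qed.

(** In the shell the stress is O(N^(-a)) with a = n-1+eps and the gradient O(1/N); a + 1 exceeds n
    by eps. *)
Lemma contract_far eps : 0 < eps -> (forall i, measurable_fun U (fun x => u x 0 i)) ->
  decays U (m.+1%:R + eps) (fun x => enorm (u x)) ->
  (\int[leb]_(x in U) contract (stress c u) (field 0 N%:R) x)%R @[N --> \oo] --> (0 : R).
Proof.
move=> eps0 mu dec; pose a : R := m.+1%:R + eps.
have a0 : 0 <= a by rewrite addr_ge0// ltW.
have [C C0 hC] := decays_nat a0 dec.
have [B B0 hB] := @field_bounded R m.
(* The number of index pairs (i, j) in the contraction. *)
pose n2 : R := m.+2%:R * m.+2%:R.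
have n20 : 0 <= n2 by exact: mulr_ge0 (ler0n _ _) (ler0n _ _).
apply: (@Rintegral_far _ _ U (a + 1) _ (n2 * ((C + `|c|) * C * B))) => //.
- move=> N; rewrite /contract; apply: measurable_sum => i; apply: measurable_sum => j.
  apply: measurable_funM; last first.
    by apply: measurable_funTS; apply: continuous_measurable_rV; exact: continuous_pderiv_field.
  by apply: measurable_funM => //; apply: measurable_funB => //; exact: measurable_cst.
- by rewrite /a addrAC natr1 ltrDl.
- near=> N.
  have N1 : 1 <= N%:R :> R by rewrite ler1n; near: N; exact: nbhs_infty_gt.
  have N0 : 0 < N%:R :> R by exact: lt_le_trans N1.
  have hN (x : space) : U x -> N%:R <= `|x| -> `|enorm (u x)| <= C * N%:R `^ (- a).
    by move: x; near: N.
  have Na1 : N%:R `^ (- a) <= 1.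
    by rewrite -[leRHS](powRr0 N%:R) ler_powR// oppr_le0.
  have [_ hB'] := hB 0 N%:R 0 N0; move=> x Ux.
  have [xN|Nx] := ltP `|x| N%:R.
    rewrite /contract big1 => [|i _].
      rewrite normr0; apply: mulr_ge0; last exact: powR_ge0.
      by apply: mulr_ge0 => //; rewrite !mulr_ge0// addr_ge0.
    by rewrite big1// => j _; rewrite pderiv_field_inside ?subr0// mulr0.
  have ux i : `|u x 0 i| <= C * N%:R `^ (- a).
    by apply: le_trans (coord_le_enorm _ _) _; apply: le_trans (ler_norm _) (hN x Ux Nx).
  have pE : N%:R `^ (- (a + 1)) = N%:R `^ (- a) / N%:R.
    rewrite opprD powRD; first by rewrite powR_inv1// ltW.
    by rewrite (gt_eqF N0) implybT.
  have sE (z : R) : \sum_(i < m.+2) \sum_(j < m.+2) z = n2 * z.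
    by rewrite !sumr_const !card_ord -[LHS]mulr_natl -[z *+ _]mulr_natl mulrA.
  have -> : n2 * ((C + `|c|) * C * B) * N%:R `^ (- (a + 1)) =
      \sum_(i < m.+2) \sum_(j < m.+2) ((C + `|c|) * (C * N%:R `^ (- a)) * (B / N%:R)).
    by rewrite sE pE; move: (N%:R `^ _) (N%:R^-1) n2 {n20 sE} => *; ring.
  rewrite /contract; apply: le_trans (ler_norm_sum _ _ _) _; apply: ler_sum => i _.
  apply: le_trans (ler_norm_sum _ _ _) _; apply: ler_sum => j _.
  rewrite normrM; apply: ler_pM => //; last by have [_] := hB 0 N%:R x N0; exact.
  rewrite /stress normrM; apply: ler_pM => //.
  apply: le_trans (ler_normB _ _) _; apply: lerD; last exact: ler_coord_norm.
  by apply: le_trans (ux j) _; rewrite -[leRHS]mulr1 ler_wpM2l.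
- move=> N x _ Nx; rewrite /contract big1// => i _; rewrite big1// => j _.
  by rewrite pderiv_field_outside ?mulr0 ?subr0.
Unshelve. all: by end_near. Qed.

End far_field.
(** * Point vortices *)

Section parity.
Context {R : realType}.
Implicit Type f : R -> R.

Definition parity (e : R) f := forall s, f (- s) = e * f s.

Lemma parity_cutoff : parity 1 (@cutoff R).
Proof. by move=> s; rewrite cutoff_even mul1r. Qed.

Lemma parity_derive e f : tame f -> parity e f -> parity (- e) (derive1 f).
Proof.
move=> tf pf s.
have := @is_derive_comp_affine R f (-1) 0 s (derive1 f (- s)).
rewrite mulN1r addr0 => /(_ (tame_is_derive (- s) tf)) [_].
rewrite (_ : (fun t => _) = e *: f); last first.
  by apply/funext => t; rewrite mulN1r addr0 pf.
have [df dfE] := tame_is_derive s tf.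
rewrite deriveZ// dfE mulN1r => h.
by move: h; rewrite /GRing.scale/= => h; lra.
Qed.

End parity.

Section vortex.
Context {R : realType}.
Local Notation space := 'rV[R]_2.
Local Notation leb := (@lebesgue_rV R 2).
Local Notation mu := (@lebesgue_measure R).
Local Notation i0 := (@ord0 1).
Local Notation i1 := (@ord_max 1).

Lemma sum_ord2 (F : 'I_2 -> R) : \sum_i F i = F i0 + F i1.
Proof. by rewrite big_ord_recl big_ord1; congr (_ + F _); apply/val_inj. Qed.

Lemma ord2_ind (Q : 'I_2 -> Prop) : Q i0 -> Q i1 -> forall i, Q i.
Proof.
move=> Q0 Q1 [[|[|//]] hi].
- by rewrite (_ : Ordinal hi = i0)//; apply/val_inj.
- by rewrite (_ : Ordinal hi = i1)//; apply/val_inj.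
Qed.

(** Component i of k times the rotated gradient of log|x - a|, in closed form. At x = a the value is
    0, by the convention on the inverse of 0. *)
Definition vortex (k : R) (a : space) (i : 'I_2) (x : space) : R :=
  k * (if i == i0 then - (x - a) 0 i1 else (x - a) 0 i0) / dot (x - a) (x - a).

Lemma norm_sqr_le_dot n (y : 'rV[R]_n) : `|y| ^+ 2 <= dot y y.
Proof.
rewrite -[leRHS]sqr_sqrtr ?dot_ge0// ler_pXn2r// ?nnegrE ?sqrtr_ge0//.
exact: norm_le_enorm.
Qed.

Lemma vortex_bound k a i x r : 0 < r -> r <= `|x - a| -> `|vortex k a i x| <= `|k| / r.
Proof.
move=> r0 rx; set y := x - a in rx *.
have y0 : 0 < `|y| by exact: lt_le_trans rx.
have d0 : 0 < dot y y by apply: lt_le_trans (norm_sqr_le_dot y); rewrite exprn_gt0.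
rewrite /vortex -/y !normrM normfV (gtr0_norm d0) -mulrA ler_wpM2l//.
rewrite ler_pdivrMr//; apply: (@le_trans _ _ `|y|).
  by case: ifP => _; rewrite ?normrN ler_coord_norm.
rewrite mulrC ler_pdivlMr//; apply: le_trans (norm_sqr_le_dot y).
by rewrite expr2 ler_wpM2l// ltW.
Qed.

Lemma perp_grad_ln (k : R) (a x : space) i : x != a ->
  (k *: perp_grad (fun y => ln (enorm (y - a))) x) 0 i = vortex k a i x.
Proof.
move=> xa; set y := x - a.
have y0 : 0 < `|y| by rewrite normr_gt0 subr_eq0.
have d0 : 0 < dot y y by apply: lt_le_trans (norm_sqr_le_dot y); rewrite exprn_gt0.
have e0 : 0 < enorm y by rewrite /enorm sqrtr_gt0.
have dd j : is_derive x (delta_mx 0 j) (fun z : space => dot (z - a) (z - a)) (2 * y 0 j).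
  apply: is_derive_coord.
  have -> : (fun h : R => dot (h *: delta_mx 0 j + x - a) (h *: delta_mx 0 j + x - a)) =
      (fun h => h * h + (2 * y 0 j) * h + dot y y).
    apply/funext => h; rewrite /dot !sum_ord2 !mxE /=.
    by move: j; apply: ord2_ind => /=; ring.
  have D1 := @is_deriveM _ _ id id (0 : R) 1 _ _ (is_derive_id _ _) (is_derive_id _ _).
  have D2 := @is_deriveZ _ _ _ id (2 * y 0 j) (0 : R) 1 _ (is_derive_id _ _).
  apply: is_derive_eq (is_deriveD (is_deriveD D1 D2) (is_derive_cst (dot y y) _ _)) _.
  by rewrite !scale0r !add0r addr0 [_ *: 1]mulr1.
have dp j : pderiv j (fun z : space => ln (enorm (z - a))) x = y 0 j / dot y y.
  rewrite /pderiv; apply: (@derive_val _ _ _ _ _ _ _ _).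
  have -> : y 0 j / dot y y = (enorm y)^-1 * ((2 * enorm y)^-1 * (2 * y 0 j)).
    have {1}-> : dot y y = enorm y ^+ 2 by rewrite sqr_sqrtr// dot_ge0.
    by field; rewrite gt_eqF.
  have dS : is_derive x (delta_mx 0 j) (fun z : space => enorm (z - a))
      ((2 * enorm y)^-1 * (2 * y 0 j)).
    have h := @is_derive1_sqrt R (dot y y) d0.
    exact: (@is_derive_real_comp _ _ Num.sqrt
      (fun z : space => dot (z - a) (z - a)) _ _ _ _ h (dd j)).
  have h := @is_derive1_ln R (enorm y) e0.
  exact: (@is_derive_real_comp _ _ (@ln R) (fun z : space => enorm (z - a)) _ _ _ _ h dS).
rewrite !mxE /vortex -/y; case: ifP => _; rewrite dp -?mulrA ?mulNr//.
Qed.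

Lemma measurable_vortex k a i : measurable_fun setT (vortex k a i).
Proof.
have cc j : continuous (fun x : space => (x - a) 0 j).
  rewrite (_ : (fun x : space => _) = fun x => x 0 j + - a 0 j).
    by apply: continuous_add_fun; [exact: coord_continuous|exact: cst_continuous].
  by apply/funext => x; rewrite !mxE.
have cd : continuous (fun x : space => dot (x - a) (x - a)).
  by apply: continuous_sum_fun => j; exact: continuous_mul_fun.
(* The inverse is written as the power -1, a measurable function; the two agree because the
   denominator is nonnegative. *)
rewrite (_ : vortex k a i = fun x =>
    k * (if i == i0 then - (x - a) 0 i1 else (x - a) 0 i0) * dot (x - a) (x - a) `^ (-1)).
  apply: measurable_funM.
    apply: continuous_measurable_rV; apply: continuous_scale_fun.
    case: (i == i0); last exact: cc.
    by move=> x; exact: cvgN (cc i1 x).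
  exact: measurableT_comp (measurable_powR _) (continuous_measurable_rV cd).
by apply/funext => x; rewrite powR_inv1// dot_ge0.
Qed.

Definition reflect (a x : space) : space := join (horiz x) (2 * a 0 i1 - x 0 i1).

Lemma reflect0 a x : reflect a x 0 i0 = x 0 i0.
Proof.
rewrite mxE; case: unliftP => [j ji|]; last by move/eqP.
by rewrite mxE -ji.
Qed.

Lemma reflect1 a x : reflect a x 0 i1 = 2 * a 0 i1 - x 0 i1.
Proof. by rewrite mxE unlift_none. Qed.

Lemma tensor_reflect F (a : space) r x e : parity e (F i1) ->
  tensor F a r (reflect a x) = e * tensor F a r x.
Proof.
move=> pF; rewrite /tensor !big_ord_recl !big_ord0 !mulr1 /=.
have -> : lift ord0 ord0 = i1 by apply/val_inj.
rewrite reflect0 reflect1 [X in F i1 X](_ : _ = - ((x 0 i1 - a 0 i1) / r)); last by ring.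
by rewrite pF; ring.
Qed.

Lemma vortex_reflect k a i x :
  vortex k a i (reflect a x) = (if i == i0 then -1 else 1) * vortex k a i x.
Proof.
have E0 : (reflect a x - a) 0 i0 = (x - a) 0 i0.
  by rewrite [LHS]mxE reflect0 [RHS]mxE.
have E1 : (reflect a x - a) 0 i1 = - (x - a) 0 i1.
  by rewrite [LHS]mxE reflect1 !mxE; ring.
rewrite /vortex (_ : dot (reflect a x - a) _ = dot (x - a) (x - a)).
  by rewrite E0 E1; case: ifP => _; ring.
by rewrite /dot !sum_ord2 E0 E1; ring.
Qed.

(** Parity in x_2 - a_2: v_1 is odd and v_2 even, while psi_1 is odd and psi_2 even, and d_2
    reverses parity. Each of the four terms v_j v_i d_j psi_i is then odd. *)
Lemma contract_vortex_reflect k (a : space) r x :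
  contract (fun i j x => vortex k a j x * vortex k a i x) (field a r) (reflect a x) =
  - contract (fun i j x => vortex k a j x * vortex k a i x) (field a r) x.
Proof.
have pc := @parity_cutoff R.
have pc1 := parity_derive (@tame_cutoff R) pc.
have pc2 := parity_derive (tame_derive (@tame_cutoff R)) pc1.
rewrite /contract !sum_ord2 !vortex_reflect /=.
rewrite !pderiv_field_max !pderiv_field_ord0.
rewrite (@tensor_reflect _ _ _ _ (-1)); last by [].
rewrite (@tensor_reflect _ _ _ _ 1); last by move=> s; rewrite -[1]opprK; exact: pc2.
rewrite (@tensor_reflect _ _ _ _ 1); last by [].
rewrite (@tensor_reflect _ _ _ _ (-1)); last by [].
ring.
Qed.

(** The gradient of the field vanishes within distance r of a, which hides the singularity. On an
    area of order r^2 this bound gives integrability at fixed r but no limit 0. *)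
Lemma contract_vortex_bound k : exists2 A, 0 <= A & forall (a x : space) r, 0 < r ->
  `|contract (fun i j x => vortex k a j x * vortex k a i x) (field a r) x| <= A / r ^+ 3.
Proof.
have [B B0 hB] := @field_bounded R 0.
have K0 : 0 <= `|k| by [].
exists (4 * (`|k| * `|k| * B)); first by rewrite !mulr_ge0.
move=> a x r r0; have r3 : 0 < r ^+ 3 by rewrite exprn_gt0.
have [xr|rx] := ltP `|x - a| r.
  rewrite /contract big1 => [|i _]; first by rewrite normr0 divr_ge0 ?(ltW r3)// !mulr_ge0.
  by rewrite big1// => j _; rewrite pderiv_field_inside// mulr0.
have [_ hB'] := hB a r x r0.
have t i j : `|vortex k a j x * vortex k a i x * pderiv j (fun y => field a r y 0 i) x| <=
    (`|k| / r) * (`|k| / r) * (B / r).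
  rewrite [leLHS]normrM; apply: ler_pM => //.
  by rewrite [leLHS]normrM; apply: ler_pM => //; apply: vortex_bound.
rewrite /contract !sum_ord2 (_ : _ / r ^+ 3 =
  (`|k| / r) * (`|k| / r) * (B / r) + (`|k| / r) * (`|k| / r) * (B / r) +
  ((`|k| / r) * (`|k| / r) * (B / r) + (`|k| / r) * (`|k| / r) * (B / r))); last first.
  by field; rewrite gt_eqF.
apply: le_trans (ler_normD _ _) _; apply: lerD;
  by apply: le_trans (ler_normD _ _) _; apply: lerD.
Qed.

Let vv k a r := contract (fun i j x => vortex k a j x * vortex k a i x) (field a r).

Lemma measurable_contract_vortex k a r : measurable_fun setT (vv k a r).
Proof.
rewrite /vv /contract; apply: measurable_sum => i; apply: measurable_sum => j.
apply: measurable_funM; first by apply: measurable_funM; exact: measurable_vortex.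
by apply: continuous_measurable_rV; exact: continuous_pderiv_field.
Qed.

Lemma contract_vortex_outside k a r x : 0 < r -> 2 * r < `|x - a| -> vv k a r x = 0.
Proof.
move=> r0 xr; rewrite /vv /contract big1// => i _; rewrite big1// => j _.
by rewrite pderiv_field_outside// mulr0.
Qed.

Lemma integrable_contract_vortex k a r : 0 < r -> leb.-integrable setT (EFin \o vv k a r).
Proof.
move=> r0; have [A A0 hA] := contract_vortex_bound k.
apply: (@integrable_bounded_support _ _ _ _ a (2 * r) (A / r ^+ 3)) => //.
- exact: measurable_contract_vortex.
- by rewrite mulr_ge0// ltW.
- by rewrite divr_ge0// exprn_ge0// ltW.
- by move=> x _ _; exact: hA.
- by move=> x _; exact: contract_vortex_outside.
Qed.

(** By Fubini along vertical lines: each slice is antisymmetric about the height of a. *)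
Lemma integral_contract_vortex k a r : 0 < r ->
  (\int[leb]_x (vv k a r x)%:E = 0)%E.
Proof.
move=> r0; have [A A0 hA] := contract_vortex_bound k.
rewrite integral_join_vert//=; last exact: integrable_contract_vortex.
rewrite integral0_eq// => x' _.
apply: (@integral_antisymmetric _ (2 * a 0 i1)); last first.
  move=> t; rewrite -[RHS]contract_vortex_reflect /reflect horiz_join.
  by rewrite -/(vert (join x' t)) vert_join.
pose J : interval R := `[a 0 i1 - 2 * r, a 0 i1 + 2 * r].
pose D : set (measurableTypeR R) := [set` J].
have mD : measurable D by exact: measurable_itv.
have msl : measurable_fun setT (fun t : measurableTypeR R => vv k a r (join x' t)).
  apply: measurableT_comp; first exact: measurable_contract_vortex.
  apply: measurable_fun_matrix => i j; under eq_fun do rewrite mxE.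
  by case: (unlift _ _) => [l|]; [exact: measurable_cst|exact: measurable_id].
rewrite (_ : _ \o _ = (EFin \o (fun t => vv k a r (join x' t))) \_ D).
  have h := @integrable_mkcond _ _ _ mu _ (EFin \o (fun t => vv k a r (join x' t))) mD.
  apply: (iffLR h); apply: measurable_bounded_integrable => //.
  - change (mu [set` J] < +oo)%E.
    by rewrite lebesgue_measure_itv/=; case: ifP => _; rewrite -?EFinB ltry.
  - exact: measurable_funTS.
  - exists (A / r ^+ 3); split; first exact: num_real.
    by move=> M hM t _ /=; apply: le_trans (hA _ _ _ r0) (ltW hM).
apply/funext => t; rewrite patchE; case: ifPn => // tD.
rewrite /= contract_vortex_outside//; move: tD; rewrite notin_setE /D /J /= in_itv/= => /negP h.
apply: lt_le_trans (ler_coord_norm _ i1); rewrite ltNge; apply: contra h.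
rewrite [(join x' t - a) 0 i1]mxE -/(vert (join x' t)) vert_join mxE ler_norml => /andP[h1 h2].
by apply/andP; split; lra.
Qed.

End vortex.
Section subtracted_sum.
Context {R : realType} (n m : nat).
Local Notation space := 'rV[R]_n.
Variables (f : space -> space) (G : 'I_m -> space -> space).
Hypotheses (Cf : forall i k, class_C k (fun x => f x 0 i))
  (CG : forall l i k, class_C k (fun x => G l x 0 i)).

Lemma coord_sub_sum i : (fun x => (f x - \sum_l G l x) 0 i) =
  (fun x => f x 0 i + (-1) * \sum_l G l x 0 i).
Proof. by apply/funext => x; rewrite !mxE summxE mulN1r. Qed.

Lemma class_C_sub_sum i k : class_C k (fun x => (f x - \sum_l G l x) 0 i).
Proof.
rewrite coord_sub_sum; apply: class_C_add => //; apply: class_C_scale.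
exact: class_C_sum.
Qed.

Lemma pderiv_sub_sum i j x : pderiv j (fun y => (f y - \sum_l G l y) 0 i) x =
  pderiv j (fun y => f y 0 i) x - \sum_l pderiv j (fun y => G l y 0 i) x.
Proof.
rewrite coord_sub_sum /pderiv.
have df : derivable (fun y => f y 0 i) x (delta_mx 0 j).
  exact: class_C_derivable (@Cf i 1%N).
have dG l : derivable (fun y => G l y 0 i) x (delta_mx 0 j).
  exact: class_C_derivable (@CG l i 1%N).
have -> : (fun y => f y 0 i + -1 * \sum_l G l y 0 i) =
    (fun y => f y 0 i) - \sum_(l < m) (fun y => G l y 0 i).
  by apply/funext => y; rewrite mulN1r !fctE fct_sumE.
by rewrite deriveB//; [rewrite derive_sum|exact: derivable_sum].
Qed.

Lemma contract_sub_sum w x : contract w (fun y => f y - \sum_l G l y) x =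
  contract w f x - \sum_l contract w (G l) x.
Proof.
rewrite /contract [X in _ - X]exchange_big -sumrB; apply: eq_bigr => i _.
rewrite [X in _ - X]exchange_big -sumrB; apply: eq_bigr => j _.
by rewrite pderiv_sub_sum mulrBr mulr_sumr.
Qed.

End subtracted_sum.

Lemma Rintegral_sumr {R : realType} (n : nat) (U : set 'rV[R]_n) (I : finType)
    (f : I -> 'rV[R]_n -> R) : measurable U ->
  (forall i, (@lebesgue_rV R n).-integrable U (EFin \o f i)) ->
  (\int[@lebesgue_rV R n]_(x in U) \sum_i f i x)%R =
  \sum_i (\int[@lebesgue_rV R n]_(x in U) f i x)%R.
Proof.
move=> mU fi.
have h (s : seq I) : (\int[@lebesgue_rV R n]_(x in U) \sum_(i <- s) f i x)%R =
    \sum_(i <- s) (\int[@lebesgue_rV R n]_(x in U) f i x)%R /\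
    (@lebesgue_rV R n).-integrable U (EFin \o (fun x => \sum_(i <- s) f i x)).
  elim: s => [|i s [ih iih]].
    under eq_Rintegral do rewrite big_nil; rewrite big_nil Rintegral_cst// mul0r.
    by split => //; under eq_fun do rewrite big_nil; exact: integrable0.
  under eq_Rintegral do rewrite big_cons; rewrite RintegralD// ih big_cons; split => //.
  apply: eq_integrable (integrableD mU (fi i) iih) => // x _ /=.
  by rewrite big_cons EFinD.
by have [] := h (index_enum I).
Qed.
Section restriction.
Context {R : realType} (n : nat).
Local Notation leb := (@lebesgue_rV R n).

Lemma Rintegral_support (U : set 'rV[R]_n) (f : 'rV[R]_n -> R) :
  (forall x, ~ U x -> f x = 0) ->
  (\int[leb]_(x in U) f x)%R = (\int[leb]_x f x)%R.
Proof.
move=> f0; rewrite Rintegral_mkcond; congr Rintegral; apply/funext => x.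
by rewrite patchE; case: ifPn => //; rewrite notin_setE => /f0.
Qed.

Lemma loc_integrable_cst (U Xi : set 'rV[R]_n) (a : R) : measurable U ->
  loc_integrable U Xi (cst a).
Proof.
move=> mU K cK _; have mK : measurable K.
  by apply: closed_measurable_rV; exact: compact_closed (@norm_hausdorff _ _) cK.
have [M [Mr hM]] := compact_bounded cK.
have M1 : M < `|M| + 1 by rewrite (le_lt_trans (ler_norm M))// ltrDl.
apply: (@integrable_bounded_support _ _ _ _ 0 (`|M| + 1) `|a|) => //.
- exact: measurableI.
- by move=> x [_ Kx]; rewrite subr0 ltNge (hM _ M1 x Kx).
Qed.

End restriction.

(** * The balance of momentum with point vortices *)

Section point_vortices.
Context {R : realType}.
Local Notation space := 'rV[R]_2.
Local Notation leb := (@lebesgue_rV R 2).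
Local Notation i0 := (@ord0 1).
Local Notation i1 := (@ord_max 1).
Variables (c : space) (eta : 'rV[R]_1 -> R) (u : space -> space) (P : space -> R).
Variables (M : nat) (xi : 'I_M -> space).
Hypotheses (ceta : continuous eta) (hc : vert c = 0).
Hypotheses (xi_inj : injective xi) (xi_below : range xi `<=` below eta).
Hypothesis adm : admissible (range xi) (below eta) u P.
Hypothesis div0 : incompressible_tangential c (range xi) (below eta) u.

Let Om := below eta.
Let mOm : measurable Om. Proof. exact: measurable_below. Qed.

(** With 3 d, a point within d of one vortex is more than 2 d away from all others, outside the
    supports of their fields. *)
Definition separated (d : R) : Prop := forall k,
  cube (xi k) (2 * d) `<=` Om /\ forall l, l != k -> 3 * d < `|xi l - xi k|.

Lemma near_separated : \forall d \near 0^'+, separated d.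
Proof.
apply: filter_forall => k; apply: filterI.
  have /nbhs_ballP[e /= e0 eOm] : nbhs (xi k) Om.
    by apply: open_nbhs_nbhs; split; [exact: open_below|apply: xi_below; exists k].
  near=> d => x xd; apply: eOm; rewrite -ball_normE /ball_ /= distrC.
  apply: le_lt_trans xd _; rewrite mulrC -ltr_pdivlMr//; near: d.
  by apply: nbhs_right_lt; rewrite divr_gt0.
suff h l : \forall d \near 0^'+, l != k -> 3 * d < `|xi l - xi k| by exact: filter_forall h.
have [lk|lk] := eqVneq l k.
  exact: nearW.
have lk0 : 0 < `|xi l - xi k| by rewrite normr_gt0 subr_eq0 (inj_eq xi_inj).
near=> d => _; rewrite mulrC -ltr_pdivlMr//; near: d.
by apply: nbhs_right_lt; rewrite divr_gt0.
Unshelve. all: by end_near. Qed.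

Lemma separated_range d k x : 0 < d -> separated d -> range xi x ->
  `|x - xi k| < d \/ 2 * d < `|x - xi k|.
Proof.
move=> d0 sep [l _ <-]; have [->|lk] := eqVneq l k.
  by left; rewrite subrr normr0.
by right; have [_ /(_ l lk)] := sep k; apply: lt_trans; rewrite ltr_pM2r// ltr_nat.
Qed.

Let ls i j : loc_integrable Om (range xi) (stress c u i j).
Proof. exact: (loc_integrable_stress c mOm adm). Qed.

Lemma integrable_stress_vortex d k : 0 < d -> separated d ->
  leb.-integrable Om (EFin \o contract (stress c u) (field (xi k) d)).
Proof.
by move=> d0 sep; apply: (integrable_contract_field mOm ls d0) => x; exact: separated_range.
Qed.

(* The stress may be replaced by W: as c_2 = 0, contracting their difference with
   grad psi gives (u - c).grad (c_1 psi_1), whose integral is 0 since u - c is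
   divergence free and tangent to S. *)
Let W (i j : 'I_2) (x : space) : R := (u x 0 j - c 0 j) * (u x 0 i - c 0 i).

Let phi (a : space) d (x : space) : R := c 0 i0 * field a d x 0 i0.

Let pderiv_phi a d j x : pderiv j (phi a d) x =
  c 0 i0 * pderiv j (fun y => field a d y 0 i0) x.
Proof.
rewrite /pderiv /phi (@deriveZ _ _ _ (fun y => field a d y 0 i0))//.
exact: class_C_derivable (@class_C_field _ _ a d i0 1).
Qed.

Let c1 : c 0 i1 = 0. Proof. exact: hc. Qed.

Let stressE a d x : contract (stress c u) (field a d) x =
  contract W (field a d) x + \sum_j (u x 0 j - c 0 j) * pderiv j (phi a d) x.
Proof.
rewrite /contract !sum_ord2 !pderiv_phi /stress /W c1.
move: (pderiv _ _ _) (pderiv _ _ _) (pderiv _ _ _) (pderiv _ _ _) => p q r s.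
move: (u x 0 i0) (u x 0 i1) (c 0 i0) => v w b; ring.
Qed.

(** Within d of the vortex k the field is e_n, whose horizontal component is 0; thus phi vanishes
    near that vortex, and the other vortices are outside its support. *)
Let test_phi d k : 0 < d -> separated d -> test_fun (~` range xi) (phi (xi k) d).
Proof.
move=> d0 sep; pose K := cube (xi k) (2 * d) `&` [set x | d <= `|x - xi k|].
have clK : closed K.
  apply: closedI; first exact: cube_closed.
  rewrite (_ : [set x | _] = ~` [set x | `|x - xi k| < d]); last first.
    by apply/seteqP; split=> x /=; rewrite leNgt => /negP.
  apply: open_closedC; rewrite openE => x /= xr; exact: near_inside.
apply: (@test_fun_compact _ _ _ K) => //.
- by move=> s; apply: class_C_scale; exact: class_C_field.
- apply: subclosed_compact clK (@cube_compact _ _ (xi k) (2 * d)) _ => x [] //.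
- by move=> x [/= xd dx] /(@separated_range d k x d0 sep)[]; rewrite ltNge ?xd ?dx.
move=> x; apply: contraPP => nK.
suff h : field (xi k) d x 0 i0 = 0 by rewrite /phi h mulr0 eqxx.
have [xr|rx] := ltP `|x - xi k| d; first by rewrite field_inside// mxE.
have [xr|xr] := leP `|x - xi k| (2 * d); last by rewrite field_outside// mxE.
by exfalso; apply: nK.
Qed.

Let integrable_phi d k : 0 < d -> separated d ->
  leb.-integrable Om (EFin \o (fun x => \sum_j (u x 0 j - c 0 j) * pderiv j (phi (xi k) d) x)).
Proof.
move=> d0 sep; apply: integrable_sumr => // j.
have lu : loc_integrable Om (range xi) (fun x => u x 0 j + - c 0 j).
  apply: loc_integrableD => //; first exact: (loc_integrable_velocity adm).
  exact: loc_integrable_cst.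
have [Cphi cphi sphi] := test_phi k d0 sep.
apply: (loc_integrable_test mOm lu cphi sphi).
  exact: class_C_continuous (class_C_pderiv j (Cphi 1%N)).
move=> x nx; have : \forall y \near x, phi (xi k) d y = 0.
  have oC : open (~` closure [set x | phi (xi k) d x != 0]).
    by rewrite openC; exact: closed_closure.
  apply: filterS (open_nbhs_nbhs (conj oC nx)) => y ny.
  by apply/eqP; apply: contrapT => /negP h; apply: ny; exact: subset_closure.
move=> h; rewrite /pderiv (@near_eq_derive _ _ _ _ (cst (0 : R))) ?derive_cst//.
Qed.

Let integrable_W d k : 0 < d -> separated d ->
  leb.-integrable Om (EFin \o contract W (field (xi k) d)).
Proof.
move=> d0 sep; have h := integrableB mOm (integrable_stress_vortex k d0 sep)
  (integrable_phi k d0 sep).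
apply: eq_integrable h => // x _ /=; rewrite stressE -EFinB.
by rewrite addrK.
Qed.

Let Rintegral_stress d k : 0 < d -> separated d ->
  (\int[leb]_(x in Om) contract (stress c u) (field (xi k) d) x)%R =
  (\int[leb]_(x in Om) contract W (field (xi k) d) x)%R.
Proof.
move=> d0 sep; under eq_Rintegral do rewrite stressE.
rewrite RintegralD//; [|exact: integrable_W|exact: integrable_phi].
by rewrite (div0 (test_phi k d0 sep)) addr0.
Qed.

(* The self-interaction of the vortex cancels by symmetry, and its interaction
   with the rest of the flow is o(1/d) * O(1/d) on a square of size O(d). *)
Lemma vortex_force_cvg0 (k : 'I_M) (kappa : R) :
  u x - kappa *: perp_grad (fun y => ln (enorm (y - xi k))) x @[x --> (xi k)^'] --> c ->
  forall e, 0 < e -> \forall d \near 0^'+,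
    `|(\int[leb]_(x in Om) contract (stress c u) (field (xi k) d) x)%R| <= e.
Proof.
move=> uc e e0; have [B B0 hB] := @field_bounded R 0.
pose K := `|kappa|; have K0 : 0 <= K by exact: normr_ge0.
(* 64 = 4 * 16: four index pairs on a square of side 4 d. The factors e1 (2 K / d + e1) and B / d
   times that area give 64 B (2 K + e1 d) e1, with d and e1 at most 1. *)
pose L := 64 * (B * (2 * K + 1)).
have L0 : 0 <= L by rewrite !mulr_ge0// addr_ge0// mulr_ge0.
pose e1 := Num.min 1 (e / (L + 1)).
have L1 : 0 < L + 1 by rewrite ltr_wpDl.
have e10 : 0 < e1 by rewrite lt_min ltr01 divr_gt0.
have e1le1 : e1 <= 1 by rewrite ge_min lexx.
have Le1 : L * e1 <= e.
  apply: (@le_trans _ _ ((L + 1) * e1)).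
    by rewrite ler_wpM2r ?ltW// ltrDl.
  by rewrite mulrC -ler_pdivlMr// ge_min lexx orbT.
move/cvgrPdist_lt : uc => /(_ e1 e10); rewrite near_withinE => /nbhs_ballP[r /= r0 hr].
near=> d.
have d0 : 0 < d by near: d; exact: nbhs_right_gt.
have d1 : d <= 1 by near: d; apply: nbhs_right_le.
have dr : 2 * d < r.
  by rewrite mulrC -ltr_pdivlMr//; near: d; apply: nbhs_right_lt; rewrite divr_gt0.
have sep : separated d by near: d; exact: near_separated.
pose a := xi k.
pose vv (i j : 'I_2) (x : space) : R := vortex kappa a j x * vortex kappa a i x.
have ivv : leb.-integrable setT (EFin \o contract vv (field a d)).
  exact: integrable_contract_vortex.
(* The support lies in the fluid, so the integral extends to the plane, where the reflection
   symmetry is available. *)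
have vv0 : (\int[leb]_(x in Om) contract vv (field a d) x)%R = 0.
  rewrite Rintegral_support ?/Rintegral ?integral_contract_vortex//.
  move=> x Omx; apply: contract_vortex_outside => //; rewrite ltNge; apply/negP => xd.
  by apply: Omx; have [h _] := sep k; exact: h.
have ivvO := integrableS measurableT mOm (@subsetT _ Om) ivv.
rewrite Rintegral_stress// -[X in `|X|]subr0 -vv0 -RintegralB//; last exact: integrable_W.
have := @Rintegral_bounded_support R 2 Om
  (fun x => contract W (field a d) x - contract vv (field a d) x) a (2 * d)
  (4 * (e1 * (2 * K / d + e1) * (B / d))) mOm.
have -> : 4 * (e1 * (2 * K / d + e1) * (B / d)) * (2 * (2 * d)) ^+ 2 =
    64 * (B * (2 * K + e1 * d)) * e1 by field; rewrite gt_eqF.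
move=> hRint; apply: (le_trans (hRint _ _ _ _ _)) => {hRint}.
- apply: measurable_funB; apply/measurable_EFinP.
    by apply: measurable_int; exact: integrable_W.
  exact: measurable_int ivvO.
- by rewrite mulr_ge0// ltW.
- rewrite !mulr_ge0 ?addr_ge0 ?invr_ge0 ?(ltW e10) ?(ltW d0)//.
  by rewrite !mulr_ge0// invr_ge0 ltW.
- move=> x Omx xd; rewrite /contract -sumrB.
  have [_ hB'] := hB a d x d0.
  have [xd'|dx] := ltP `|x - a| d.
    rewrite big1 => [|i _].
      rewrite normr0 !mulr_ge0 ?addr_ge0 ?invr_ge0 ?(ltW e10) ?(ltW d0)//.
      by rewrite !mulr_ge0// invr_ge0 ltW.
    by rewrite -sumrB big1// => j _; rewrite pderiv_field_inside// !mulr0 subrr.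
  have xa : x != a.
    by apply/eqP => xE; move: dx; rewrite xE subrr normr0 leNgt d0.
  have hx : `|c - (u x - kappa *: perp_grad (fun y => ln (enorm (y - xi k))) x)| < e1.
    by apply: hr => //; rewrite -ball_normE /ball_ /= distrC (le_lt_trans xd).
  have hv i : `|u x 0 i - c 0 i - vortex kappa a i x| <= e1.
    apply: le_trans (ltW hx); apply: le_trans (ler_coord_norm _ i).
    rewrite [X in _ <= `|X|]mxE [X in _ <= `|_ + X|]mxE [X in _ <= `|_ - X|]mxE.
    rewrite [X in _ <= `|_ - (_ + X)|]mxE perp_grad_ln// -/a -normrN.
    by apply/eqP/eqP; rewrite le_eqVlt; apply/orP; left; apply/eqP; congr `|_|; ring.
  have hV i : `|vortex kappa a i x| <= K / d by exact: vortex_bound.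
  have ht i j : `|W i j x * pderiv j (fun y => field a d y 0 i) x -
      vv i j x * pderiv j (fun y => field a d y 0 i) x| <= e1 * (2 * K / d + e1) * (B / d).
    rewrite -mulrBl normrM; apply: ler_pM => //.
    have := hv i; have := hv j; have := hV i; have := hV j.
    rewrite /W /vv; set p := u x 0 j - c 0 j; set q := u x 0 i - c 0 i.
    move=> hVj hVi hp hq.
    (* Every term of this expansion about the vortex velocity keeps a factor of size at most e1. *)
    have -> : p * q - vortex kappa a j x * vortex kappa a i x =
       (p - vortex kappa a j x) * (q - vortex kappa a i x) +
       ((p - vortex kappa a j x) * vortex kappa a i x +
        vortex kappa a j x * (q - vortex kappa a i x)) by ring.
    have -> : e1 * (2 * K / d + e1) = e1 * e1 + (e1 * (K / d) + (K / d) * e1) by ring.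
    apply: le_trans (ler_normD _ _) _; apply: lerD; first by rewrite normrM; apply: ler_pM.
    by apply: le_trans (ler_normD _ _) _; apply: lerD; rewrite normrM; apply: ler_pM.
  rewrite !sum_ord2 (_ : 4 * _ = e1 * (2 * K / d + e1) * (B / d) + e1 * (2 * K / d + e1) * (B / d)
    + (e1 * (2 * K / d + e1) * (B / d) + e1 * (2 * K / d + e1) * (B / d))); last by ring.
  apply: le_trans (ler_normD _ _) _; apply: lerD;
    by rewrite opprD addrACA; apply: le_trans (ler_normD _ _) _; apply: lerD.
- move=> x _ xd; rewrite contract_vortex_outside// subr0 /contract big1// => i _.
  by rewrite big1// => j _; rewrite pderiv_field_outside// mulr0.
apply: le_trans Le1; apply: ler_wpM2r; first exact: ltW.
rewrite /L; do 2! apply: ler_wpM2l => //.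
by rewrite lerD2l -[leRHS]mulr1; apply: ler_pM => //; exact: ltW.
Unshelve. all: by end_near. Qed.

Variables (g sigma h N : R) (kappa : 'I_M -> R).
Hypotheses (etah : forall x, `|eta x| <= h) (hN : h < N).
Hypothesis xiN : forall k, `|xi k| < N.
Hypothesis vortices : forall k,
  u x - kappa k *: perp_grad (fun y => ln (enorm (y - xi k))) x @[x --> (xi k)^'] --> c.
Hypothesis balance : forall psi, test_field (~` range xi) psi ->
  momentum g c Om u P 1 psi = tension sigma eta psi.

Let N0 : 0 < N.
Proof. by apply: le_lt_trans hN; apply: le_trans (etah 0). Qed.

(* Near the vortex k, both [field 0 N] and [field (xi k) d] are equal to e_n. *)
Let psi d (x : space) : space := field 0 N x - \sum_k field (xi k) d x.

Let vertE a d : (fun x : space => vert (field a d x)) = field_vert a d.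
Proof. exact: field_max. Qed.

Section fixed_size.
Variable d : R.
Hypotheses (d0 : 0 < d) (sep : separated d) (small : forall k, `|xi k| + 2 * d < N).

(** By [small], the d-cubes around the vortices lie where the large field is e_n. There it cancels
    against the one small field that is e_n too, the others being 0 by separation. *)
Let test_psi : test_field (~` range xi) (psi d).
Proof.
pose K := cube (0 : space) (2 * N) `&` [set x | forall k, d <= `|x - xi k|].
have clK : closed K.
  apply: closedI; first exact: cube_closed.
  rewrite (_ : [set x | _] = \bigcap_(k in setT) ~` [set x | `|x - xi k| < d]); last first.
    apply/seteqP; split=> x /= hx k; first by move=> _ /=; rewrite ltNge hx.
    by rewrite leNgt; apply/negP; exact: hx.
  apply: closed_bigI => k _.
  by apply: open_closedC; rewrite openE => x /= xr; exact: near_inside.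
move=> i; apply: (@test_fun_compact _ _ _ K) => //.
- by move=> k; apply: class_C_sub_sum => *; exact: class_C_field.
- by apply: subclosed_compact clK (@cube_compact _ _ 0 (2 * N)) _ => x [].
- by move=> x [/= _ dx] [k _ xk]; have := dx k; rewrite xk subrr normr0 leNgt d0.
move=> x; apply: contraPP => nK.
suff E : psi d x = 0 by rewrite E mxE eqxx.
rewrite /psi; have [xN|Nx] := ltP (2 * N) `|x|.
  rewrite field_outside ?subr0// big1 ?subr0// => k _; rewrite field_outside//.
  by have := lerB_dist x (xi k); have := small k; have := N0; lra.
have [k kd] : exists k, `|x - xi k| < d.
  apply: contrapT => nk; apply: nK; split; first by rewrite /cube /= subr0.
  by move=> k /=; rewrite leNgt; apply/negP => kd; apply: nk; exists k.
have xN : `|x| < N.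
  apply: le_lt_trans (small k); rewrite -[x in leLHS](subrK (xi k)).
  apply: le_trans (ler_normD _ _) _; rewrite addrC lerD2l; apply: ltW.
  by apply: lt_trans kd _; rewrite mulr_natl mulr2n ltrDl.
rewrite field_inside ?subr0// (bigD1 k)//= field_inside// big1 ?addr0 ?subrr// => l lk.
rewrite field_outside//; have [_ /(_ l lk) ] := sep k.
have := ler_distD x (xi l) (xi k); rewrite (distrC (xi l) x); lra.
Qed.

Let psi_div0 x : \sum_i pderiv i (fun y => psi d y 0 i) x = 0.
Proof.
under eq_bigr => i _.
  rewrite pderiv_sub_sum; [|by move=> *; exact: class_C_field|by move=> *; exact: class_C_field].
  over.
rewrite sumrB field_divergence exchange_big big1 ?subrr// => k _; exact: field_divergence.
Qed.

Let contract_psi w x : contract w (psi d) x =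
  contract w (field 0 N) x - \sum_k contract w (field (xi k) d) x.
Proof. by apply: contract_sub_sum => *; exact: class_C_field. Qed.

Let integrable_far : leb.-integrable Om (EFin \o contract (stress c u) (field 0 N)).
Proof.
by apply: (integrable_contract_field mOm ls N0) => x [k _ <-]; left; rewrite subr0.
Qed.

Let integrable_near : leb.-integrable Om
  (EFin \o (fun x => \sum_k contract (stress c u) (field (xi k) d) x)).
Proof. by apply: integrable_sumr => // k; exact: integrable_stress_vortex. Qed.

Let integrable_psi : leb.-integrable Om (EFin \o contract (stress c u) (psi d)).
Proof.
apply: eq_integrable (integrableB mOm integrable_far integrable_near) => // x _ /=.
by rewrite contract_psi EFinB.
Qed.

Let vert_psi x : vert (psi d x) = field_vert 0 N x - \sum_k field_vert (xi k) d x.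
Proof.
rewrite /vert /psi !mxE summxE eqxx; congr (_ - _).
by apply: eq_bigr => k _; rewrite -(congr1 (@^~ x) (vertE (xi k) d)).
Qed.

Let integrable_vert a r : 0 < r -> leb.-integrable Om (EFin \o field_vert a r).
Proof. by move=> r0; rewrite -vertE; exact: integrable_vert_field. Qed.

Let integrable_verts :
  leb.-integrable Om (EFin \o (fun x => \sum_k field_vert (xi k) d x)).
Proof. by apply: integrable_sumr => // k; exact: integrable_vert. Qed.

Let integrable_vert_psi : leb.-integrable Om (EFin \o (fun x => vert (psi d x))).
Proof.
have iN := integrable_vert 0 N0.
apply: eq_integrable (integrableB mOm iN integrable_verts) => // x _ /=.
by rewrite vert_psi EFinB.
Qed.

Let field_vert_outside k x : ~ Om x -> field (xi k) d x = 0.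
Proof.
move=> Omx; rewrite field_outside// ltNge; apply/negP => xk; apply: Omx.
by have [hk _] := sep k; exact: hk.
Qed.

(** The small fields lie inside the fluid and their vertical components have integral 0, so gravity
    does not see them. *)
Let Rintegral_vert_psi : (\int[leb]_(x in Om) vert (psi d x))%R =
  (\int[@lebesgue_rV R 1]_x' (eta x' * field_vert 0 N x'))%R.
Proof.
under eq_Rintegral do rewrite vert_psi.
have iN := integrable_vert 0 N0.
rewrite (RintegralB mOm iN integrable_verts).
rewrite (Rintegral_field_vert_below ceta etah hN) Rintegral_sumr//; last first.
  by move=> k; exact: integrable_vert.
rewrite big1 ?subr0// => k _; rewrite Rintegral_support => [|x Omx].
  by rewrite /Rintegral integral_field_vert.
by rewrite -(congr1 (@^~ x) (vertE (xi k) d)) field_vert_outside// /vert mxE.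
Qed.

(** The small fields vanish on the surface, as their supports are inside the open fluid domain. *)
Let tension_psi : tension sigma eta (psi d) = tension sigma eta (field 0 N).
Proof.
rewrite /tension; congr surface_integral; apply/funext => x'; congr (_ * dot _ _).
rewrite /psi big1 ?subr0// => k _; apply: field_vert_outside.
by rewrite /Om /below /= horiz_join vert_join ltxx.
Qed.

Lemma balance_truncated :
  (\int[leb]_(x in Om) contract (stress c u) (field 0 N) x)%R -
  g * (\int[@lebesgue_rV R 1]_x' (eta x' * field_vert 0 N x'))%R -
  tension sigma eta (field 0 N) =
  \sum_k (\int[leb]_(x in Om) contract (stress c u) (field (xi k) d) x)%R.
Proof.
have := balance test_psi; rewrite momentum_solenoidal// tension_psi Rintegral_vert_psi.
rewrite !mul1r; under eq_Rintegral do rewrite contract_psi.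
rewrite RintegralB// Rintegral_sumr//; last by move=> k; exact: integrable_stress_vortex.
by move=> <-; ring.
Qed.

End fixed_size.

(** The defect D of the identity does not involve d, yet it is a sum of M forces that tend to 0 with
    d. *)
Lemma balance_vortices :
  (\int[leb]_(x in Om) contract (stress c u) (field 0 N) x)%R -
  g * (\int[@lebesgue_rV R 1]_x' (eta x' * field_vert 0 N x'))%R =
  tension sigma eta (field 0 N).
Proof.
apply/eqP; rewrite -subr_eq0; apply: contraT; set D := (X in X != 0) => D0.
have Dp : 0 < `|D| by rewrite normr_gt0.
have M1 : 0 < M%:R + 1 :> R by rewrite ltr_wpDl.
(* M + 1 instead of M covers the absence of vortices and makes |D| <= M e < |D| absurd. *)
pose e := `|D| / (M%:R + 1); have e0 : 0 < e by rewrite divr_gt0.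
have [d [d0 sep small le_e]] : exists d, [/\ 0 < d, separated d,
    (forall k, `|xi k| + 2 * d < N) &
    forall k, `|(\int[leb]_(x in Om) contract (stress c u) (field (xi k) d) x)%R| <= e].
  apply: (@filter_ex _ (0 : R)^'+); near=> d; split.
  - by near: d; exact: nbhs_right_gt.
  - by near: d; exact: near_separated.
  - near: d; apply: filter_forall => k; near=> d.
    rewrite addrC -ltrBrDr mulrC -ltr_pdivlMr//; near: d.
    by apply: nbhs_right_lt; rewrite divr_gt0// subr_gt0.
  - by near: d; apply: filter_forall => k; exact: (vortex_force_cvg0 (vortices k)).
have : `|D| <= M%:R * e.
  rewrite /D (balance_truncated d0 sep small); apply: le_trans (ler_norm_sum _ _ _) _.
  apply: (@le_trans _ _ (\sum_(k < M) e)); last by rewrite sumr_const card_ord mulr_natl.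
  by apply: ler_sum => k _; exact: le_e.
rewrite /e mulrCA -[X in X <= _]mulr1 ler_pM2l// ler_pdivlMr// mul1r.
by rewrite leNgt ltrDl ltr01.
Unshelve. all: by end_near. Qed.

End point_vortices.
(** * The excess mass *)

Section vanishing_mass.
Context {R : realType}.

Lemma nonneg_integral_eq0 n (f : 'rV[R]_n -> R) : continuous f ->
  (@lebesgue_rV R n).-integrable setT (EFin \o f) -> (forall x, 0 <= f x) ->
  (\int[@lebesgue_rV R n]_x f x)%R = 0 -> forall x, f x = 0.
Proof.
move=> cf If f0 I0 x; apply/eqP; rewrite eq_le f0 andbT leNgt; apply/negP => fx.
have f2 : f x / 2 < f x by rewrite ltr_pdivrMr// ltr_pMr// ltr1n.
have /nbhs_ballP[r /= r0 hr] : \forall y \near x, f x / 2 < f y.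
  exact: (cf x) (open_nbhs_nbhs (conj (@open_gt R (f x / 2)) f2)).
have r2 : 0 < r / 2 by rewrite divr_gt0.
have mC := @measurable_cube R n x (r / 2).
have : (0 < \int[@lebesgue_rV R n]_(y in cube x (r / 2)) (f x / 2)%:E)%E.
  rewrite integral_cst//; have E := lebesgue_cube x (ltW r2).
  rewrite [X in (_ * X)%E]E -EFinM lte_fin.
  by rewrite mulr_gt0 ?divr_gt0// exprn_gt0// mulr_gt0.
apply/negP; rewrite -leNgt.
have <- : (\int[@lebesgue_rV R n]_y (f y)%:E = 0)%E.
  by rewrite -[LHS]fineK ?integrable_fin_num// -/(Rintegral _ _ _) I0.
have mf : measurable_fun setT (EFin \o f) by exact: measurable_int If.
apply: (@le_trans _ _ (\int[@lebesgue_rV R n]_(y in cube x (r / 2)) (f y)%:E)%E).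
  apply: ge0_le_integral => //.
  - by move=> y _; rewrite lee_fin divr_ge0.
  - exact: measurable_funTS.
  - move=> y yr; rewrite lee_fin ltW//; apply: hr; rewrite -ball_normE /ball_ /= distrC.
    by apply: le_lt_trans yr _; rewrite ltr_pdivrMr// ltr_pMr// ltr1n.
by apply: ge0_subset_integral => // y _; rewrite lee_fin.
Qed.

Lemma one_signed_integral_eq0 n (f : 'rV[R]_n -> R) : continuous f ->
  (@lebesgue_rV R n).-integrable setT (EFin \o f) ->
  (\int[@lebesgue_rV R n]_x f x)%R = 0 ->
  (forall x, 0 <= f x) \/ (forall x, f x <= 0) -> forall x, f x = 0.
Proof.
move=> cf If I0 [f0|f0]; first exact: nonneg_integral_eq0.
have E : (fun y => - f y) = (fun y => -1 * f y) by apply/funext => y; rewrite mulN1r.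
move=> x; apply: oppr_inj; rewrite oppr0; move: x.
apply: (@nonneg_integral_eq0 _ (fun y => - f y)).
- by move=> y; exact: cvgN (cf y).
- by rewrite E; exact: (integrableZl measurableT (-1) If).
- by move=> y; rewrite oppr_ge0.
- by rewrite E RintegralZl// I0 mulr0.
Qed.

End vanishing_mass.

Section excess_mass.
Context {R : realType} (m : nat) (eta : 'rV[R]_m.+1 -> R) (h : R).
Local Notation V N := (\int[@lebesgue_rV R m.+1]_x' (eta x' * field_vert 0 N x'))%R.
Hypotheses (Ceta : class_C 2 eta) (etah : forall x, `|eta x| <= h).

(** Common end of all cases: F is the momentum flux, and kappa is g for one fluid and (rho_m -
    rho_p) g for two. *)
Lemma mass_eq0 sigma b kappa (F : nat -> R) : kappa != 0 -> m.+1%:R < b ->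
  (forall i, decays setT b (pderiv i eta)) ->
  (@lebesgue_rV R m.+1).-integrable setT (EFin \o eta) -> F @ \oo --> (0 : R) ->
  (\forall N \near \oo, F N - kappa * V N%:R = tension sigma eta (field 0 N%:R)) ->
  (\int[@lebesgue_rV R m.+1]_x' eta x')%R = 0.
Proof.
move=> k0 mb dec If F0 bal.
have hT := tension_cvg0 Ceta etah sigma mb dec.
have hV := Rintegral_eta_field_cvg Ceta If.
have : (fun N : nat => kappa * V N%:R) @ \oo --> (0 : R).
  have h0 : (F - (fun N : nat => tension sigma eta (field 0 N%:R))) @ \oo --> (0 : R).
    by have := cvgB F0 hT; rewrite subrr; exact.
  apply: cvg_trans h0; apply: near_eq_cvg; near=> N.
  have E : F N - kappa * V N%:R = tension sigma eta (field 0 N%:R) by near: N.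
  by rewrite !fctE -E opprB addrC subrK.
have hk : (fun N : nat => kappa * V N%:R) @ \oo -->
    kappa * (\int[@lebesgue_rV R m.+1]_x' eta x')%R by exact: cvgM (cvg_cst kappa) hV.
move=> /(cvg_unique (@Rhausdorff R) hk) /eqP.
by rewrite mulf_eq0 (negbTE k0) => /eqP.
Unshelve. all: by end_near. Qed.

End excess_mass.

(** * The balance of momentum without point vortices *)

Section truncated_balance.
Context {R : realType} (m : nat) (eta : 'rV[R]_m.+1 -> R) (h : R).
Local Notation space := 'rV[R]_m.+2.
Local Notation leb := (@lebesgue_rV R m.+2).
Local Notation V N := (\int[@lebesgue_rV R m.+1]_x' (eta x' * field_vert 0 N x'))%R.
Variables (g sigma : R) (c : space) (u : space -> space) (P : space -> R).
Hypotheses (Ceta : class_C 2 eta) (etah : forall x, `|eta x| <= h).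

Let ceta : continuous eta. Proof. exact: class_C_continuous Ceta. Qed.

Local Notation flux U N := (\int[leb]_(x in U) contract (stress c u) (field 0 N) x)%R.

Lemma momentum_field U rho N : measurable U -> admissible set0 U u P -> 0 < N ->
  momentum g c U u P rho (field 0 N) =
  rho * flux U N - rho * g * (\int[leb]_(x in U) field_vert 0 N x)%R.
Proof.
move=> mU adm N0; rewrite momentum_solenoidal//.
- by rewrite -(@field_max R m 0 N).
- apply: (@integrable_contract_field _ _ _ mU set0 _ _ _ _ N0) => // i j.
  exact: (loc_integrable_stress c mU adm).
- exact: integrable_vert_field.
- exact: field_divergence.
Qed.

Lemma balance_one_fluid N : h < N -> admissible set0 (below eta) u P ->
  (forall psi, test_field (~` set0) psi ->
     momentum g c (below eta) u P 1 psi = tension sigma eta psi) ->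
  flux (below eta) N - g * V N = tension sigma eta (field 0 N).
Proof.
move=> hN adm bal; have N0 : 0 < N by apply: le_lt_trans hN; apply: le_trans (etah 0).
have mU := measurable_below ceta.
rewrite -bal; last by apply: test_fun_field => // x _; rewrite setC0.
by rewrite momentum_field// (Rintegral_field_vert_below ceta etah hN) !mul1r.
Qed.

(** Raising the surface takes from the upper fluid the volume that it gives to the lower one, hence
    the difference of the densities. *)
Lemma balance_two_fluids rho_m rho_p N : h < N ->
  admissible set0 (below eta) u P -> admissible set0 (above eta) u P ->
  (forall psi, test_field setT psi ->
     momentum g c (below eta) u P rho_m psi + momentum g c (above eta) u P rho_p psi =
     tension sigma eta psi) ->
  rho_m * flux (below eta) N + rho_p * flux (above eta) N - (rho_m - rho_p) * g * V N =
  tension sigma eta (field 0 N).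
Proof.
move=> hN adm adp bal; have N0 : 0 < N by apply: le_lt_trans hN; apply: le_trans (etah 0).
have mU := measurable_below ceta; have mU' := measurable_above ceta.
rewrite -bal; last exact: test_fun_field.
rewrite !momentum_field// (Rintegral_field_vert_below ceta etah hN).
by rewrite (Rintegral_field_vert_above ceta etah hN); ring.
Qed.

End truncated_balance.

Lemma decaysS {R : realType} n (D E : set 'rV[R]_n) a (f : 'rV[R]_n -> R) :
  D `<=` E -> decays E a f -> decays D a f.
Proof. by move=> DE [C [r hf]]; exists C, r => x /DE; exact: hf. Qed.

(* The dimension is n = m + 1. *)
Theorem theorem1p2 (R : realType) (m : nat) (hm : m = 1%N \/ m = 2%N)
  (g sigma : R) (hg : 0 < g) (hsigma : 0 <= sigma)
  (c : 'rV[R]_m.+1) (hc : vert c = 0)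
  (eta : 'rV[R]_m -> R) (u : 'rV[R]_m.+1 -> 'rV[R]_m.+1)
  (P : 'rV[R]_m.+1 -> R)
  (eps : R) (heps : 0 < eps < 1 / 4)
  (heta : C2_bdd eta)
  (heta_decay : forall s : seq 'I_m, (size s <= 1)%N ->
     decays setT (m%:R + (size s)%:R + 4 * eps) (pderivs s eta))
  (hwave :
     (caseI g sigma c eta u P /\
      decays (below eta) (m%:R + eps) (fun x => enorm (u x))) \/
     (caseII g sigma c eta u P /\
      decays (below eta `|` above eta) (m%:R + eps) (fun x => enorm (u x)))) :
  (((forall x', 0 <= eta x') \/ (forall x', eta x' <= 0)) ->
     forall x', eta x' = 0) /\
  ((@lebesgue_rV R m).-integrable setT (EFin \o eta) /\
   (\int[@lebesgue_rV R m]_x' eta x')%R = 0).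
Proof.
case: m hm c hc eta u P heta heta_decay hwave => [|m] hm c hc eta u P heta heta_decay hwave.
  by case: hm.
have [Ceta bdd] := heta; have ceta : continuous eta by exact: class_C_continuous Ceta.
have [h etah] := bdd [::] isT.
have /andP[eps0 _] := heps; have eps4 : 0 < 4 * eps by rewrite mulr_gt0.
have Ieta : (@lebesgue_rV R m.+1).-integrable setT (EFin \o eta).
  have := heta_decay [::] isT; apply: decays_integrable => //=.
  - by exists h.
  - by rewrite addr0 ltrDl.
(* The decay rate of grad eta; from here on m stands for n - 2. *)
have mb : m.+1%:R < m.+1%:R + 1%:R + 4 * eps by rewrite -addrA ltrDl addr_gt0.
have dec i : decays setT (m.+1%:R + 1%:R + 4 * eps) (pderiv i eta).
  exact: heta_decay [:: i] isT.
suff I0 : (\int[@lebesgue_rV R m.+1]_x' eta x')%R = 0.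
  by split; [exact: one_signed_integral_eq0|split].
have mb_ := measurable_below ceta; have ma_ := measurable_above ceta.
case: hwave => [[wave udec]|[[rho_m [rho_p [[rm0 rp0 rmp] _ fluid bal]]] udec]].
- have g0 : g != 0 by rewrite gt_eqF.
  have flux0 Xi : admissible Xi (below eta) u P ->
      (\int[@lebesgue_rV R m.+2]_(x in below eta)
         contract (stress c u) (field 0 N%:R) x)%R @[N --> \oo] --> (0 : R).
    move=> adm; apply: (contract_far c mb_ eps0 _ udec) => i.
    exact: (measurable_velocity mb_ adm).
  have IA : one_fluid g sigma c set0 eta u P ->
      (\int[@lebesgue_rV R m.+1]_x' eta x')%R = 0.
    move=> [_ adm _ bal]; apply: (mass_eq0 Ceta etah g0 mb dec Ieta (flux0 _ adm)).
    near=> N; apply: (balance_one_fluid Ceta etah _ adm bal).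
    by near: N; exact: nbhs_infty_gtr.
  (* m = 1 is the space case, which has no point vortices; m = 0 leaves the two planar cases. *)
  case: hm => -[hm]; subst m; last by case: wave => /IA.
  case: wave => [[/IA//]|[M [xi [vpi [w [[xi_inj xi_below] [_ adm div0 bal] _ _ vort]]]]]].
  apply: (mass_eq0 Ceta etah g0 mb dec Ieta (flux0 _ adm)).
  near=> N.
  apply: (balance_vortices ceta hc xi_inj xi_below adm div0 etah _ _ vort bal).
    by near: N; exact: nbhs_infty_gtr.
  by near: N; apply: filter_forall => k; exact: nbhs_infty_gtr.
- have k0 : (rho_m - rho_p) * g != 0 by rewrite mulf_neq0 ?subr_eq0// gt_eqF.
  have [adm _ _] := fluid _ (or_introl erefl).
  have [adp _ _] := fluid _ (or_intror erefl).
  have flux0 U : U `<=` below eta `|` above eta -> measurable U -> admissible set0 U u P ->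
      (\int[@lebesgue_rV R m.+2]_(x in U)
         contract (stress c u) (field 0 N%:R) x)%R @[N --> \oo] --> (0 : R).
    move=> UE mU adU; apply: (contract_far c mU eps0 _ (decaysS UE udec)) => i.
    exact: (measurable_velocity mU adU).
  have F0 : (fun N : nat =>
     rho_m * (\int[@lebesgue_rV R m.+2]_(x in below eta) contract (stress c u) (field 0 N%:R) x)%R +
     rho_p * (\int[@lebesgue_rV R m.+2]_(x in above eta) contract (stress c u) (field 0 N%:R) x)%R)
     @ \oo --> (0 : R).
    have := cvgD (cvgM (cvg_cst rho_m) (flux0 _ (@subsetUl _ _ _) mb_ adm))
      (cvgM (cvg_cst rho_p) (flux0 _ (@subsetUr _ _ _) ma_ adp)).
    by rewrite !mulr0 addr0; exact.
  apply: (mass_eq0 Ceta etah k0 mb dec Ieta F0).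
  near=> N; apply: (balance_two_fluids Ceta etah _ adm adp bal).
  by near: N; exact: nbhs_infty_gtr.
Unshelve. all: by end_near. Qed.
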